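(* Fix a real number $\vartheta$ with $0<\vartheta<1$ and a constant $A>0$. Then there exist $x_0$ and $C>0$ (depending on $\vartheta$ and $A$) such that for all real $x\ge x_0$ and all real $z>0$ with $|\log z|\le A\log\log x$, \[ \left|S_\vartheta(zx)-z^{\vartheta}S_\vartheta(x)\right|\le C\,z^{\vartheta}S_\vartheta(x)\sqrt{\frac{\log\log x}{\log x}}. \]
   Context: For a natural number $m$, let $k(m)$ denote the largest square-free divisor of $m$. For $\vartheta>0$ and real $x\ge 1$, let $S_\vartheta(x)$ be the number of natural numbers $m\le x$ with $k(m)\le m^{\vartheta}$. *)

(* Defs.v *)
From mathcomp Require Import all_boot.
From Stdlib Require Import Reals.

Definition sqfree_kernel (m : nat) : nat := \prod_(p <- primes m) p.

(* S_theta(x) = #{ m natural, 1 <= m <= x : k(m) <= m^theta }.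
   Candidates m range over 1 .. up x (up x > x), filtered by INR m <= x. *)
Definition S_count (theta x : R) : nat :=
  count (fun m : nat =>
           (if Rle_dec (INR m) x then true else false) &&
           (if Rle_dec (INR (sqfree_kernel m)) (Rpower (INR m) theta)
            then true else false))
        (iota 1 (Z.to_nat (up x))).

(* Main.v *)
(** Write [m = d * k(d) * l] with [l] square-free and coprime to [d].  Summing over [l] turns
    [S_theta(x)] into [c x^theta H(X)] with [X = x^(1 - theta)], where [H(X)] is the sum of
    [w(d) g(d / X)] over [d], with [w(d) = prod_(p | d) 1 / (p + 1)], [al = theta / (1 - theta)] and
    [g(u) = min (u^al, 1 / u)].  It remains to show that [H] varies slowly: a dilation by a power
    of [v = log X] changes it by a factor [1 + O(eps)], [eps = sqrt (log v / v)].

    Comparing the integers divisible by [p] at [X] and at [pX] gives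
    [H(pX) - H(X) = H_p(pX) - (1 - 1 / (p + 1)) H_p(X)], where [H_p] runs over [d] prime to [p].
    With Chebyshev bounds this identity (for the unweighted sums [W]) shows that [log W] grows by
    about one when [log X] grows by [M = sqrt (v log v)], so that [H_p] is a small part of [H] and
    [H] is nearly constant along small integer dilations.  Interpolation to real dilations gives
    [H_p(tX) >= (1 - O(sqrt eps)) H_p(X)]; fed back into the identity, this yields
    [H(pX) >= H(X)] exactly, for all primes [p] up to a multiple of [1 / sqrt eps].  Hence
    interpolation between integers of that size costs only [O(eps)], and a preliminary shift down
    by a power of [2] (again at cost [O(eps)]) reduces every dilation to this case. *)

From Stdlib Require Import Reals Lra Lia.
From HB Require Import structures.
From mathcomp Require Import all_boot.
From mathcomp Require Import zify.
Require Import Defs.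

Set Implicit Arguments.
Unset Strict Implicit.
Unset Printing Implicit Defensive.

Open Scope R_scope.

(** The identity for [X -> pX] can lose [H_p (X)], so that dilating by an integer [n] is bounded
    here at a cost of order [eps n^2], while interpolating between integers near [n] costs [n^-2].
    The two balance at [n = eps^(-1/4)], which is why a first pass cannot beat [sqrt eps]. The way
    out is the term [1 / (p + 1)] of the identity: it is a gain, and it outweighs an error
    [sqrt eps] while [p] stays below a multiple of [eps^(-1/2)], exactly the size at which
    interpolation costs [eps]. The second pass applies the first one to [H_p], whose own dilations
    remove yet another prime. Hence the modulus [e] in all estimates, with up to two prime factors
    in those on [W]. Repeated halving of [X] must not cost [eps] each time: the losses are first
    summed over all scales, and the kernel makes the sum as small as a single loss. Upper bounds
    come from lower bounds by closing a cycle of dilations. Everything happens at one scale [v].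
    Sums are cut at [d <= X T] with [T = v^B], and the density of the square-free integers enters as
    a finite product shared by [x] and [zx]. *)

Local Notation rad := sqfree_kernel.

HB.instance Definition _ := Monoid.isComLaw.Build R 0 Rplus
  (fun x y z => esym (Rplus_assoc x y z)) Rplus_comm Rplus_0_l.
HB.instance Definition _ := Monoid.isComLaw.Build R 1 Rmult
  (fun x y z => esym (Rmult_assoc x y z)) Rmult_comm Rmult_1_l.
HB.instance Definition _ := Monoid.isMulLaw.Build R 0 Rmult Rmult_0_l Rmult_0_r.
HB.instance Definition _ := Monoid.isAddLaw.Build R Rmult Rplus
  (fun x y z => Rmult_plus_distr_r x y z) (fun x y z => Rmult_plus_distr_l x y z).

Notation "\rsum_ ( i <- r | P ) F" := (\big[Rplus/0]_(i <- r | P%B) F)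
  (at level 41, F at level 41, i, r at level 50).
Notation "\rsum_ ( i <- r ) F" := (\big[Rplus/0]_(i <- r) F)
  (at level 41, F at level 41, i, r at level 50).

Notation "\rprod_ ( i <- r ) F" := (\big[Rmult/1]_(i <- r) F)
  (at level 41, F at level 41, i, r at level 50).

(** * Finite sums of real numbers *)

Lemma rsum_le (I : eqType) (r : seq I) (P : pred I) (F G : I -> R) :
  (forall i, i \in r -> P i -> F i <= G i) ->
  \rsum_(i <- r | P i) F i <= \rsum_(i <- r | P i) G i.
Proof.
elim: r => [|i r IH] H; first by rewrite !big_nil; lra.
have IHr : \rsum_(j <- r | P j) F j <= \rsum_(j <- r | P j) G j.
  by apply: IH => j jr; apply: H; rewrite inE jr orbT.
rewrite !big_cons; case: ifP => // Pi.
by have := H i (mem_head _ _) Pi; lra.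
Qed.

Lemma rsum_ge0 (I : eqType) (r : seq I) (P : pred I) (F : I -> R) :
  (forall i, i \in r -> P i -> 0 <= F i) -> 0 <= \rsum_(i <- r | P i) F i.
Proof.
move=> H; apply: (Rle_trans _ (\rsum_(i <- r | P i) 0)).
  by rewrite big1 //; lra.
exact: rsum_le.
Qed.

Lemma rsum_scal (I : Type) (r : seq I) (P : pred I) (F : I -> R) c :
  \rsum_(i <- r | P i) (c * F i) = c * \rsum_(i <- r | P i) F i.
Proof. by rewrite big_distrr. Qed.

Lemma rsum_const (I : Type) (r : seq I) (P : pred I) c :
  \rsum_(i <- r | P i) c = INR (count P r) * c.
Proof.
elim: r => [|i r IH]; first by rewrite big_nil /=; lra.
rewrite big_cons IH /=; case: (P i); rewrite ?add1n ?add0n ?S_INR; lra.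
Qed.

Lemma rsum_sub_pred (I : eqType) (r : seq I) (P Q : pred I) (F : I -> R) :
  (forall i, i \in r -> P i -> Q i) -> (forall i, i \in r -> Q i -> 0 <= F i) ->
  \rsum_(i <- r | P i) F i <= \rsum_(i <- r | Q i) F i.
Proof.
elim: r => [|i r IH] HPQ HF; first by rewrite !big_nil; lra.
have IHr : \rsum_(j <- r | P j) F j <= \rsum_(j <- r | Q j) F j.
  by apply: IH => j jr; [apply: HPQ | apply: HF]; rewrite inE jr orbT.
rewrite !big_cons; case Pi: (P i); first by rewrite (HPQ i (mem_head _ _) Pi); lra.
case Qi: (Q i) => //.
by have := HF i (mem_head _ _) Qi; lra.
Qed.

(** Charging argument: [F i] is paid by [G (phi i)], and no [j] is charged more than [K] times. *)
Lemma rsum_le_fiber (I J : eqType) (r : seq I) (s : seq J) (P : pred I) (Q : pred J)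
    (phi : I -> J) (F : I -> R) (G : J -> R) (K : R) :
  uniq s ->
  (forall i, i \in r -> P i -> [/\ phi i \in s, Q (phi i) & F i <= G (phi i)]) ->
  (forall j, j \in s -> Q j -> 0 <= G j) ->
  (forall j, j \in s -> Q j -> INR (count (fun i => P i && (phi i == j)) r) <= K) ->
  \rsum_(i <- r | P i) F i <= K * \rsum_(j <- s | Q j) G j.
Proof.
move=> us H1 H2 H3.
apply: (Rle_trans _ (\rsum_(i <- r | P i) \rsum_(j <- s | Q j && (phi i == j)) G j)).
  apply: rsum_le => i ir Pi; have [ps Qp le] := H1 i ir Pi.
  rewrite big_mkcond (bigD1_seq (phi i)) //= Qp eqxx /= big1; first by lra.
  by move=> j /negPf jne; rewrite [phi i == j]eq_sym jne andbF.
rewrite (eq_bigr (fun i => \rsum_(j <- s | Q j) (if phi i == j then G j else 0))); last first.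
  by move=> i _; rewrite big_mkcondr.
rewrite exchange_big /= -rsum_scal.
apply: rsum_le => j js Qj.
rewrite -big_mkcondr rsum_const.
by apply: Rmult_le_compat_r; [exact: H2|exact: H3].
Qed.

Lemma rsum_le_inj (I J : eqType) (r : seq I) (s : seq J) (P : pred I) (Q : pred J)
    (phi : I -> J) (F : I -> R) (G : J -> R) :
  uniq r -> uniq s ->
  (forall i, i \in r -> P i -> [/\ phi i \in s, Q (phi i) & F i <= G (phi i)]) ->
  (forall i i', i \in r -> i' \in r -> P i -> P i' -> phi i = phi i' -> i = i') ->
  (forall j, j \in s -> Q j -> 0 <= G j) ->
  \rsum_(i <- r | P i) F i <= \rsum_(j <- s | Q j) G j.
Proof.
move=> ur us H1 Hinj H2; rewrite -[X in _ <= X]Rmult_1_l.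
apply: (rsum_le_fiber (phi := phi)) => // j js Qj.
apply: (le_INR _ 1); apply/leP; rewrite -size_filter.
case E: [seq i <- r | P i && (phi i == j)] => [//|a [//|b l]].
have ul : uniq [seq i <- r | P i && (phi i == j)] by exact: filter_uniq.
have : a \in [seq i <- r | P i && (phi i == j)] by rewrite E mem_head.
have : b \in [seq i <- r | P i && (phi i == j)] by rewrite E !inE eqxx orbT.
rewrite !mem_filter => /andP[/andP[Pb /eqP Eb] br] /andP[/andP[Pa /eqP Ea] ar].
by move: ul; rewrite E /= (Hinj a b) ?Ea ?Eb // inE eqxx.
Qed.

Lemma rsum_le_incl (I : eqType) (r s : seq I) (P Q : pred I) (F G : I -> R) :
  uniq r -> uniq s ->
  (forall i, i \in r -> P i -> [/\ i \in s, Q i & F i <= G i]) ->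
  (forall i, i \in s -> Q i -> 0 <= G i) ->
  \rsum_(i <- r | P i) F i <= \rsum_(i <- s | Q i) G i.
Proof.
move=> ur us H1 H2.
exact (@rsum_le_inj I I r s P Q (fun i => i) F G ur us H1 (fun i i' _ _ _ _ ii' => ii') H2).
Qed.

(** * Positive integers up to a real bound *)

Definition Rleb (x y : R) : bool := if Rle_dec x y then true else false.

Lemma RlebP x y : reflect (x <= y) (Rleb x y).
Proof. by rewrite /Rleb; case: Rle_dec => H; constructor. Qed.

(** The same enumeration as in [S_count]: [up Y] exceeds [Y], so no candidate is missed, and the
    filter leaves the list empty for [Y < 1]. *)
Definition upto (Y : R) : seq nat :=
  [seq d <- iota 1 (Z.to_nat (up Y)) | Rleb (INR d) Y].

Lemma mem_upto Y d : (d \in upto Y) = (0 < d)%N && Rleb (INR d) Y.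
Proof.
rewrite mem_filter mem_iota andbC; case: (RlebP (INR d) Y) => [le|]; last by rewrite !andbF.
rewrite !andbT; apply: andb_idr => d0.
have [upY _] := archimed Y.
have : (Z.of_nat d < up Y)%Z by apply: lt_IZR; rewrite -INR_IZR_INZ; lra.
by lia.
Qed.

Lemma uptoP Y d : reflect ((0 < d)%N /\ INR d <= Y) (d \in upto Y).
Proof.
rewrite mem_upto; apply: (iffP andP) => [[d0 /RlebP H]|[d0 H]]; split => //.
by apply/RlebP.
Qed.

Lemma upto_uniq Y : uniq (upto Y).
Proof. by rewrite filter_uniq // iota_uniq. Qed.

Lemma INR_ge1 d : (0 < d)%N -> 1 <= INR d.
Proof. by move=> d0; apply: (le_INR 1); apply/leP. Qed.

Lemma INR_gt0 d : (0 < d)%N -> 0 < INR d.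
Proof. by move=> /INR_ge1; lra. Qed.

Lemma INR_mul m n : INR (m * n)%N = INR m * INR n.
Proof. exact: mult_INR. Qed.

Lemma INR_exp m n : INR (m ^ n)%N = INR m ^ n.
Proof. by elim: n => [|n IH] //; rewrite expnS INR_mul IH. Qed.

Lemma Rle_div_l' a b c : 0 < c -> (a <= b / c <-> c * a <= b).
Proof.
move=> c0; split => H.
  have := Rmult_le_compat_l c _ _ (Rlt_le _ _ c0) H.
  by have -> : c * (b / c) = b by field; lra.
apply: (Rmult_le_reg_l c) => //.
by have -> : c * (b / c) = b by field; lra.
Qed.

Lemma sum_multiples (n : nat) (Y : R) (P : pred nat) (F : nat -> R) :
  (0 < n)%N ->
  \rsum_(d <- upto Y | (n %| d)%N && P d) F d =
  \rsum_(d <- upto (Y / INR n) | P (n * d)%N) F (n * d)%N.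
Proof.
move=> n0; rewrite -big_filter_cond -[RHS](big_map (muln n) P F).
apply: perm_big; apply: uniq_perm.
- by rewrite filter_uniq // upto_uniq.
- rewrite map_inj_uniq ?upto_uniq // => a b /eqP.
  by rewrite eqn_pmul2l // => /eqP.
move=> d; rewrite mem_filter; apply/andP/mapP.
- move=> [/dvdnP[k ->]] /uptoP[kn0 le]; exists k; last by rewrite mulnC.
  apply/uptoP; split; first by case: k kn0 le.
  by apply/Rle_div_l'; [exact: INR_gt0 | rewrite -INR_mul mulnC].
- move=> [k /uptoP[k0 le] ->]; rewrite dvdn_mulr //; split => //.
  apply/uptoP; rewrite muln_gt0 n0 k0; split => //.
  by rewrite INR_mul; apply/Rle_div_l' => //; exact: INR_gt0.
Qed.

Lemma nat_floor y : 0 <= y -> exists n, INR n <= y < INR n + 1.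
Proof.
move=> y0; have [h1 h2] := archimed y.
have u0 : (0 < up y)%Z by apply: lt_IZR; lra.
exists (Z.to_nat (up y - 1)); rewrite INR_IZR_INZ.
have -> : Z.of_nat (Z.to_nat (up y - 1)) = (up y - 1)%Z by lia.
by rewrite minus_IZR; lra.
Qed.

(** * The weights and their kernel sums *)

(** Among the square-free integers, those prime to [d] have relative density
    [prod_(p | d) p / (p + 1)]; [w d] is this density divided by [rad d]. *)
Definition w (d : nat) : R := \big[Rmult/1]_(p <- primes d) / (INR p + 1).

Lemma rprod_gt0 (I : eqType) (r : seq I) (F : I -> R) :
  (forall i, i \in r -> 0 < F i) -> 0 < \big[Rmult/1]_(i <- r) F i.
Proof.
elim: r => [|i r IH] H; first by rewrite big_nil; lra.
rewrite big_cons; apply: Rmult_lt_0_compat; first exact: H (mem_head _ _).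
by apply: IH => j jr; apply: H; rewrite inE jr orbT.
Qed.

Lemma w_gt0 d : 0 < w d.
Proof.
apply: rprod_gt0 => p _; apply: Rinv_0_lt_compat.
by have := pos_INR p; lra.
Qed.

Lemma w_ge0 d : 0 <= w d.
Proof. exact/Rlt_le/w_gt0. Qed.

Lemma w_coprime a b : (0 < a)%N -> (0 < b)%N -> coprime a b -> w (a * b) = w a * w b.
Proof.
move=> a0 b0 cab; rewrite /w -big_cat; apply: perm_big; apply: uniq_perm.
- exact: primes_uniq.
- by rewrite cat_uniq !primes_uniq andbT -coprime_has_primes.
by move=> p; rewrite primesM // mem_cat.
Qed.

Lemma w_prime p : prime p -> w p = / (INR p + 1).
Proof. by move=> pp; rewrite /w primes_prime // big_seq1. Qed.

Lemma w_mul_ndvd p d : prime p -> (0 < d)%N -> ~~ (p %| d)%N ->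
  w (p * d) = w d / (INR p + 1).
Proof.
move=> pp d0 pd; have cpd : coprime p d by rewrite prime_coprime.
by rewrite (w_coprime (prime_gt0 pp) d0 cpd) (w_prime pp) Rmult_comm.
Qed.

Lemma w_mul_dvd p d : prime p -> (0 < d)%N -> (p %| d)%N -> w (p * d) = w d.
Proof.
move=> pp d0 pd; rewrite /w; suff -> : primes (p * d) = primes d by [].
apply/eq_primes => q; rewrite (primesM _ (prime_gt0 pp) d0) (primes_prime pp) inE.
apply/orP/idP => [[/eqP->|//]|]; last by right.
by rewrite mem_primes pp d0.
Qed.

Lemma coprime_prime_r p d : prime p -> coprime d p = ~~ (p %| d)%N.
Proof. by move=> pp; rewrite coprime_sym prime_coprime. Qed.

(** Common form of [W] ([f = 1], [T = 1]) and of [H], so that the identity under [X -> pX] is proved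
    once. The cut-off [X * T] scales with [X], as that identity requires. *)
Definition ksum (T : R) (f : R -> R) (e : nat) (X : R) : R :=
  \rsum_(d <- upto (X * T) | coprime d e) (w d * f (INR d / X)).

Definition ksum_dvd (T : R) (f : R -> R) (e p : nat) (X : R) : R :=
  \rsum_(d <- upto (X * T) | (p %| d)%N && coprime d e) (w d * f (INR d / X)).

Lemma ksum_split T f e p X : prime p ->
  ksum T f e X = ksum T f (e * p) X + ksum_dvd T f e p X.
Proof.
move=> pp; rewrite /ksum /ksum_dvd (bigID (fun d => p %| d)%N) /= Rplus_comm.
congr (_ + _).
  by apply: eq_bigl => d; rewrite coprimeMr (coprime_prime_r _ pp).
by apply: eq_bigl => d; rewrite andbC.
Qed.

(** Put [d = p d']: the ratio [d / (pX)] becomes [d' / X]. If [p] divides [d'] the weight is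
    unchanged, otherwise it drops by the factor [p + 1]. *)
Lemma ksum_dvd_shift T f e p X : prime p -> coprime p e ->
  ksum_dvd T f e p (INR p * X) =
  ksum_dvd T f e p X + ksum T f (e * p) X / (INR p + 1).
Proof.
move=> pp cpe; have p0 := INR_gt0 (prime_gt0 pp).
rewrite /ksum_dvd (sum_multiples _ _ _ (prime_gt0 pp)).
have -> : INR p * X * T / INR p = X * T by field; lra.
rewrite (bigID (fun d => p %| d)%N) /=; congr (_ + _).
- rewrite (eq_bigl (fun d => (p %| d)%N && coprime d e)); last first.
    by move=> d; rewrite coprimeMl cpe andbC.
  rewrite big_seq_cond [RHS]big_seq_cond; apply: eq_bigr => d.
  move=> /andP[/uptoP[d0 _] /andP[pd _]]; rewrite w_mul_dvd // INR_mul.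
  by rewrite Rdiv_mult_l_l //; lra.
- rewrite /ksum [RHS]Rmult_comm -rsum_scal.
  rewrite (eq_bigl (fun d => coprime d (e * p))); last first.
    by move=> d; rewrite coprimeMl cpe coprimeMr (coprime_prime_r _ pp).
  rewrite big_seq_cond [RHS]big_seq_cond; apply: eq_bigr => d.
  move=> /andP[/uptoP[d0 _]]; rewrite coprimeMr (coprime_prime_r _ pp).
  move=> /andP[_ pd]; rewrite w_mul_ndvd // INR_mul Rdiv_mult_l_l; last by lra.
  by rewrite /Rdiv; ring.
Qed.

Lemma ksum_ge0 T f e X : (forall u, 0 <= f u) -> 0 <= ksum T f e X.
Proof. by move=> f0; apply: rsum_ge0 => d _ _; apply: Rmult_le_pos => //; exact: w_ge0. Qed.

Lemma ksum_dvd_ge0 T f e p X : (forall u, 0 <= f u) -> 0 <= ksum_dvd T f e p X.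
Proof. by move=> f0; apply: rsum_ge0 => d _ _; apply: Rmult_le_pos => //; exact: w_ge0. Qed.

Definition W (e : nat) (Y : R) : R := ksum 1 (fun=> 1) e Y.
Definition V (e p : nat) (Y : R) : R := ksum_dvd 1 (fun=> 1) e p Y.

Lemma WE e Y : W e Y = \rsum_(d <- upto Y | coprime d e) w d.
Proof. by rewrite /W /ksum Rmult_1_r; apply: eq_bigr => d _; rewrite Rmult_1_r. Qed.

Lemma VE e p Y : V e p Y = \rsum_(d <- upto Y | (p %| d)%N && coprime d e) w d.
Proof. by rewrite /V /ksum_dvd Rmult_1_r; apply: eq_bigr => d _; rewrite Rmult_1_r. Qed.

Lemma W_ge0 e Y : 0 <= W e Y.
Proof. by apply: ksum_ge0 => _; lra. Qed.

Lemma V_ge0 e p Y : 0 <= V e p Y.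
Proof. by apply: ksum_dvd_ge0 => _; lra. Qed.

Lemma W_mono e Y Y' : Y <= Y' -> W e Y <= W e Y'.
Proof.
move=> le; rewrite !WE; apply: rsum_le_incl; rewrite ?upto_uniq //.
- move=> d /uptoP[d0 dY] cd; split => //; last by lra.
  by apply/uptoP; split => //; lra.
- by move=> d _ _; exact: w_ge0.
Qed.

Lemma V_mono e p Y Y' : Y <= Y' -> V e p Y <= V e p Y'.
Proof.
move=> le; rewrite !VE; apply: rsum_le_incl; rewrite ?upto_uniq //.
- move=> d /uptoP[d0 dY] cd; split => //; last by lra.
  by apply/uptoP; split => //; lra.
- by move=> d _ _; exact: w_ge0.
Qed.

Lemma W_lt1 e Y : Y < 1 -> W e Y = 0.
Proof.
move=> Y1; rewrite WE big_seq_cond big1 // => d /andP[/uptoP[/INR_ge1 d0 le] _]; lra.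
Qed.

Lemma V_le_W e p Y : V e p Y <= W e Y.
Proof.
rewrite WE VE; apply: rsum_sub_pred => d _; first by case/andP.
by move=> _; exact: w_ge0.
Qed.

Lemma W_split e p Y : prime p -> W e Y = W (e * p) Y + V e p Y.
Proof. exact: ksum_split. Qed.

Lemma W_mul_le e p Y : prime p -> W (e * p) Y <= W e Y.
Proof. by move=> pp; rewrite (W_split e Y pp); have := V_ge0 e p Y; lra. Qed.

Lemma V_shift e p Y : prime p -> coprime p e ->
  V e p Y = V e p (Y / INR p) + W (e * p) (Y / INR p) / (INR p + 1).
Proof.
move=> pp cpe; rewrite -ksum_dvd_shift // -/(V e p _); congr (V _ _ _).
by field; have := INR_gt0 (prime_gt0 pp); lra.
Qed.

(** Reads off [V] from the values of [W] at the scales [Y / p^j]; both the lower and the upper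
    growth bounds for [W] rest on this expansion. *)
Lemma V_iter e p Y J : prime p -> coprime p e ->
  V e p Y = V e p (Y / INR p ^ J) +
            \rsum_(j <- iota 1 J) (W (e * p) (Y / INR p ^ j) / (INR p + 1)).
Proof.
move=> pp cpe; have p0 := INR_gt0 (prime_gt0 pp).
elim: J => [|J IH]; first by rewrite big_nil /= Rdiv_1_r; lra.
rewrite -addn1 iotaD big_cat /= big_seq1 add1n addn1 {1}IH.
rewrite (V_shift _ pp cpe).
have -> : Y / INR p ^ J / INR p = Y / INR p ^ J.+1.
  by rewrite /= /Rdiv Rinv_mult; ring.
by ring.
Qed.

(** * Chebyshev-type bounds *)

Lemma bin_le_exp2 n m : ('C(n, m) <= 2 ^ n)%N.
Proof.
elim: n m => [|n IH] [|m] //; rewrite ?bin0 ?expn_gt0 //.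
by rewrite binS expnS mul2n -addnn leq_add.
Qed.

Lemma prime_dvd_fact p n : prime p -> (p %| n`!)%N -> (p <= n)%N.
Proof.
move=> pp; elim: n => [|n IH]; first by rewrite fact0 Euclid_dvd1.
rewrite factS Euclid_dvdM // => /orP[/dvdn_leq->//|/IH]; exact: leqW.
Qed.

Lemma prod_primes_dvd (s : seq nat) m :
  uniq s -> (forall p, p \in s -> prime p && (p %| m)%N) -> (\prod_(p <- s) p %| m)%N.
Proof.
elim: s => [|p s IH]; first by rewrite big_nil dvd1n.
rewrite cons_uniq => /andP[ps us] H.
have /andP[pp pm] := H p (mem_head _ _).
have H' q : q \in s -> prime q && (q %| m)%N by move=> qs; apply: H; rewrite inE qs orbT.
have cop : coprime p (\prod_(q <- s) q).
  rewrite prime_coprime // Euclid_dvd_prod // big_has; apply/hasPn => q qs /=.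
  have /andP[pq _] := H' q qs.
  by rewrite dvdn_prime2 //; apply: contraNneq ps => ->.
by rewrite big_cons Gauss_dvd // pm IH.
Qed.

(** Chebyshev's argument with [n = 2^k]: every prime in [(n, 2n]] divides the central binomial
    coefficient, which is at most [4^n], while the product of these primes is at least [n] to the
    power of their number. *)
Lemma dyadic_prime_count k :
  (k * count prime (iota (2 ^ k).+1 (2 ^ k)) <= 2 ^ k.+1)%N.
Proof.
set n := (2 ^ k)%N; set s := [seq p <- iota n.+1 n | prime p].
have Hs p : p \in s -> prime p && (p %| 'C(n.*2, n))%N.
  rewrite mem_filter mem_iota => /andP[pp /andP[np pn]]; rewrite pp /=.
  have le2 : (n <= n.*2)%N by rewrite -addnn leq_addr.
  have pf : (p %| n.*2`!)%N.
    by rewrite dvdn_fact // prime_gt0 //= -addnn; move: pn; rewrite addSn ltnS.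
  move: pf; rewrite -(bin_fact le2) -addnn addnK Euclid_dvdM // => /orP[//|].
  by rewrite Euclid_dvdM // orbb => /(prime_dvd_fact pp); rewrite leqNgt np.
have pd : (\prod_(p <- s) p %| 'C(n.*2, n))%N.
  by apply: prod_primes_dvd => //; rewrite filter_uniq // iota_uniq.
have lep : (\prod_(p <- s) p <= 2 ^ n.*2)%N.
  apply: leq_trans (bin_le_exp2 _ n); apply: dvdn_leq pd.
  by rewrite bin_gt0 -addnn leq_addr.
have gep : (n ^ size s <= \prod_(p <- s) p)%N.
  have : all (leq n) s.
    by apply/allP => p; rewrite mem_filter mem_iota => /andP[_ /andP[/ltnW]].
  elim: (s) => [|p r IH] //=; first by rewrite big_nil.
  by move=> /andP[np /IH le]; rewrite big_cons expnS leq_mul.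
move: (leq_trans gep lep); rewrite -expnM leq_exp2l // size_filter.
by rewrite /n expnS mul2n.
Qed.

Lemma rsum_nat_rec (f : nat -> R) a b : (a <= b)%N ->
  \rsum_(k <- iota a (b.+1 - a)) f k = \rsum_(k <- iota a (b - a)) f k + f b.
Proof.
move=> ab; rewrite subSn // -addn1 iotaD big_cat /= big_seq1; congr (_ + f _).
by rewrite subnKC.
Qed.

(** Partial summation in dyadic blocks: the block [(2^k, 2^(k+1)]] has at most [2^(k+1) / k]
    primes. *)
Lemma dyadic_prime_sum (f F : nat -> R) a b :
  (1 <= a <= b)%N ->
  (forall k p, (a <= k < b)%N -> prime p -> (2 ^ k < p <= 2 ^ k.+1)%N -> f p <= F k) ->
  (forall k, (a <= k < b)%N -> 0 <= F k) ->
  \rsum_(p <- iota (2 ^ a).+1 (2 ^ b - 2 ^ a) | prime p) f p <=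
  \rsum_(k <- iota a (b - a)) (2 ^ k.+1 / INR k * F k).
Proof.
move=> /andP[a1]; elim: b => [|b IH]; first by case: a a1.
rewrite leq_eqVlt => /orP[/eqP<- _ _|]; first by rewrite !subnn /= !big_nil; lra.
rewrite ltnS => ab Hf HF.
have ex : (2 ^ a <= 2 ^ b)%N by rewrite leq_exp2l.
have -> : (2 ^ b.+1 - 2 ^ a = (2 ^ b - 2 ^ a) + 2 ^ b)%N.
  by rewrite expnS mul2n -addnn -addnBAC.
rewrite iotaD big_cat /= rsum_nat_rec //.
have -> : ((2 ^ a).+1 + (2 ^ b - 2 ^ a) = (2 ^ b).+1)%N by rewrite addSn subnKC.
apply: Rplus_le_compat.
  apply: IH => // [k p|k] /andP[ak kb]; [apply: Hf | apply: HF]; rewrite ak /=; exact: ltnW.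
apply: (Rle_trans _ (\rsum_(p <- iota (2 ^ b).+1 (2 ^ b) | prime p) F b)).
  apply: rsum_le => p; rewrite mem_iota => /andP[p1 p2] pp; apply: Hf => //.
    by rewrite ab leqnn.
  by rewrite p1 /= expnS mul2n -addnn -ltnS -addSn.
rewrite rsum_const; apply: Rmult_le_compat_r; first by apply: HF; rewrite ab leqnn.
have b0 : 0 < INR b by apply: INR_gt0; exact: leq_trans ab.
apply: (Rmult_le_reg_l (INR b)) => //.
have -> : INR b * (2 ^ b.+1 / INR b) = 2 ^ b.+1 by field; lra.
rewrite -INR_mul -[2]/(INR 2) -INR_exp; apply: le_INR; apply/leP.
exact: dyadic_prime_count.
Qed.

Lemma ln_INR_ge0 n : (0 < n)%N -> 0 <= ln (INR n).
Proof.
move=> n0; rewrite -ln_1; case: (Rle_lt_or_eq_dec _ _ (INR_ge1 n0)) => [lt|<-]; last by lra.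
by apply/Rlt_le/ln_increasing; lra.
Qed.

Lemma ln_prime_gt0 p : prime p -> 0 < ln (INR p).
Proof.
move=> /prime_gt1 p1; rewrite -ln_1; apply: ln_increasing; first by lra.
by apply: (lt_INR 1); apply/ltP.
Qed.

Lemma ln_le x y : 0 < x -> x <= y -> ln x <= ln y.
Proof.
move=> x0 /Rle_lt_or_eq_dec[lt|<-]; last by lra.
by apply/Rlt_le/ln_increasing.
Qed.

Lemma ln_pow_nat x n : 0 < x -> ln (x ^ n) = INR n * ln x.
Proof. by move=> x0; rewrite ln_pow. Qed.

Lemma ln2_bounds : / 2 < ln 2 < 1.
Proof.
split; first by have := ln_lt_2; lra.
rewrite -[X in _ < X](ln_exp 1); apply: ln_increasing; first by lra.
by have := exp_ineq1 1; lra.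
Qed.

Lemma ln_dyadic_bounds k p : (1 <= k)%N -> (2 ^ k < p <= 2 ^ k.+1)%N ->
  [/\ 2 ^ k < INR p, INR p <= 2 ^ k.+1, INR k * ln 2 <= ln (INR p) &
      ln (INR p) <= INR k.+1 * ln 2].
Proof.
move=> k1 /andP[lt le].
have lt' : 2 ^ k < INR p by rewrite -[2]/(INR 2) -INR_exp; apply: lt_INR; apply/ltP.
have le' : INR p <= 2 ^ k.+1 by rewrite -[2]/(INR 2) -INR_exp; apply: le_INR; apply/leP.
have p2 : 0 < 2 ^ k by apply: pow_lt; lra.
split=> //; rewrite -ln_pow_nat; try lra; apply: ln_le; lra.
Qed.

Lemma exists_dyadic y : 2 <= y -> exists k, (1 <= k)%N /\ 2 ^ k <= y < 2 ^ k.+1.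
Proof.
move=> y2.
have [n ny] : exists n, y < 2 ^ n.
  have [yu _] := archimed y; exists (Z.to_nat (up y)).
  have yn : y < INR (Z.to_nat (up y)).
    have up0 : (0 <= up y)%Z by apply: le_IZR; lra.
    by rewrite INR_IZR_INZ; have -> : Z.of_nat (Z.to_nat (up y)) = up y by lia.
  apply: (Rlt_trans _ _ _ yn).
  by rewrite -[2]/(INR 2) -INR_exp; apply: lt_INR; apply/ltP; exact: ltn_expl.
elim: n ny => [|n IH] ny; first by move: ny => /=; lra.
case: (Rlt_dec y (2 ^ n)) => [/IH //|ge].
exists n; split; last by lra.
by case: n ny ge {IH} => //= ny ge; lra.
Qed.

Lemma sum_inv_sq a b : (1 <= a <= b)%N ->
  \rsum_(k <- iota a (b - a)) (/ (INR k * INR k)) <= 2 / INR a - 2 / INR b.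
Proof.
move=> /andP[a1]; elim: b => [|b IH]; first by case: a a1.
rewrite leq_eqVlt => /orP[/eqP<-|]; first by rewrite subnn big_nil; lra.
rewrite ltnS => ab; rewrite rsum_nat_rec //.
have := IH ab; have b1 : 1 <= INR b by apply: INR_ge1; exact: leq_trans ab.
rewrite S_INR => IHb.
suff : / (INR b * INR b) <= 2 / INR b - 2 / (INR b + 1) by lra.
apply: (Rmult_le_reg_l (INR b * INR b * (INR b + 1))); first by nra.
have -> : INR b * INR b * (INR b + 1) * (/ (INR b * INR b)) = INR b + 1 by field; lra.
have -> : INR b * INR b * (INR b + 1) * (2 / INR b - 2 / (INR b + 1)) = 2 * INR b by field; lra.
lra.
Qed.

Lemma exists_pow2_ge y : exists n, y < 2 ^ n.
Proof.
case: (Rlt_dec y 2) => [lt|ge]; first by exists 1%N => /=; lra.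
by have [k [_ [_ lt]]] := exists_dyadic (Rnot_lt_le _ _ ge); exists k.+1.
Qed.

Lemma seq_bounded_pow2 (s : seq nat) : exists n, forall p, p \in s -> INR p <= 2 ^ n.
Proof.
elim: s => [|p s [n H]]; first by exists 0%N.
have [m Hm] := exists_pow2_ge (INR p).
exists (maxn m n) => q; rewrite inE => /orP[/eqP->|/H le].
  apply: (Rle_trans _ (2 ^ m)); first by lra.
  by apply: Rle_pow; [lra | apply/leP; exact: leq_maxl].
apply: (Rle_trans _ _ _ le); apply: Rle_pow; [lra | apply/leP; exact: leq_maxr].
Qed.

(** The block [k] contributes at most [2 / (ln 2 k^2)], so the blocks from [a] on give
    [4 / (a ln 2)], and [ln y <= 2 a ln 2]. *)
Lemma sum_inv_plogp_le y (s : seq nat) :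
  2 <= y -> uniq s -> (forall p, p \in s -> prime p /\ y < INR p) ->
  \rsum_(p <- s) (/ (INR p * ln (INR p))) <= 8 / ln y.
Proof.
move=> y2 us Hs; have [a [a1 [ya ay]]] := exists_dyadic y2.
have [n Hn] := seq_bounded_pow2 s; set b := maxn n a.
have ab : (1 <= a <= b)%N by rewrite a1 leq_maxr.
have l2 := ln2_bounds.
have a0 : 1 <= INR a by exact: INR_ge1.
pose F k := / (2 ^ k * (INR k * ln 2)).
have H := @dyadic_prime_sum (fun p => / (INR p * ln (INR p))) F a b ab.
apply: (Rle_trans _ (\rsum_(p <- iota (2 ^ a).+1 (2 ^ b - 2 ^ a) | prime p) (/ (INR p * ln (INR p))))).
  rewrite big_seq_cond; apply: rsum_le_incl; rewrite ?iota_uniq //.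
    move=> p ps _; have [pp yp] := Hs p ps; split=> //; last by lra.
    rewrite mem_iota; apply/andP; split.
      by apply/ltP/INR_lt; rewrite INR_exp -[INR 2]/2; lra.
    rewrite addSn ltnS subnKC; last by rewrite leq_exp2l // leq_maxr.
    apply/leP/INR_le; rewrite INR_exp -[INR 2]/2; apply: (Rle_trans _ _ _ (Hn p ps)).
    by apply: Rle_pow; [lra | apply/leP; exact: leq_maxl].
  move=> p _ pp; apply/Rlt_le/Rinv_0_lt_compat/Rmult_lt_0_compat; last exact: ln_prime_gt0.
  exact: INR_gt0 (prime_gt0 pp).
have Fk k : (a <= k)%N -> 1 <= INR k /\ 0 < 2 ^ k.
  by move=> ak; split; [apply: INR_ge1; exact: leq_trans ak | apply: pow_lt; lra].
apply: (Rle_trans _ _ _ (H _ _)).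
- move=> k p /andP[ak kb] pp kp; have [k1 k2] := Fk k ak.
  have [h1 h2 h3 h4] := ln_dyadic_bounds (leq_trans a1 ak) kp.
  rewrite /F; apply: Rinv_le_contravar; first by apply: Rmult_lt_0_compat; nra.
  by apply: Rmult_le_compat; nra.
- move=> k /andP[ak kb]; have [k1 k2] := Fk k ak.
  by apply/Rlt_le/Rinv_0_lt_compat/Rmult_lt_0_compat; nra.
rewrite big_seq_cond.
rewrite (eq_bigr (fun k => 2 / ln 2 * / (INR k * INR k))); last first.
  move=> k /andP[]; rewrite mem_iota => /andP[ak _] _; have [k1 k2] := Fk k ak.
  by rewrite /F /=; field; lra.
rewrite -big_seq_cond rsum_scal; have := sum_inv_sq ab => hs.
have b0 : 1 <= INR b by apply: INR_ge1; exact: leq_trans a1 (leq_maxr _ _).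
have ib : 0 < / INR b by apply: Rinv_0_lt_compat; lra.
have lny : ln y <= 2 * INR a * ln 2.
  apply: (Rle_trans _ (ln (2 ^ a.+1))); first by apply: ln_le; lra.
  by rewrite ln_pow_nat; [rewrite S_INR; nra | lra].
have lny0 : 0 < ln y by rewrite -ln_1; apply: ln_increasing; lra.
apply: (Rle_trans _ (2 / ln 2 * (2 / INR a))).
  apply: Rmult_le_compat_l; first by apply: Rlt_le; apply: Rdiv_lt_0_compat; lra.
  by apply: (Rle_trans _ _ _ hs); rewrite /Rdiv; lra.
have -> : 2 / ln 2 * (2 / INR a) = 8 / (2 * INR a * ln 2) by field; lra.
by apply: Rmult_le_compat_l; [lra | apply: Rinv_le_contravar].
Qed.

Lemma sum_pow2_over_le K : (1 <= K)%N ->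
  \rsum_(k <- iota 1 (K.+1 - 1)) (2 ^ k.+1 / INR k * 1) <= 16 * (2 ^ K / INR K).
Proof.
case: K => [//|[_|K _]]; first by rewrite /= big_seq1 /=; lra.
(* The induction step fails from 1 to 2, so 2 is a second base case. *)
elim: K => [|K IH]; first by rewrite /= big_cons big_seq1 /=; lra.
rewrite rsum_nat_rec //.
apply: (Rle_trans _ _ _ (Rplus_le_compat_r _ _ _ IH)).
rewrite !S_INR -!tech_pow_Rmult; have K0 := pos_INR K.
have p0 : 0 < 2 ^ K by apply: pow_lt; lra.
set a := INR K in K0 *; set t := 2 ^ K in p0 *.
have -> : 16 * (2 * (2 * t) / (a + 1 + 1)) + 2 * (2 * (2 * (2 * t))) / (a + 1 + 1 + 1) * 1
  = 16 * t * (4 / (a + 2) + 1 / (a + 3)) by field; lra.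
have -> : 16 * (2 * (2 * (2 * t)) / (a + 1 + 1 + 1)) = 16 * t * (8 / (a + 3)) by field; lra.
apply: Rmult_le_compat_l; first by lra.
apply: (Rmult_le_reg_l ((a + 2) * (a + 3))); first by nra.
have -> : (a + 2) * (a + 3) * (4 / (a + 2) + 1 / (a + 3)) = 4 * (a + 3) + (a + 2) by field; lra.
have -> : (a + 2) * (a + 3) * (8 / (a + 3)) = 8 * (a + 2) by field; lra.
lra.
Qed.

(** The prime 2 stands alone because the block bound [2^(k+1) / k] makes sense only for [k >= 1],
    that is, above 2. *)
Lemma primes_upto_dyadic y K (s : seq nat) (f : nat -> R) :
  y < 2 ^ K.+1 -> uniq s -> (forall p, p \in s -> prime p /\ INR p <= y) ->
  (forall p, prime p -> 0 <= f p) ->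
  \rsum_(p <- s) f p <=
  f 2%N + \rsum_(p <- iota (2 ^ 1).+1 (2 ^ K.+1 - 2 ^ 1) | prime p) f p.
Proof.
move=> yK us Hs f0.
apply: (Rle_trans _ (\rsum_(p <- (2%N :: iota (2 ^ 1).+1 (2 ^ K.+1 - 2 ^ 1)) | prime p) f p)); last first.
  by rewrite big_cons /=; lra.
apply: rsum_le_incl => //.
- by rewrite cons_uniq iota_uniq mem_iota.
- move=> p ps _; have [pp py] := Hs p ps; split => //; last by lra.
  have p1 := prime_gt1 pp; rewrite inE mem_iota.
  case: (ltnP 2 p) => [p2|]; last first.
    by move=> p2; apply/orP; left; rewrite eqn_leq p2.
  apply/orP; right; apply/andP; split; first by [].
  rewrite addSn ltnS subnKC; last by rewrite leq_exp2l.
  by apply/leP/INR_le; rewrite INR_exp -[INR 2]/2; lra.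
- by move=> p _; exact: f0.
Qed.

Lemma prime_count_le y (s : seq nat) :
  2 <= y -> uniq s -> (forall p, p \in s -> prime p /\ INR p <= y) ->
  INR (size s) <= 40 * (y / ln y).
Proof.
move=> y2 us Hs; have [K [K1 [Ky yK]]] := exists_dyadic y2.
have l2 := ln2_bounds.
have -> : INR (size s) = \rsum_(p <- s) 1.
  by rewrite (eq_bigl predT) // rsum_const count_predT Rmult_1_r.
have f0 p : prime p -> 0 <= 1 by lra.
apply: (Rle_trans _ _ _ (primes_upto_dyadic yK us Hs f0)).
have H := @dyadic_prime_sum (fun _ => 1) (fun _ => 1) 1 K.+1 erefl.
have {}H := H (fun _ _ _ _ _ => Rle_refl 1) (fun _ _ => Rle_0_1).
have HK := sum_pow2_over_le K1.
have k1 := INR_ge1 K1.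
have lny : ln y <= 2 * INR K * ln 2.
  apply: (Rle_trans _ (ln (2 ^ K.+1))); first by apply: ln_le; lra.
  by rewrite ln_pow_nat; [rewrite S_INR; nra | lra].
have lny0 : 0 < ln y by rewrite -ln_1; apply: ln_increasing; lra.
have lny1 : ln y <= y - 1.
  by have := exp_ineq1_le (ln y); rewrite exp_ln; lra.
have h1 : 1 <= y / ln y.
  by apply: (Rmult_le_reg_r (ln y)) => //; rewrite /Rdiv Rmult_assoc Rinv_l; lra.
have h2 : 2 ^ K / INR K <= 2 * (y / ln y).
  apply: (Rle_trans _ (y / INR K)).
    by apply: Rmult_le_compat_r => //; apply/Rlt_le/Rinv_0_lt_compat; lra.
  have -> : 2 * (y / ln y) = y * (2 * / ln y) by rewrite /Rdiv; ring.
  apply: Rmult_le_compat_l; first by lra.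
  apply: (Rmult_le_reg_l (INR K * ln y)); first by nra.
  have -> : INR K * ln y * / INR K = ln y by field; lra.
  have -> : INR K * ln y * (2 * / ln y) = 2 * INR K by field; lra.
  nra.
lra.
Qed.

(** Each dyadic block contributes at most [4 ln 2], and about [ln y / ln 2] blocks are involved; the
    prime 2 accounts for the [+ 1]. *)
Lemma sum_logp_over_p_le y (s : seq nat) :
  2 <= y -> uniq s -> (forall p, p \in s -> prime p /\ INR p <= y) ->
  \rsum_(p <- s) (ln (INR p) / INR p) <= 4 * ln y + 1.
Proof.
move=> y2 us Hs; have [K [K1 [Ky yK]]] := exists_dyadic y2.
have l2 := ln2_bounds.
have f0 p : prime p -> 0 <= ln (INR p) / INR p.
  by move=> pp; apply/Rlt_le/Rdiv_lt_0_compat; [exact: ln_prime_gt0 | exact: INR_gt0 (prime_gt0 pp)].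
apply: (Rle_trans _ _ _ (primes_upto_dyadic yK us Hs f0)).
pose F k := INR k.+1 * ln 2 / 2 ^ k.
have pw k : 0 < 2 ^ k by apply: pow_lt; lra.
have H := @dyadic_prime_sum (fun p => ln (INR p) / INR p) F 1 K.+1 erefl.
have : \rsum_(k <- iota 1 (K.+1 - 1)) (2 ^ k.+1 / INR k * F k) <= INR K * (4 * ln 2).
  rewrite subSS subn0.
  apply: (Rle_trans _ (\rsum_(k <- iota 1 K) (4 * ln 2))).
    apply: rsum_le => k; rewrite mem_iota => /andP[k1 _] _; have k1' := INR_ge1 k1.
    rewrite /F -tech_pow_Rmult S_INR.
    have -> : 2 * 2 ^ k / INR k * ((INR k + 1) * ln 2 / 2 ^ k) = 2 * ln 2 * ((INR k + 1) / INR k).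
      by field; have := pw k; lra.
    have : (INR k + 1) / INR k <= 2; last by nra.
    by apply: (Rmult_le_reg_r (INR k)); [lra | rewrite /Rdiv Rmult_assoc Rinv_l; lra].
  by rewrite rsum_const count_predT size_iota; lra.
have {}H := H _ _; have : INR K * ln 2 <= ln y.
  by rewrite -ln_pow_nat; [apply: ln_le => // | lra].
have : ln (INR 2) / INR 2 <= 1 by rewrite -[INR 2]/2; lra.
suff : \rsum_(p <- iota (2 ^ 1).+1 (2 ^ K.+1 - 2 ^ 1) | prime p) (ln (INR p) / INR p) <=
   \rsum_(k <- iota 1 (K.+1 - 1)) (2 ^ k.+1 / INR k * F k) by lra.
apply: H.
- move=> k p /andP[k1 _] pp kp; have [h1 h2 h3 h4] := ln_dyadic_bounds k1 kp.
  have := pw k => pk; rewrite /F; apply: Rmult_le_compat => //.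
  + by apply/Rlt_le/ln_prime_gt0.
  + by apply/Rlt_le/Rinv_0_lt_compat; lra.
  + by apply: Rinv_le_contravar; lra.
- move=> k _; rewrite /F; apply: Rmult_le_pos; first by have := pos_INR k.+1; nra.
  exact/Rlt_le/Rinv_0_lt_compat.
Qed.

Lemma ln_prod_pow (s : seq nat) (a : nat -> nat) :
  (forall p, p \in s -> (0 < p)%N) ->
  ln (INR (\prod_(p <- s) p ^ a p)%N) = \rsum_(p <- s) (INR (a p) * ln (INR p)).
Proof.
elim: s => [|p s IH] H; first by rewrite !big_nil ln_1.
have p0 := H p (mem_head _ _).
have H' q : q \in s -> (0 < q)%N by move=> qs; apply: H; rewrite inE qs orbT.
rewrite !big_cons INR_mul ln_mult ?IH //.
- by rewrite INR_exp ln_pow_nat //; exact: INR_gt0.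
- by apply: INR_gt0; rewrite expn_gt0 p0.
- apply: INR_gt0; rewrite big_seq_cond prodn_cond_gt0 // => q /andP[/H' q0 _].
  by rewrite expn_gt0 q0.
Qed.

Lemma ln_logn (s : seq nat) d : (0 < d)%N -> uniq s -> {subset primes d <= s} ->
  ln (INR d) = \rsum_(p <- s) (INR (logn p d) * ln (INR p)).
Proof.
move=> d0 us sub.
have -> : \rsum_(p <- s) (INR (logn p d) * ln (INR p)) =
          \rsum_(p <- primes d) (INR (logn p d) * ln (INR p)).
  rewrite (bigID (fun p => p \in primes d)) /= [X in _ + X]big1; last first.
    by move=> p; rewrite -logn_gt0 lt0n negbK => /eqP->; rewrite /=; lra.
  rewrite Rplus_0_r -big_filter; apply: perm_big; apply: uniq_perm.
  - by rewrite filter_uniq.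
  - exact: primes_uniq.
  by move=> p; rewrite mem_filter; apply: andb_idr => /sub.
rewrite -ln_prod_pow => [|p]; last by rewrite mem_primes => /andP[/prime_gt0].
congr (ln (INR _)); rewrite {1}(prod_prime_decomp d0) prime_decompE big_map.
exact: eq_bigr.
Qed.

Lemma geom_le q n : 0 < q < 1 -> \rsum_(j <- iota 1 n) q ^ j <= q / (1 - q).
Proof.
move=> q01.
have : \rsum_(j <- iota 1 n) q ^ j = (q - q ^ n.+1) / (1 - q).
  elim: n => [|n IH]; first by rewrite big_nil /=; field; lra.
  rewrite -[in iota _ _](addn1 n) iotaD big_cat [iota _ 1]/= big_seq1 add1n {}IH /=; field; lra.
move=> ->; apply: Rmult_le_compat_r; first by apply/Rlt_le/Rinv_0_lt_compat; lra.
have qn : 0 < q ^ n.+1 by apply: pow_lt; lra.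
lra.
Qed.

Lemma ln_div a b : 0 < a -> 0 < b -> ln (a / b) = ln a - ln b.
Proof.
by move=> a0 b0; rewrite /Rdiv ln_mult ?ln_Rinv //; exact: Rinv_0_lt_compat.
Qed.

Lemma ln_fact_ge n : (0 < n)%N -> INR n * ln (INR n) - INR n <= ln (INR n`!).
Proof.
elim: n => [//|[|n] IH] _; first by rewrite /= ln_1; lra.
have {IH} := IH erefl; rewrite [in X in _ -> X]factS INR_mul ln_mult; last first.
- by apply: INR_gt0; exact: fact_gt0.
- exact: INR_gt0.
rewrite [INR n.+2]S_INR; set m := INR n.+1; have m1 : 1 <= m by exact: INR_ge1.
move=> IH; suff : m * (ln (m + 1) - ln m) <= 1 by nra.
have -> : ln (m + 1) - ln m = ln ((m + 1) / m) by rewrite ln_div; lra.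
have h : ln ((m + 1) / m) <= / m.
  have := exp_ineq1_le (/ m) => h; rewrite -[X in _ <= X]ln_exp; apply: ln_le.
    by apply: Rdiv_lt_0_compat; lra.
  by have -> : (m + 1) / m = 1 + / m by [field; lra]; lra.
apply: (Rle_trans _ (m * / m)); first by apply: Rmult_le_compat_l; lra.
by rewrite Rinv_r; lra.
Qed.

Lemma INR_sum (I : Type) (r : seq I) (P : pred I) (F : I -> nat) :
  INR (\sum_(i <- r | P i) F i)%N = \rsum_(i <- r | P i) INR (F i).
Proof.
elim: r => [|i r IH]; first by rewrite !big_nil.
by rewrite !big_cons; case: ifP => // _; rewrite plus_INR IH.
Qed.

Lemma INR_divn_le n d : (0 < d)%N -> INR (n %/ d) <= INR n / INR d.
Proof.
move=> d0; apply/Rle_div_l'; first exact: INR_gt0.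
by rewrite -INR_mul; apply: le_INR; apply/leP; rewrite mulnC leq_divM.
Qed.

(** Legendre's formula, summed as a geometric series to [n / (p - 1) <= 2 n / p]. *)
Lemma logn_fact_le p n : prime p -> INR (logn p n`!) <= 2 * (INR n / INR p).
Proof.
move=> pp; have p2 : 2 <= INR p by apply: (le_INR 2); apply/leP; exact: prime_gt1.
rewrite logn_fact // INR_sum /index_iota subSS subn0.
apply: (Rle_trans _ (\rsum_(j <- iota 1 n) (INR n * (/ INR p) ^ j))).
  apply: rsum_le => j _ _; apply: (Rle_trans _ (INR n / INR (p ^ j))).
    by apply: INR_divn_le; rewrite expn_gt0 prime_gt0.
  by rewrite INR_exp pow_inv; lra.
rewrite rsum_scal; have n0 := pos_INR n.
have ip : 0 < / INR p <= / 2.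
  by split; [apply: Rinv_0_lt_compat; lra | apply: Rinv_le_contravar; lra].
have -> : 2 * (INR n / INR p) = INR n * (2 * / INR p) by rewrite /Rdiv; ring.
apply: Rmult_le_compat_l => //.
apply: (Rle_trans _ _ _ (geom_le _ _)); first by lra.
apply: (Rmult_le_reg_r (1 - / INR p)); first by lra.
have -> : / INR p / (1 - / INR p) * (1 - / INR p) = / INR p by field; lra.
nra.
Qed.

Definition primes_in (a b : R) : seq nat := [seq p <- upto b | prime p & ~~ Rleb (INR p) a].

Lemma primes_inP a b p :
  reflect [/\ prime p, a < INR p & INR p <= b] (p \in primes_in a b).
Proof.
rewrite mem_filter; apply: (iffP andP).
  by move=> [/andP[pp /RlebP na] /uptoP[_ le]]; split=> //; lra.
move=> [pp ap pb]; split; last by apply/uptoP; split=> //; exact: prime_gt0.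
by rewrite pp /=; apply/RlebP; lra.
Qed.

Lemma primes_in_uniq a b : uniq (primes_in a b).
Proof. by rewrite filter_uniq // upto_uniq. Qed.

(** Mertens' argument: factor [n!], bound its valuations by [2 n / p], and compare with
    [ln n! >= n ln n - n]. The crude valuation bound is what costs the factor 1/2. *)
Lemma sum_logp_over_p_ge y :
  2 <= y -> (ln y - 2) / 2 <= \rsum_(p <- primes_in 0 y) (ln (INR p) / INR p).
Proof.
move=> y2; have [n [ny yn]] := @nat_floor y ltac:(lra).
have n0 : (0 < n)%N by apply/ltP/INR_lt; rewrite /=; lra.
have n1 := INR_ge1 n0.
have := ln_fact_ge n0.
have sub : {subset primes n`! <= primes_in 0 y}.
  move=> p; rewrite mem_primes => /and3P[pp _ /(prime_dvd_fact pp) pn].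
  apply/primes_inP; split => //; first exact: INR_gt0 (prime_gt0 pp).
  by have := le_INR _ _ (elimT leP pn); lra.
rewrite (ln_logn (fact_gt0 n) (primes_in_uniq 0 y) sub) => H.
have : \rsum_(p <- primes_in 0 y) (INR (logn p n`!) * ln (INR p)) <=
       \rsum_(p <- primes_in 0 y) (2 * INR n * (ln (INR p) / INR p)).
  apply: rsum_le => p /primes_inP[pp _ _] _.
  have := logn_fact_le n pp; have := ln_prime_gt0 pp.
  have -> : 2 * INR n * (ln (INR p) / INR p) = 2 * (INR n / INR p) * ln (INR p).
    by rewrite /Rdiv; ring.
  by nra.
rewrite rsum_scal => /(Rle_trans _ _ _ H) {}H.
set Sg := \big[Rplus/0]_(_ <- _) _ in H *.
have lyn : ln y <= ln (INR n) + 1.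
  apply: (Rle_trans _ (ln (INR n * exp 1))).
    apply: ln_le; first by lra.
    by have := exp_ineq1 1; nra.
  by rewrite ln_mult ?ln_exp; [lra | lra | exact: exp_pos].
apply: (Rmult_le_reg_l (2 * INR n)); first by lra.
have h : INR n * ln y <= INR n * (ln (INR n) + 1) by apply: Rmult_le_compat_l; lra.
lra.
Qed.

(* The primes up to [Y = y^10] carry [log p / p]-mass at least [5 log y - 1], and those up to [y]
   at most [4 log y + 1]. *)
Lemma sum_inv_plogp_ge y Y : 60 <= ln y -> 0 < Y -> ln Y = 10 * ln y ->
  / 400 / ln y <= \rsum_(p <- primes_in y Y) (/ (INR p * ln (INR p))).
Proof.
move=> ly Y0 lY.
have y0 : 0 < y.
  case: (Rlt_dec 0 y) => // ny; move: ly; rewrite /ln; case: Rlt_dec => // _; lra.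
have y2 : 2 <= y.
  rewrite -(exp_ln y) //; have := exp_ineq1_le (ln y); lra.
have yY : y <= Y.
  by rewrite -(exp_ln y) // -(exp_ln Y) //; apply/Rlt_le/exp_increasing; lra.
have A := @sum_logp_over_p_ge Y ltac:(lra).
have B := @sum_logp_over_p_le y (primes_in 0 y) y2 (primes_in_uniq _ _).
have {}B := B (fun p ps => let: And3 pp _ py := elimT (primes_inP _ _ _) ps in conj pp py).
have C : \rsum_(p <- primes_in 0 Y) (ln (INR p) / INR p) <=
   \rsum_(p <- primes_in 0 y) (ln (INR p) / INR p) +
   \rsum_(p <- primes_in y Y) (ln (INR p) / INR p).
  rewrite -big_cat.
  have f0 p : prime p -> 0 <= ln (INR p) / INR p.
    by move=> pp; apply/Rlt_le/Rdiv_lt_0_compat; [exact: ln_prime_gt0 | exact: INR_gt0 (prime_gt0 pp)].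
  apply: rsum_le_incl; first exact: primes_in_uniq.
  - rewrite cat_uniq !primes_in_uniq andbT /=; apply/hasPn => p /primes_inP[_ yp _].
    by apply/primes_inP => -[_ _]; lra.
  - move=> p pin _; have [pp p0 py] := elimT (primes_inP _ _ _) pin.
    split=> //; last by lra.
    rewrite mem_cat; case: (Rle_dec (INR p) y) => hp; apply/orP; [left|right]; apply/primes_inP;
    by split=> //; lra.
  - by move=> p; rewrite mem_cat => /orP[] /primes_inP[pp _ _] _; exact: f0.
(* On this range [ln p <= 10 ln y], which trades [ln p / p] for [1 / (p ln p)] at the price of
   [(10 ln y)^2]. *)
have D : \rsum_(p <- primes_in y Y) (ln (INR p) / INR p) <=
   \rsum_(p <- primes_in y Y) (100 * (ln y * ln y) * / (INR p * ln (INR p))).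
  apply: rsum_le => p /primes_inP[pp yp py] _.
  have lp : ln (INR p) <= 10 * ln y.
    by rewrite -lY; apply: ln_le => //; lra.
  have lp0 := ln_prime_gt0 pp.
  have -> : ln (INR p) / INR p = (ln (INR p) * ln (INR p)) * / (INR p * ln (INR p)) by field; lra.
  apply: Rmult_le_compat_r; first by apply/Rlt_le/Rinv_0_lt_compat/Rmult_lt_0_compat; lra.
  nra.
rewrite rsum_scal in D; set Sg := \big[Rplus/0]_(p <- _) / _ in D *.
rewrite lY in A.
have E : ln y - 2 <= 100 * (ln y * ln y) * Sg by lra.
apply: (Rmult_le_reg_l (100 * (ln y * ln y))); first by nra.
have -> : 100 * (ln y * ln y) * (/ 400 / ln y) = ln y / 4 by field; lra.
lra.
Qed.

(** * Eventual inequalities *)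

(** [v] is the scale, comparable to [log X]. Constants are chosen before [v], and quantifiers over
    [e], [X], [Y] sit inside [P], so that all bounds are uniform. *)
Definition ev (P : R -> Prop) : Prop := exists v0, forall v, v0 <= v -> P v.

Lemma ev_mp (P Q : R -> Prop) : ev P -> ev (fun v => P v -> Q v) -> ev Q.
Proof.
move=> [a Ha] [b Hb]; exists (Rmax a b) => v ge.
have := Rmax_l a b; have := Rmax_r a b => h1 h2.
by apply: Hb; [lra | apply: Ha; lra].
Qed.

Lemma ev_all (P : R -> Prop) : (forall v, P v) -> ev P.
Proof. by move=> H; exists 0 => v _; exact: H. Qed.

Lemma ev_ln C : ev (fun v => C <= ln v).
Proof.
exists (exp C) => v ge; rewrite -(ln_exp C); apply: ln_le => //; exact: exp_pos.
Qed.

Lemma ev_gt0 : ev (fun v => 0 < v).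
Proof. by exists 1 => v; lra. Qed.

(** With [L = ln v], write [v] as the [(k+1)]-st power of [exp (L / (k+1))], which is at least
    [L / (k+1)]; then [L >= C (k+1)^(k+1)] suffices. *)
Lemma ev_ln_pow C k : ev (fun v => C * ln v ^ k <= v).
Proof.
apply: (ev_mp ev_gt0); apply: (ev_mp (ev_ln (Rmax 1 (C * INR k.+1 ^ k.+1)))).
apply: ev_all => v lnv v0; set L := ln v in lnv *.
have L1 := Rle_trans _ _ _ (Rmax_l _ _) lnv.
have LC := Rle_trans _ _ _ (Rmax_r _ _) lnv.
have k0 : 0 < INR k.+1 by exact: INR_gt0.
have ev : v = exp (L / INR k.+1) ^ k.+1.
  rewrite -Rpower_pow; last exact: exp_pos.
  rewrite /Rpower ln_exp; have -> : INR k.+1 * (L / INR k.+1) = L by field; lra.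
  by rewrite exp_ln.
rewrite ev; apply: (Rle_trans _ ((L / INR k.+1) ^ k.+1)); last first.
  apply: pow_incr; split; first by apply/Rlt_le/Rdiv_lt_0_compat; lra.
  by have := exp_ineq1_le (L / INR k.+1); lra.
have -> : (L / INR k.+1) ^ k.+1 = L * L ^ k / INR k.+1 ^ k.+1.
  by rewrite /Rdiv Rpow_mult_distr pow_inv.
have pk : 0 < INR k.+1 ^ k.+1 by apply: pow_lt.
have Lk : 0 < L ^ k by apply: pow_lt; lra.
apply/Rle_div_l' => //; nra.
Qed.

(** [Mv] is the length on the [log X] axis over which [W] changes by a constant factor. The relation
    [Mv^2 = v ln v] gives two forms of the relative error, [eps = Mv / v = ln v / Mv], and both are
    used throughout. *)
Definition Mv (v : R) : R := sqrt (v * ln v).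
Definition eps (v : R) : R := sqrt (ln v / v).

Lemma ev_Mv : ev (fun v =>
  [/\ 1 <= ln v, 1 <= v, 1 <= Mv v & [/\ Mv v * Mv v = v * ln v, Mv v <= v,
      eps v * Mv v = ln v, eps v * v = Mv v & ln v / 2 <= ln (Mv v) <= ln v]]).
Proof.
apply: (ev_mp (ev_ln 1)); apply: (ev_mp (ev_ln_pow 1 1)); exists 1 => v v1 lv l1.
have lv' : ln v <= v by move: lv => /=; lra.
have v0 : 0 < v by lra.
have vl : 1 <= v * ln v by nra.
have MM : Mv v * Mv v = v * ln v by apply: sqrt_def; lra.
have M0 : 0 <= Mv v by exact: sqrt_pos.
have M1 : 1 <= Mv v by nra.
have Mlev : Mv v <= v by nra.
have ev : eps v * v = Mv v.
  rewrite -[X in _ * X](sqrt_square v); last by lra.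
  rewrite /eps /Mv -sqrt_mult; try by [nra | apply/Rlt_le/Rdiv_lt_0_compat; lra].
  by congr sqrt; field; lra.
have eM : eps v * Mv v = ln v.
  apply: (Rmult_eq_reg_l v); last by lra.
  by rewrite -MM -{2}ev; ring.
split=> //; split=> //.
have lM : 2 * ln (Mv v) = ln v + ln (ln v).
  by rewrite -ln_mult -?MM ?ln_mult; lra.
have lln : 0 <= ln (ln v) by rewrite -ln_1; apply: ln_le; lra.
by split; [lra | apply: ln_le; lra].
Qed.

Lemma ev_M_ge C k : ev (fun v => C * ln v ^ k <= Mv v).
Proof.
apply: (ev_mp (ev_ln_pow (C * C) (k + k))); apply: (ev_mp ev_Mv); apply: ev_all.
move=> v [l1 v1 M1 [MM _ _ _ _]]; rewrite pow_add => h.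
case: (Rle_dec (C * ln v ^ k) (Mv v)) => // /Rnot_le_lt lt.
have : Mv v * Mv v < (C * ln v ^ k) * (C * ln v ^ k) by nra.
rewrite MM; nra.
Qed.

Lemma ev_M_const C : ev (fun v => C <= Mv v).
Proof. by apply: (ev_mp (ev_M_ge C 0)); apply: ev_all => v /=; lra. Qed.

Lemma ev_v_M C : ev (fun v => C * Mv v <= v).
Proof.
apply: (ev_mp (ev_M_ge (Rabs C) 1)); apply: (ev_mp ev_Mv); apply: ev_all.
move=> v [l1 v1 M1 [MM _ _ _ _]]; rewrite pow_1 => h.
have := Rle_abs C => aC.
have : Rabs C * ln v * Mv v <= v * ln v by rewrite -MM; apply: Rmult_le_compat_r; lra.
move=> h2; have : Rabs C * Mv v <= v by nra.
nra.
Qed.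

(** * Lower growth of [W] *)

Lemma count_lt_iota l J : count (fun j => (j < l)%N) (iota 0 J) = minn J l.
Proof.
elim: J => [|J IH]; first by rewrite min0n.
rewrite -addn1 iotaD count_cat IH /= add0n addn0 addn1.
by case: ltnP => h /=; lia.
Qed.

Lemma w_pow_mul p j d : prime p -> (0 < d)%N -> (p %| d)%N -> w (p ^ j * d) = w d.
Proof.
move=> pp d0 pd; elim: j => [|j IH]; first by rewrite mul1n.
have pj : (0 < p ^ j * d)%N by rewrite muln_gt0 d0 expn_gt0 prime_gt0.
by rewrite expnS -mulnA (w_mul_dvd pp pj) // dvdn_mull.
Qed.

(** Multiplying a multiple of [p] by [p^j] does not change its weight, so passing to the scale
    [Y / p^j] is the same as asking for divisibility by [p^(j+1)] at the scale [Y]. *)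
Lemma V_pow e p Y j : prime p -> coprime p e ->
  V e p (Y / INR p ^ j) = \rsum_(d <- upto Y | (p ^ j.+1 %| d)%N && coprime d e) w d.
Proof.
move=> pp cpe; have pj : (0 < p ^ j)%N by rewrite expn_gt0 prime_gt0.
rewrite (eq_bigl (fun d => (p ^ j %| d)%N && ((p ^ j.+1 %| d)%N && coprime d e))); last first.
  move=> d; rewrite andbA; congr (_ && _); apply/idP/andP => [h|[]//]; split=> //.
  by apply: dvdn_trans h; rewrite expnS dvdn_mull.
rewrite (sum_multiples _ _ _ pj) VE INR_exp; apply: congr_big => //.
  move=> d; rewrite expnSr dvdn_pmul2l // coprimeMl; congr (_ && _).
  by rewrite coprimeXl.
move=> d /andP[pd _]; case: (posnP d) => [->|d0]; first by rewrite muln0.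
by rewrite w_pow_mul.
Qed.

Lemma sum_V_pow e p Y J : prime p -> coprime p e ->
  \rsum_(j <- iota 0 J) V e p (Y / INR p ^ j) =
  \rsum_(d <- upto Y | coprime d e) (w d * INR (minn J (logn p d))).
Proof.
move=> pp cpe.
rewrite (eq_bigr (fun j => \rsum_(d <- upto Y | coprime d e) (if (p ^ j.+1 %| d)%N then w d else 0))); last first.
  by move=> j _; rewrite V_pow // -big_mkcondl.
rewrite exchange_big /= big_seq_cond [RHS]big_seq_cond; apply: eq_bigr => d /andP[/uptoP[d0 _] _].
rewrite -big_mkcond rsum_const Rmult_comm -count_lt_iota; congr (_ * INR _).
by apply: eq_count => j /=; rewrite pfactor_dvdn.
Qed.

Lemma sum_logn_le (s : seq nat) d : (0 < d)%N -> uniq s -> all prime s ->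
  \rsum_(p <- s) (INR (logn p d) * ln (INR p)) <= ln (INR d).
Proof.
move=> d0 us ps.
rewrite (@ln_logn (undup (s ++ primes d)) d) ?undup_uniq //; last first.
  by move=> p pd; rewrite mem_undup mem_cat pd orbT.
rewrite [X in _ <= X]big_seq_cond; apply: rsum_le_incl; rewrite ?undup_uniq //.
- move=> p pin _; have h : p \in undup (s ++ primes d) by rewrite mem_undup mem_cat pin.
  by rewrite h; split=> //; lra.
- move=> p; rewrite mem_undup mem_cat => /orP pin _.
  have pp : prime p by case: pin => [/(allP ps)//|]; rewrite mem_primes => /andP[].
  by have := ln_prime_gt0 pp; have := pos_INR (logn p d); nra.
Qed.

(** Expand [ln d], which is at most [ln Y], as the sum of [v_p(d) ln p], and average over [d] with
    the weights [w]. Keeping only the primes of [s] and truncating the valuations at [J p] loses in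
    the right direction. *)
Lemma log_mean_ge e Y (s : seq nat) (J : nat -> nat) :
  0 < Y -> uniq s -> all (fun p => prime p && coprime p e) s ->
  \rsum_(p <- s) (ln (INR p) * \rsum_(j <- iota 0 (J p)) V e p (Y / INR p ^ j)) <=
  ln Y * W e Y.
Proof.
move=> Y0 us ps.
apply: (Rle_trans _ (\rsum_(p <- s) \rsum_(d <- upto Y | coprime d e) (w d * (INR (logn p d) * ln (INR p))))).
  apply: rsum_le => p pin _; have /andP[pp cpe] := allP ps p pin.
  rewrite sum_V_pow // -rsum_scal; apply: rsum_le => d _ _.
  have := ln_prime_gt0 pp; have := w_gt0 d => w0 l0.
  have le : INR (minn (J p) (logn p d)) <= INR (logn p d) by apply: le_INR; apply/leP; exact: geq_minr.
  have -> : ln (INR p) * (w d * INR (minn (J p) (logn p d))) = w d * (INR (minn (J p) (logn p d)) * ln (INR p)) by ring.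
  by apply: Rmult_le_compat_l; [lra | apply: Rmult_le_compat_r; lra].
rewrite exchange_big /= WE -rsum_scal; apply: rsum_le => d /uptoP[d0 dY] _.
rewrite rsum_scal Rmult_comm; apply: Rmult_le_compat_r; first exact: w_ge0.
apply: (Rle_trans _ (ln (INR d))).
  by apply: sum_logn_le => //; apply: sub_all ps => p /andP[].
by apply: ln_le => //; exact: INR_gt0.
Qed.

Lemma V_ge e p Y J c : prime p -> coprime p e -> 0 < Y ->
  (forall j, (1 <= j <= J)%N -> c <= W (e * p) (Y / INR p ^ j)) ->
  INR J * (c / (INR p + 1)) <= V e p Y.
Proof.
move=> pp cpe Y0 H; have p1 := INR_ge1 (prime_gt0 pp).
rewrite (V_iter Y J pp cpe); have := V_ge0 e p (Y / INR p ^ J).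
suff : INR J * (c / (INR p + 1)) <=
   \rsum_(j <- iota 1 J) (W (e * p) (Y / INR p ^ j) / (INR p + 1)) by lra.
have -> : INR J = INR (count predT (iota 1 J)) by rewrite count_predT size_iota.
rewrite -rsum_const; apply: rsum_le => j; rewrite mem_iota add1n ltnS => jJ _.
apply: Rmult_le_compat_r; first by apply/Rlt_le/Rinv_0_lt_compat; lra.
exact: H.
Qed.

(** The multiples of [p] in [W e Y0] are covered by monotonicity of [V]. The part prime to [p]
    occurs in [V e p Y] with weight [1 / (p + 1)] at each of [J] scales above [Y0], hence the factor
    [(p + 1) / J]. *)
Lemma W_le_V e p Y Y0 J : prime p -> coprime p e -> (0 < J)%N -> 0 < Y ->
  Y0 <= Y / INR p ^ J -> W e Y0 <= (1 + (INR p + 1) / INR J) * V e p Y.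
Proof.
move=> pp cpe J0 Y0' le; have p1 := INR_ge1 (prime_gt0 pp); have J1 := INR_ge1 J0.
have pJ j : 1 <= INR p ^ j by apply: pow_R1_Rle.
have YJ j : Y / INR p ^ j <= Y.
  apply: (Rmult_le_reg_r (INR p ^ j)); first by have := pJ j; lra.
  by rewrite /Rdiv Rmult_assoc Rinv_l; have := pJ j; nra.
have h1 : INR J * (W (e * p) (Y / INR p ^ J) / (INR p + 1)) <= V e p Y.
  apply: V_ge => // j /andP[_ jJ]; apply: W_mono; apply: Rmult_le_compat_l; first by lra.
  apply: Rinv_le_contravar; first by have := pJ j; lra.
  by apply: Rle_pow => //; apply/leP.
have h2 : W (e * p) Y0 <= (INR p + 1) / INR J * V e p Y.
  apply: (Rle_trans _ _ _ (W_mono (e * p) le)).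
  apply: (Rmult_le_reg_l (INR J / (INR p + 1))); first by apply: Rdiv_lt_0_compat; lra.
  have -> : INR J / (INR p + 1) * ((INR p + 1) / INR J * V e p Y) = V e p Y by field; lra.
  by have -> : INR J / (INR p + 1) * W (e * p) (Y / INR p ^ J) =
     INR J * (W (e * p) (Y / INR p ^ J) / (INR p + 1)) by field; lra.
rewrite (W_split e Y0 pp); have : V e p Y0 <= V e p Y; last by lra.
by apply: V_mono; have := YJ J; lra.
Qed.

Lemma coprime_prime_primes p e : prime p -> (0 < e)%N -> coprime p e = (p \notin primes e).
Proof. by move=> pp e0; rewrite prime_coprime // mem_primes pp e0. Qed.

Lemma floor_half a : 1 <= a -> exists J, (0 < J)%N /\ INR J <= a <= 2 * INR J.
Proof.
move=> a1; have [J [h1 h2]] := @nat_floor a ltac:(lra).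
have J0 : (0 < J)%N by apply/ltP/INR_lt; rewrite /=; lra.
by exists J; split => //; have := INR_ge1 J0; lra.
Qed.

(** The at most two primes dividing [e] contribute at most [2 / (y ln y)]; with [y >= 1600] this is
    no more than half of the full sum. *)
Lemma sum_inv_plogp_coprime_ge e y Y : 60 <= ln y -> 1600 <= y -> 0 < Y -> ln Y = 10 * ln y ->
  (0 < e)%N -> (size (primes e) <= 2)%N ->
  / 800 / ln y <=
  \rsum_(p <- [seq p <- primes_in y Y | coprime p e]) (/ (INR p * ln (INR p))).
Proof.
move=> ly y16 Y0 lY e0 se.
have := sum_inv_plogp_ge ly Y0 lY; rewrite (bigID (fun p => coprime p e)) /=.
rewrite -big_filter.
suff h : \rsum_(p <- primes_in y Y | ~~ coprime p e) (/ (INR p * ln (INR p))) <= / 800 / ln y.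
  have -> : / 400 / ln y = / 800 / ln y + / 800 / ln y by field; lra.
  by lra.
apply: (Rle_trans _ (\rsum_(p <- primes e) (/ (y * ln y)))).
  apply: rsum_le_incl; rewrite ?primes_in_uniq ?primes_uniq //.
    move=> p /primes_inP[pp yp pY] ncp; split=> //.
      by move: ncp; rewrite coprime_prime_primes // negbK.
    apply: Rinv_le_contravar; first by nra.
    have lyp : ln y <= ln (INR p) by apply: ln_le; lra.
    by apply: Rmult_le_compat; lra.
  by move=> p _ _; apply/Rlt_le/Rinv_0_lt_compat; nra.
rewrite rsum_const count_predT.
have s2 : INR (size (primes e)) <= 2 by apply: (le_INR _ 2); apply/leP.
have i0 : 0 < / (y * ln y) by apply: Rinv_0_lt_compat; nra.
apply: (Rle_trans _ (2 * / (y * ln y))); first by apply: Rmult_le_compat_r; lra.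
have -> : 2 * / (y * ln y) = 2 / y * / ln y by field; lra.
rewrite /Rdiv; apply: Rmult_le_compat_r; first by apply/Rlt_le/Rinv_0_lt_compat; lra.
apply: (Rmult_le_reg_r y); first by lra.
by rewrite Rmult_assoc Rinv_l; lra.
Qed.

(** For [M < p <= M^10], [V e p] is at least about [M / (p ln p)] times the small value [W0] at all
    scales [Y / p^j] with [j ln p <= (K - 1) M]. Weighted by [ln p] and summed over [j] and [p],
    this gives order [K M^2 / ln M] times [W0], while the total is at most [Lam v W e Y]. The
    relation [M^2 = v ln v] makes the two sides comparable, and a large [K] yields the factor
    1/2. *)
Lemma W_halve Lam : 0 < Lam -> exists K, 0 < K /\ ev (fun v => forall e Y,
  (0 < e)%N -> (size (primes e) <= 2)%N -> 0 < Y -> ln Y <= Lam * v ->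
  W e (Y * exp (- (K * Mv v))) <= / 2 * W e Y).
Proof.
(* The comparison ends with [(K - 1) / 8000 >= 2 Lam]; the extra 1 keeps [(K - 1) M / ln p] at least
   1, so that it has a positive integer part. *)
move=> Lam0; pose K := 2 + 16000 * Lam; exists K; split; first by rewrite /K; lra.
apply: (ev_mp ev_Mv); apply: (ev_mp (ev_M_const 1600)); apply: (ev_mp (ev_ln 120)).
apply: (ev_mp (ev_M_ge 10 1)).
apply: ev_all => v; rewrite pow_1 => M10 l120 M16 [l1 v1 M1 [MM Mlev _ _ lM]] e Y e0 se Y0 lY.
set M := Mv v in M10 M16 M1 MM Mlev lM *.
have M0 : 0 < M by lra.
pose Y10 := exp (10 * ln M).
have := @sum_inv_plogp_coprime_ge e M Y10 ltac:(lra) M16 (exp_pos _) (ln_exp _) e0 se.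
set s := [seq p <- primes_in M Y10 | coprime p e] => hs.
have us : uniq s by rewrite filter_uniq // primes_in_uniq.
have sP p : p \in s -> [/\ prime p, coprime p e, M < INR p & ln (INR p) <= 10 * ln M].
  rewrite mem_filter => /andP[cp /primes_inP[pp Mp pY]]; split=> //.
  by rewrite -[X in _ <= X]ln_exp; apply: ln_le => //; lra.
set W0 := W e (Y * exp (- (K * M))).
have W00 : 0 <= W0 by exact: W_ge0.
have key p : p \in s -> exists J, (K - 1) * (M * M) / 10 * / (INR p * ln (INR p)) * W0 <=
    ln (INR p) * \rsum_(j <- iota 0 J) V e p (Y / INR p ^ j).
  move=> pin; have [pp cpe Mp lp10] := sP p pin.
  have lp1 : 1 <= ln (INR p) by have : ln M <= ln (INR p) by [apply: ln_le; lra]; lra.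
  set l := ln (INR p) in lp1 lp10 *; set P := INR p in Mp l lp1 lp10 *.
  (* Of the distance [K M] down to [W0], the part [(K - 1) M] is used for the scales [j < J], and
     the remaining [M] for the [I] further steps that compare [V] with [W0]. *)
  have [I [I0 [I1 I2]]] := @floor_half (M / l) ltac:(apply/Rle_div_l'; lra).
  have IR := INR_ge1 I0.
  have [J [J0 [J1 J2]]] := @floor_half ((K - 1) * M / l)
    ltac:(apply/Rle_div_l'; [lra | rewrite /K; nra]).
  exists J.
  have Vge j : (j < J)%N -> M / (5 * (P * l)) * W0 <= V e p (Y / P ^ j).
    move=> jJ; have jJ' : INR j <= INR J by apply: le_INR; apply/leP; exact: ltnW.
    have Pj n : P ^ n = exp (INR n * l) by rewrite -Rpower_pow //; lra.
    have h : Y * exp (- (K * M)) <= Y / P ^ j / P ^ I.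
      rewrite /Rdiv !Pj -!exp_Ropp Rmult_assoc -exp_plus; apply: Rmult_le_compat_l; first by lra.
      have : INR I * l <= M by move: I1 => /(Rle_div_l' _ _ _) h; rewrite Rmult_comm; apply/h; lra.
      have : INR J * l <= (K - 1) * M.
        by move: J1 => /(Rle_div_l' _ _ _) h; rewrite Rmult_comm; apply/h; lra.
      move=> a1 a2; have a3 : INR j * l <= INR J * l by apply: Rmult_le_compat_r; lra.
      case: (Rle_lt_or_eq_dec (- (K * M)) (- (INR j * l) + - (INR I * l))) => [|/exp_increasing/Rlt_le//|->]; lra.
    have Yj : 0 < Y / P ^ j by apply: Rdiv_lt_0_compat => //; apply: pow_lt; lra.
    have := W_le_V pp cpe I0 Yj h; rewrite -/W0 -/P => hV.
    set V0 := V e p (Y / P ^ j) in hV *; have V00 : 0 <= V0 by exact: V_ge0.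
    have c5 : 1 + (P + 1) / INR I <= 5 * (P * l) / M.
      apply: (Rmult_le_reg_r M) => //.
      have -> : 5 * (P * l) / M * M = 5 * (P * l) by field; lra.
      have hI : M / INR I <= 2 * l.
        apply: (Rmult_le_reg_r (INR I)); first by lra.
        have -> : M / INR I * INR I = M by field; lra.
        have -> : M = M / l * l by field; lra.
        by nra.
      have -> : (1 + (P + 1) / INR I) * M = M + (P + 1) * (M / INR I) by field; lra.
      by nra.
    have Pl : 0 < P * l by nra.
    apply: (Rmult_le_reg_l (5 * (P * l) / M)); first by apply: Rdiv_lt_0_compat; lra.
    have -> : 5 * (P * l) / M * (M / (5 * (P * l)) * W0) = W0 by field; lra.
    by nra.
  apply: (Rle_trans _ (l * (INR J * (M / (5 * (P * l)) * W0)))); last first.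
    apply: Rmult_le_compat_l; first by lra.
    have -> : INR J = INR (count predT (iota 0 J)) by rewrite count_predT size_iota.
    rewrite -rsum_const; apply: rsum_le => j; rewrite mem_iota => /andP[_ jJ] _; exact: Vge.
  have -> : (K - 1) * (M * M) / 10 * / (P * l) * W0 = (K - 1) * M / l / 2 * (M * / (5 * P) * W0) by field; lra.
  have -> : l * (INR J * (M / (5 * (P * l)) * W0)) = INR J * (M * / (5 * P) * W0) by field; lra.
  apply: Rmult_le_compat_r; last by lra.
  by apply: Rmult_le_pos => //; apply: Rmult_le_pos; [lra | apply/Rlt_le/Rinv_0_lt_compat; lra].
(* Finite choice: [J] depends on [p], and the function is assembled along the list. *)
have [Jf HJ] : exists J : nat -> nat, forall p, p \in s ->
    (K - 1) * (M * M) / 10 * / (INR p * ln (INR p)) * W0 <=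
    ln (INR p) * \rsum_(j <- iota 0 (J p)) V e p (Y / INR p ^ j).
  elim: (s) key => [|p r IH] key; first by exists (fun _ => 0%N).
  have [J0 H0] := key p (mem_head _ _).
  have [J HJ] := IH (fun q qr => key q (mem_behead (s := p :: r) qr)).
  exists (fun q => if q == p then J0 else J q) => q; rewrite inE.
  by case: eqP => [-> _|_ /= /HJ].
have := @log_mean_ge e Y s Jf Y0 us => H.
have {}H := H ltac:(by apply/allP => p /sP[-> ->]).
have H2 : (K - 1) * (M * M) / 10 * W0 * (/ 800 / ln M) <= ln Y * W e Y.
  apply: Rle_trans H.
  apply: (Rle_trans _ (\rsum_(p <- s) ((K - 1) * (M * M) / 10 * W0 * / (INR p * ln (INR p))))).
    rewrite rsum_scal; apply: Rmult_le_compat_l => //.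
    by apply: Rmult_le_pos => //; rewrite /K; nra.
  by apply: rsum_le => p ps _; have := HJ p ps; lra.
have WY := W_ge0 e Y.
have H3 : ln Y * W e Y <= Lam * v * W e Y by apply: Rmult_le_compat_r.
have lM0 : 0 < ln M by lra.
have H4 : (K - 1) * v / 8000 * W0 <= (K - 1) * (M * M) / 10 * W0 * (/ 800 / ln M).
  rewrite MM.
  have -> : (K - 1) * (v * ln v) / 10 * W0 * (/ 800 / ln M) = (K - 1) * v / 8000 * W0 * (ln v / ln M) by field; lra.
  rewrite -{1}[X in X <= _]Rmult_1_r; apply: Rmult_le_compat_l.
    by apply: Rmult_le_pos => //; rewrite /K; nra.
  by apply/Rle_div_l' => //; lra.
have H5 : (K - 1) * v / 8000 * W0 <= Lam * v * W e Y by lra.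
apply: (Rmult_le_reg_l (2 * Lam * v)); first by nra.
have -> : 2 * Lam * v * (/ 2 * W e Y) = Lam * v * W e Y by field.
apply: Rle_trans H5; apply: Rmult_le_compat_r => //; rewrite /K; nra.
Qed.

Lemma exp_le a b : a <= b -> exp a <= exp b.
Proof. by move=> h; case: (Rle_lt_or_eq_dec _ _ h) => [/exp_increasing lt|->]; lra. Qed.

(** Halve [floor (ln r / (K Mv))] times; the factor 2 pays for the rounding. *)
Lemma W_decay Lam : 0 < Lam -> exists kap, 0 < kap /\ ev (fun v => forall e Y r,
  (0 < e)%N -> (size (primes e) <= 2)%N -> 0 < Y -> ln Y <= Lam * v -> 1 <= r ->
  W e (Y / r) <= 2 * exp (- (kap / Mv v * ln r)) * W e Y).
Proof.
move=> Lam0; have [K [K0 HK]] := W_halve Lam0.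
have l2 := ln2_bounds.
exists (ln 2 / K); split; first by apply: Rdiv_lt_0_compat; lra.
apply: (ev_mp HK); apply: (ev_mp ev_Mv); apply: ev_all.
move=> v [_ _ M1 _] H e Y r e0 se Y0 lY r1; set M := Mv v in M1 H *.
have it k : W e (Y * exp (- (INR k * (K * M)))) <= (/ 2) ^ k * W e Y.
  elim: k => [|k IH]; first by rewrite /= Rmult_0_l Ropp_0 exp_0 Rmult_1_r; lra.
  have -> : Y * exp (- (INR k.+1 * (K * M))) = Y * exp (- (INR k * (K * M))) * exp (- (K * M)).
    by rewrite Rmult_assoc -exp_plus S_INR; congr (_ * exp _); ring.
  have lY' : ln (Y * exp (- (INR k * (K * M)))) <= Lam * v.
    rewrite ln_mult ?ln_exp //; last exact: exp_pos.
    have : 0 <= INR k * (K * M) by apply: Rmult_le_pos; [exact: pos_INR | nra].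
    by lra.
  have := H e _ e0 se (Rmult_lt_0_compat _ _ Y0 (exp_pos _)) lY'.
  by move=> h; rewrite -tech_pow_Rmult; nra.
have lr : 0 <= ln r by rewrite -ln_1; apply: ln_le; lra.
have KM : 0 < K * M by nra.
have q0 : 0 <= ln r / (K * M).
  by apply: Rmult_le_pos => //; apply/Rlt_le/Rinv_0_lt_compat.
have [k [k1 k2]] := nat_floor q0.
apply: (Rle_trans _ _ _ (W_mono e _) (Rle_trans _ _ _ (it k) _)).
  rewrite /Rdiv; apply: Rmult_le_compat_l; first by lra.
  rewrite exp_Ropp; apply: Rinv_le_contravar; first exact: exp_pos.
  rewrite -(exp_ln r); last by lra.
  apply: exp_le; rewrite Rmult_comm; move: k1 => /(Rle_div_l' _ _ _); exact.
apply: Rmult_le_compat_r; first exact: W_ge0.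
have -> : (/ 2) ^ k = exp (- (INR k * ln 2)).
  by rewrite pow_inv exp_Ropp -Rpower_pow; [rewrite /Rpower | lra].
have -> : 2 = exp (ln 2) by rewrite exp_ln; lra.
rewrite -exp_plus ln_exp; apply: exp_le.
have -> : ln 2 / K / M * ln r = ln 2 * (ln r / (K * M)) by field; lra.
nra.
Qed.

(** * Upper growth of [W] *)

Lemma nat_above y : exists n, y < INR n.
Proof.
case: (Rle_dec 0 y) => [/nat_floor[n [_ lt]]|ny]; last by exists 0%N => /=; lra.
by exists n.+1; rewrite S_INR.
Qed.

Lemma pow_exp_ln p j : prime p -> INR p ^ j = exp (INR j * ln (INR p)).
Proof. by move=> pp; rewrite -Rpower_pow //; exact: INR_gt0 (prime_gt0 pp). Qed.

(** The full geometric series equals [1 / (exp a - 1)]. *)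
Lemma geom_exp_le a J : 0 < a -> \rsum_(j <- iota 1 J) exp (- (INR j * a)) <= / a.
Proof.
move=> a0.
have q1 : exp (- a) < 1 by rewrite -exp_0; apply: exp_increasing; lra.
have q0 := exp_pos (- a).
rewrite (eq_bigr (fun j => exp (- a) ^ j)); last first.
  by move=> j _; rewrite -Rpower_pow // /Rpower ln_exp; congr exp; ring.
apply: (Rle_trans _ _ _ (geom_le J (conj q0 q1))).
have h := exp_ineq1_le a.
have e1 : exp (- a) * exp a = 1 by rewrite -exp_plus Rplus_opp_l exp_0.
have -> : exp (- a) / (1 - exp (- a)) = / (exp a - 1).
  apply: (Rmult_eq_reg_r ((1 - exp (- a)) * (exp a - 1))); last by nra.
  have -> : exp (- a) / (1 - exp (- a)) * ((1 - exp (- a)) * (exp a - 1)) = exp (- a) * (exp a - 1) by field; lra.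
  have -> : / (exp a - 1) * ((1 - exp (- a)) * (exp a - 1)) = 1 - exp (- a) by field; lra.
  by lra.
by apply: Rinv_le_contravar; lra.
Qed.

(** Under exponential decay of [W] at rate [s], the expansion of [V] over the scales [Y / p^j] is a
    geometric series with sum at most [1 / (s ln p)], up to the factor [2 / (p + 1)]. *)
Lemma V_le_decay e p Y s : prime p -> coprime p e -> 0 < Y -> 0 < s ->
  (forall r, 1 <= r -> W e (Y / r) <= 2 * exp (- (s * ln r)) * W e Y) ->
  V e p Y <= 2 / s * / (INR p * ln (INR p)) * W e Y.
Proof.
move=> pp cpe Y0 s0 H; have p1 := INR_ge1 (prime_gt0 pp); have lp := ln_prime_gt0 pp.
(* Enough steps to bring the remainder below the scale 1, where there are no integers left. *)
have [J HJ] := nat_above (ln Y / ln (INR p)).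
have YJ : Y / INR p ^ J < 1.
  rewrite pow_exp_ln // -{1}(exp_ln Y) // /Rdiv -exp_Ropp -exp_plus -exp_0.
  apply: exp_increasing; have : ln Y = ln Y / ln (INR p) * ln (INR p) by field; lra.
  by move=> ->; nra.
rewrite (V_iter Y J pp cpe).
have -> : V e p (Y / INR p ^ J) = 0.
  by have := V_le_W e p (Y / INR p ^ J); have := V_ge0 e p (Y / INR p ^ J); rewrite (W_lt1 e YJ); lra.
rewrite Rplus_0_l.
have W0 := W_ge0 e Y.
have ip : 0 < / (INR p + 1) by apply: Rinv_0_lt_compat; lra.
apply: (Rle_trans _ (\rsum_(j <- iota 1 J) (2 * W e Y * / (INR p + 1) * exp (- (INR j * (s * ln (INR p))))))).
  apply: rsum_le => j _ _; apply: (Rle_trans _ (2 * exp (- (s * ln (INR p ^ j))) * W e Y * / (INR p + 1))).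
    apply: Rmult_le_compat_r; first by lra.
    apply: (Rle_trans _ _ _ (W_mul_le _ _ pp)); apply: H; apply: pow_R1_Rle; lra.
  rewrite ln_pow_nat; last by lra.
  by have -> : s * (INR j * ln (INR p)) = INR j * (s * ln (INR p)) by [ring]; lra.
rewrite rsum_scal.
have g := @geom_exp_le (s * ln (INR p)) J ltac:(nra).
apply: (Rle_trans _ (2 * W e Y * / (INR p + 1) * / (s * ln (INR p)))).
  by apply: Rmult_le_compat_l => //; apply: Rmult_le_pos; lra.
have -> : 2 / s * / (INR p * ln (INR p)) * W e Y = 2 * W e Y * / INR p * / (s * ln (INR p)) by field; lra.
apply: Rmult_le_compat_r; first by apply/Rlt_le/Rinv_0_lt_compat; nra.
apply: Rmult_le_compat_l; first by lra.
by apply: Rinv_le_contravar; lra.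
Qed.

Lemma telescope_le (a : nat -> R) m J :
  (forall j, 0 <= a j) -> (forall j, a j <= a 0%N) ->
  \rsum_(j <- iota 0 J) (a j - a (j + m)%N) <= INR m * a 0%N.
Proof.
move=> a0 amax.
have -> : \rsum_(j <- iota 0 J) (a j - a (j + m)%N) =
   \rsum_(j <- iota 0 J) a j - \rsum_(j <- iota 0 J) a (j + m)%N.
  rewrite (eq_bigr (fun j => a j + -1 * a (j + m)%N)); last by move=> j _; ring.
  by rewrite big_split rsum_scal /=; ring.
have -> : \rsum_(j <- iota 0 J) a (j + m)%N = \rsum_(j <- iota m J) a j.
  by rewrite -[in RHS](addn0 m) iotaDl big_map; apply: eq_bigr => j _; rewrite addnC.
have h : \rsum_(j <- iota 0 J) a j <= \rsum_(j <- iota 0 (m + J)) a j.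
  rewrite addnC iotaD big_cat /=; set x := (X in _ <= _ + X).
  have : 0 <= x by apply: rsum_ge0 => j _ _; exact: a0.
  by lra.
rewrite iotaD big_cat /= add0n in h.
have : \rsum_(j <- iota 0 m) a j <= INR m * a 0%N; last by lra.
apply: (Rle_trans _ (\rsum_(j <- iota 0 m) a 0%N)); first by apply: rsum_le => j _ _; exact: amax.
by rewrite rsum_const count_predT size_iota; lra.
Qed.

Lemma W_shell e y Y : y <= Y ->
  W e Y = W e y + \rsum_(d <- upto Y | coprime d e && ~~ Rleb (INR d) y) w d.
Proof.
move=> yY; rewrite !WE (bigID (fun d => Rleb (INR d) y)) /=; congr (_ + _).
rewrite -[LHS]big_filter -[RHS]big_filter; apply: perm_big; apply: uniq_perm;
  try by rewrite (filter_uniq _ (upto_uniq _)).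
move=> d; rewrite [LHS]mem_filter [RHS]mem_filter !mem_upto; case: (RlebP (INR d) y) => h; rewrite ?andbF ?andbT //.
by case: (RlebP (INR d) Y) => h'; [rewrite ?andbT | exfalso; lra].
Qed.

(** The valuations over the shell [(y, Zy]] sum to the difference of [V] at the scales [Zy / p^j]
    and [y / p^j]. Since [Z <= p^m], the latter dominate the former shifted by [m], so only [m]
    terms survive the telescoping. *)
Lemma shell_logn_le e p y Z m : prime p -> coprime p e -> 0 < y -> 1 <= Z ->
  Z <= INR p ^ m ->
  \rsum_(d <- upto (Z * y) | coprime d e && ~~ Rleb (INR d) y) (w d * INR (logn p d)) <=
  INR m * V e p (Z * y).
Proof.
move=> pp cpe y0 Z1 Zm; have p1 := INR_ge1 (prime_gt0 pp).
have pj j : 1 <= INR p ^ j by exact: pow_R1_Rle.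
have Zy : y <= Z * y by nra.
(* A valuation is smaller than the number itself, so this [J] truncates none. *)
have [J HJ] := nat_above (Z * y).
have full Y : Y <= Z * y ->
    \rsum_(j <- iota 0 J) V e p (Y / INR p ^ j) = \rsum_(d <- upto Y | coprime d e) (w d * INR (logn p d)).
  move=> YZ; rewrite sum_V_pow // big_seq_cond [RHS]big_seq_cond.
  apply: eq_bigr => d /andP[/uptoP[d0 dY] _]; congr (_ * INR _); apply/minn_idPr.
  apply: ltnW; apply: (leq_trans (ltn_logl p d0)).
  by apply/leP/INR_le; lra.
have -> : \rsum_(d <- upto (Z * y) | coprime d e && ~~ Rleb (INR d) y) (w d * INR (logn p d)) =
   \rsum_(j <- iota 0 J) V e p (Z * y / INR p ^ j) - \rsum_(j <- iota 0 J) V e p (y / INR p ^ j).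
  rewrite !full //; last by lra.
  rewrite [X in _ = X - _](bigID (fun d => Rleb (INR d) y)) /=.
  have -> : \rsum_(d <- upto (Z * y) | coprime d e && Rleb (INR d) y) (w d * INR (logn p d)) =
     \rsum_(d <- upto y | coprime d e) (w d * INR (logn p d)); last by ring.
  rewrite -[LHS]big_filter -[RHS]big_filter; apply: perm_big; apply: uniq_perm;
    try by rewrite (filter_uniq _ (upto_uniq _)).
  move=> d; rewrite [LHS]mem_filter [RHS]mem_filter !mem_upto; case: (RlebP (INR d) y) => h; rewrite ?andbF ?andbT //.
  by case: (RlebP (INR d) (Z * y)) => h'; [rewrite ?andbT | exfalso; lra].
pose a j := V e p (Z * y / INR p ^ j).
have a0 : a 0%N = V e p (Z * y) by rewrite /a /= Rdiv_1_r.
rewrite -a0; apply: Rle_trans (telescope_le m J _ _); last first.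
- move=> j; rewrite a0; apply: V_mono.
  apply: (Rmult_le_reg_r (INR p ^ j)); first by have := pj j; lra.
  rewrite /Rdiv Rmult_assoc Rinv_l; last by have := pj j; lra.
  by have := pj j; nra.
- by move=> j; exact: V_ge0.
have -> : \rsum_(j <- iota 0 J) (a j - a (j + m)%N) =
   \rsum_(j <- iota 0 J) a j - \rsum_(j <- iota 0 J) a (j + m)%N.
  rewrite (eq_bigr (fun j => a j + -1 * a (j + m)%N)); last by move=> j _; ring.
  by rewrite big_split rsum_scal /=; ring.
suff : \rsum_(j <- iota 0 J) a (j + m)%N <= \rsum_(j <- iota 0 J) V e p (y / INR p ^ j).
  by rewrite /a; lra.
apply: rsum_le => j _ _; apply: V_mono; rewrite pow_add /Rdiv Rinv_mult.
have -> : Z * y * (/ INR p ^ j * / INR p ^ m) = y * / INR p ^ j * (Z * / INR p ^ m) by ring.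
rewrite -[X in _ <= X]Rmult_1_r; apply: Rmult_le_compat_l.
  by apply: Rmult_le_pos; [lra | apply/Rlt_le/Rinv_0_lt_compat; have := pj j; lra].
apply: (Rmult_le_reg_r (INR p ^ m)); first by have := pj m; lra.
by rewrite Rmult_assoc Rinv_l; have := pj m; lra.
Qed.

Lemma rsum_pairs (I J : eqType) (r : seq I) (s : seq J) (F : I -> J -> R) :
  \rsum_(x <- [seq (i, j) | i <- r, j <- s]) F x.1 x.2 = \rsum_(i <- r) \rsum_(j <- s) F i j.
Proof. by rewrite big_allpairs_dep. Qed.

Lemma pairs_uniq (I J : eqType) (r : seq I) (s : seq J) :
  uniq r -> uniq s -> uniq [seq (i, j) | i <- r, j <- s].
Proof. by move=> ur us; apply: allpairs_uniq => // -[a b] [c d]. Qed.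

Lemma p'part p b : prime p -> (0 < b)%N -> b = (p ^ logn p b * b`_p^')%N.
Proof. by move=> pp b0; rewrite -p_part partnC. Qed.

Lemma w_primepow p j : prime p -> w (p ^ j) = if j == 0%N then 1 else / (INR p + 1).
Proof.
move=> pp; case: j => [|j]; first by rewrite /w big_nil.
by rewrite /w primesX // primes_prime // big_seq1.
Qed.

(** Euler product bound: writing [b = p^j b'] splits off one prime of [s] at a time, with the local
    factor [1 + sum_j p^(- j del) / (p + 1)], at most [1 + 1 / (del p ln p)]. *)
Lemma sum_w_exp_le (s : seq nat) del Y : 0 < del -> uniq s -> all prime s ->
  \rsum_(b <- upto Y | all (fun p => p \in s) (primes b)) (w b * exp (- (del * ln (INR b)))) <=
  exp (\rsum_(p <- s) (/ del * / (INR p * ln (INR p)))).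
Proof.
move=> del0; elim: s => [_ _|p s IH].
  rewrite big_nil exp_0.
  apply: (Rle_trans _ (\rsum_(b <- [:: 1%N]) 1)); last by rewrite big_seq1; lra.
  apply: rsum_le_incl; rewrite ?upto_uniq //; last by move=> *; lra.
  move=> b /uptoP[b0 _] hb.
  have -> : b = 1%N.
    have : primes b == [::] by case: (primes b) hb.
    by rewrite primes_eq0; case: b b0 {hb} => [|[]].
  by rewrite inE eqxx /w big_nil /= ln_1 Rmult_0_r Ropp_0 exp_0; split=> //; lra.
rewrite cons_uniq => /andP[ps us] /= /andP[pp as_].
have {}IH := IH us as_.
have p1 := INR_ge1 (prime_gt0 pp); have lp := ln_prime_gt0 pp.
have [J HJ] := nat_above Y.
pose c j := if j == 0%N then 1 else / (INR p + 1).
pose g j b := (c j * exp (- (INR j * (del * ln (INR p))))) *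
   (if all (fun q => q \in s) (primes b) then w b * exp (- (del * ln (INR b))) else 0).
have ip : 0 < / (INR p + 1) by apply: Rinv_0_lt_compat; lra.
have c0 j : 0 <= c j by rewrite /c; case: ifP => _; lra.
have g0 j b : 0 <= g j b.
  rewrite /g; apply: Rmult_le_pos; first by apply: Rmult_le_pos => //; exact/Rlt_le/exp_pos.
  case: ifP => _; last by lra.
  by apply: Rmult_le_pos; [exact: w_ge0 | exact/Rlt_le/exp_pos].
apply: (Rle_trans _ (\rsum_(x <- [seq (j, b) | j <- iota 0 J.+1, b <- upto Y]) g x.1 x.2)).
  apply: (rsum_le_inj (phi := fun b => (logn p b, b`_p^'))).
  - exact: upto_uniq.
  - by apply: pairs_uniq; rewrite ?iota_uniq ?upto_uniq.
  - move=> b /uptoP[b0 bY] hb.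
    have lJ : logn p b \in iota 0 J.+1.
      rewrite mem_iota add0n ltnS /=; apply: ltnW; apply: (leq_trans (ltn_logl p b0)).
      by apply/leP/INR_le; lra.
    have bu : b`_p^' \in upto Y.
      apply/uptoP; split; first exact: part_gt0.
      apply: Rle_trans bY; apply: le_INR; apply/leP; apply: dvdn_leq => //; exact: dvdn_part.
    split=> //.
      by apply/allpairsP; exists (logn p b, b`_p^'); split; [exact: lJ | exact: bu |].
    rewrite /g /=.
    have -> : all (fun q => q \in s) (primes b`_p^').
      apply/allP => q; rewrite primes_part mem_filter => /andP[qp qb].
      have := allP hb q qb; rewrite inE => /orP[/eqP qq|//].
      by move: qp; rewrite qq !inE eqxx.
    have b'0 : (0 < b`_p^')%N by exact: part_gt0.
    have cop : coprime (p ^ logn p b) b`_p^' by rewrite -p_part coprime_partC.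
    have pj : (0 < p ^ logn p b)%N by rewrite expn_gt0 prime_gt0.
    rewrite {1 2}(p'part pp b0) w_coprime // w_primepow // INR_mul ln_mult; try exact: INR_gt0.
    rewrite INR_exp ln_pow_nat; last by lra.
    have -> : - (del * (INR (logn p b) * ln (INR p) + ln (INR b`_p^'))) =
      - (INR (logn p b) * (del * ln (INR p))) + - (del * ln (INR b`_p^')) by ring.
    by rewrite exp_plus /c; apply: Req_le; ring.
  - move=> b b' /uptoP[b0 _] /uptoP[b'0 _] _ _ [h1 h2].
    by rewrite (p'part pp b0) (p'part pp b'0) h1 h2.
  - by move=> [j b] _ _; exact: g0.
rewrite rsum_pairs.
set A := \rsum_(b <- upto Y | _) _ in IH.
rewrite (eq_bigr (fun j => A * (c j * exp (- (INR j * (del * ln (INR p))))))); last first.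
  by move=> j _; rewrite /g rsum_scal -big_mkcond -/A Rmult_comm.
rewrite rsum_scal.
have A0 : 0 <= A.
  by apply: rsum_ge0 => b _ _; apply: Rmult_le_pos; [exact: w_ge0 | exact/Rlt_le/exp_pos].
have dl : 0 < del * ln (INR p) by nra.
have hc : \rsum_(j <- iota 0 J.+1) (c j * exp (- (INR j * (del * ln (INR p))))) <=
    1 + / del * / (INR p * ln (INR p)).
  rewrite /= big_cons /= Rmult_0_l Ropp_0 exp_0 {1}/c eqxx Rmult_1_r.
  apply: Rplus_le_compat_l.
  apply: (Rle_trans _ (\rsum_(j <- iota 1 J) (/ (INR p + 1) * exp (- (INR j * (del * ln (INR p))))))).
    apply: rsum_le => j; rewrite mem_iota /c => /andP[j1 _] _.
    by case: eqP j1 => [->//|_ _]; lra.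
  rewrite rsum_scal; have g1 := geom_exp_le J dl.
  apply: (Rle_trans _ (/ (INR p + 1) * / (del * ln (INR p)))); first by apply: Rmult_le_compat_l; lra.
  have -> : / del * / (INR p * ln (INR p)) = / INR p * / (del * ln (INR p)) by field; lra.
  apply: Rmult_le_compat_r; first by apply/Rlt_le/Rinv_0_lt_compat.
  by apply: Rinv_le_contravar; lra.
rewrite big_cons exp_plus Rmult_comm; apply: Rmult_le_compat => //.
- apply: rsum_ge0 => j _ _; apply: Rmult_le_pos => //; exact/Rlt_le/exp_pos.
- by apply: (Rle_trans _ _ _ hc); exact: exp_ineq1_le.
Qed.

Definition rough (Z : R) : nat_pred := [pred p | ~~ Rleb (INR p) Z].

(* Splitting off the [Z]-rough part [b] of [d] bounds the tail by
   [sum_b w b * (b / e^tau)^(s/2) * W (Y / b)]; the decay of [W] makes this an Euler product. *)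
Lemma rough_tail e Y Z s tau : 0 < Y -> 2 <= Z -> 0 < s -> (0 < e)%N ->
  (forall r, 1 <= r -> W e (Y / r) <= 2 * exp (- (s * ln r)) * W e Y) ->
  \rsum_(d <- upto Y | coprime d e && ~~ Rleb (ln (INR (d`_(rough Z)))) tau) w d <=
  2 * exp (16 / (s * ln Z) - s / 2 * tau) * W e Y.
Proof.
move=> Y0 Z2 s0 e0 H; have lZ : 0 < ln Z by rewrite -ln_1; apply: ln_increasing; lra.
set ps := primes_in Z Y; have W0 := W_ge0 e Y.
(* Rankin's trick: the exponential is at least 1 on the tail. Half of the decay rate [s] pays for
   it; the other half remains to bound the Euler product over [b]. *)
pose g b a := if all (fun p => p \in ps) (primes b) && Rleb (INR a) (Y / INR b) && coprime a e
  then exp (s / 2 * (ln (INR b) - tau)) * w b * w a else 0.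
have g0 b a : 0 <= g b a.
  rewrite /g; case: ifP => _; last by lra.
  by apply: Rmult_le_pos; [apply: Rmult_le_pos; [exact/Rlt_le/exp_pos | exact: w_ge0] | exact: w_ge0].
apply: (Rle_trans _ (\rsum_(x <- [seq (b, a) | b <- upto Y, a <- upto Y]) g x.1 x.2)).
  apply: (rsum_le_inj (phi := fun d => (d`_(rough Z), d`_(rough Z)^'))).
  - exact: upto_uniq.
  - by apply: pairs_uniq; rewrite ?upto_uniq.
  - move=> d /uptoP[d0 dY] /andP[cd /RlebP tl].
    set b := d`_(rough Z) in tl *; set a := d`_(rough Z)^'.
    have b0 : (0 < b)%N by exact: part_gt0.
    have a0 : (0 < a)%N by exact: part_gt0.
    have dE : d = (b * a)%N by rewrite partnC.
    have bY : b \in upto Y.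
      apply/uptoP; split=> //; apply: Rle_trans dY; apply: le_INR; apply/leP; apply: dvdn_leq => //; exact: dvdn_part.
    have aY : a \in upto Y.
      apply/uptoP; split=> //; apply: Rle_trans dY; apply: le_INR; apply/leP; apply: dvdn_leq => //; exact: dvdn_part.
    split=> //; first by apply/allpairsP; exists (b, a).
    rewrite /g /=.
    have -> : all (fun p => p \in ps) (primes b).
      apply/allP => p; rewrite primes_part mem_filter => /andP[]; rewrite inE => /RlebP hp.
      rewrite mem_primes => /and3P[pp _ pd]; apply/primes_inP; split=> //; first by lra.
      by apply: Rle_trans dY; apply: le_INR; apply/leP; exact: dvdn_leq.
    have -> : Rleb (INR a) (Y / INR b).
      by apply/RlebP/Rle_div_l'; [exact: INR_gt0 | rewrite -INR_mul -dE].
    have -> : coprime a e by apply: coprime_dvdl cd; exact: dvdn_part.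
    rewrite /= {1}dE w_coprime //; last exact: coprime_partC.
    have : 1 <= exp (s / 2 * (ln (INR b) - tau)).
      by rewrite -exp_0; apply: exp_le; apply: Rmult_le_pos; lra.
    move=> h1; rewrite [X in _ <= X]Rmult_assoc -{1}[w b * w a]Rmult_1_l.
    by apply: Rmult_le_compat_r => //; apply: Rmult_le_pos; exact: w_ge0.
  - move=> d d' /uptoP[d0 _] /uptoP[d'0 _] _ _ [h1 h2].
    by rewrite -(partnC (rough Z) d0) -(partnC (rough Z) d'0) h1 h2.
  - by move=> [b a] _ _; exact: g0.
rewrite rsum_pairs.
apply: (Rle_trans _ (\rsum_(b <- upto Y | all (fun p => p \in ps) (primes b))
   (2 * exp (- (s / 2 * tau)) * W e Y * (w b * exp (- (s / 2 * ln (INR b))))))).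
  rewrite [X in _ <= X]big_mkcond; apply: rsum_le => b /uptoP[b0 bY] _.
  rewrite /g; case: ifP => hb /=; last by rewrite big1 //; lra.
  rewrite -big_mkcond rsum_scal.
  have hW : \rsum_(a <- upto Y | Rleb (INR a) (Y / INR b) && coprime a e) w a <= W e (Y / INR b).
    rewrite WE; apply: rsum_le_incl; rewrite ?upto_uniq //; last by move=> a _ _; exact: w_ge0.
    move=> a /uptoP[a0 _] /andP[/RlebP h1 h2]; split=> //; last by lra.
    by apply/uptoP.
  have hd := H (INR b) (INR_ge1 b0).
  have wb := w_gt0 b; have ee := exp_pos (s / 2 * (ln (INR b) - tau)).
  apply: (Rle_trans _ (exp (s / 2 * (ln (INR b) - tau)) * w b * (2 * exp (- (s * ln (INR b))) * W e Y))).
    by apply: Rmult_le_compat_l; [nra | lra].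
  apply: Req_le.
  have -> : s / 2 * (ln (INR b) - tau) = - (s / 2 * tau) + (s / 2 * ln (INR b)) by ring.
  have -> : - (s / 2 * ln (INR b)) = s / 2 * ln (INR b) + - (s * ln (INR b)) by field.
  by rewrite !exp_plus; ring.
rewrite rsum_scal.
have := @sum_w_exp_le ps (s / 2) Y ltac:(lra) (primes_in_uniq _ _).
have -> : all prime ps by apply/allP => p /primes_inP[].
move=> /(_ erefl) h.
have h2 : \rsum_(p <- ps) (/ (s / 2) * / (INR p * ln (INR p))) <= 16 / (s * ln Z).
  rewrite rsum_scal; have := @sum_inv_plogp_le Z ps Z2 (primes_in_uniq _ _).
  move=> /(_ (fun p ps => let: And3 pp yp _ := elimT (primes_inP _ _ _) ps in conj pp yp)) h3.
  have -> : 16 / (s * ln Z) = / (s / 2) * (8 / ln Z) by field; lra.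
  by apply: Rmult_le_compat_l => //; apply/Rlt_le/Rinv_0_lt_compat; lra.
have e1 := exp_pos (- (s / 2 * tau)).
apply: (Rle_trans _ (2 * exp (- (s / 2 * tau)) * W e Y * exp (16 / (s * ln Z)))).
  apply: Rmult_le_compat_l; first by nra.
  by apply: (Rle_trans _ _ _ h); apply: exp_le.
by rewrite /Rminus exp_plus; apply: Req_le; ring.
Qed.

Lemma ceil_div a b : 0 < b -> 0 <= a -> exists m, a <= INR m * b <= a + b.
Proof.
move=> b0 a0; have q0 : 0 <= a / b by apply: Rmult_le_pos => //; apply/Rlt_le/Rinv_0_lt_compat.
have [n [h1 h2]] := nat_floor q0; exists n.+1; rewrite S_INR.
have -> : a = a / b * b by field; lra.
by nra.
Qed.

(* Each [d] in the shell has logarithm at least [v / 4], and a [Z]-smooth part of logarithm at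
   least [v / 8] outside the rough tail; counting prime divisors converts this into [W]. *)
Lemma W_shell_le e y Z M v kap : 2 <= M -> M <= Z -> 0 < y -> 0 < v -> 0 < kap ->
  (0 < e)%N -> v / 4 <= ln y ->
  (forall r, 1 <= r -> W e (Z * y / r) <= 2 * exp (- (kap / M * ln r)) * W e (Z * y)) ->
  W e (Z * y) - W e y <=
  (16 * ln Z / v * ((40 + 16 / kap) * (M / ln M)) +
   2 * exp (16 * M / (kap * ln Z) - kap / M / 16 * v)) * W e (Z * y).
Proof.
move=> M2 MZ y0 v0 k0 e0 lny H.
have lM : 0 < ln M by rewrite -ln_1; apply: ln_increasing; lra.
have lMZ : ln M <= ln Z by apply: ln_le; lra.
have Zy0 : 0 < Z * y by nra.
have s0 : 0 < kap / M by apply: Rdiv_lt_0_compat; lra.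
have yZy : y <= Z * y by nra.
set Y := Z * y in H Zy0 yZy *; have W0 := W_ge0 e Y.
rewrite (W_shell e yZy).
set P := fun d => coprime d e && ~~ Rleb (INR d) y.
set small := fun d => Rleb (ln (INR (d`_(rough Z)))) (v / 8).
have -> : W e y + \rsum_(d <- upto Y | P d) w d - W e y = \rsum_(d <- upto Y | P d) w d by ring.
rewrite -(W_shell e yZy) (bigID small) /= Rmult_plus_distr_r.
apply: Rplus_le_compat; last first.
  have ht := @rough_tail e Y Z (kap / M) (v / 8) Zy0 ltac:(lra) s0 e0 H.
  have -> : 16 * M / (kap * ln Z) - kap / M / 16 * v = 16 / (kap / M * ln Z) - kap / M / 2 * (v / 8).
    by field; lra.
  apply: Rle_trans ht; apply: rsum_sub_pred => d _; last by move=> _; exact: w_ge0.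
  by rewrite /P => /andP[/andP[-> _] ->].
set s := [seq p <- primes_in 0 Z | coprime p e].
have us : uniq s by rewrite filter_uniq // primes_in_uniq.
have sP p : p \in s -> [/\ prime p, coprime p e & INR p <= Z].
  by rewrite mem_filter => /andP[cp /primes_inP[pp _ pY]].
have step1 : v / 8 * (\rsum_(d <- upto Y | P d && small d) w d) <=
   \rsum_(d <- upto Y | P d) (w d * \rsum_(p <- s) (INR (logn p d) * ln (INR p))).
  rewrite -rsum_scal; apply: rsum_le_incl; rewrite ?upto_uniq //.
    move=> d dY /andP[Pd /RlebP sd]; split=> //; rewrite Rmult_comm.
    apply: Rmult_le_compat_l; first exact: w_ge0.
    have [d0 _] := elimT (uptoP _ _) dY; move: Pd => /andP[cd /RlebP dy].
    have ld : v / 4 <= ln (INR d) by apply: (Rle_trans _ _ _ lny); apply: ln_le; lra.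
    set b := d`_(rough Z) in sd; set a := d`_(rough Z)^'.
    have b0 : (0 < b)%N by exact: part_gt0.
    have a0 : (0 < a)%N by exact: part_gt0.
    have dE : d = (b * a)%N by rewrite partnC.
    have la : v / 8 <= ln (INR a).
      by move: ld; rewrite dE INR_mul ln_mult; [lra | exact: INR_gt0 | exact: INR_gt0].
    apply: (Rle_trans _ _ _ la).
    have sub : {subset primes a <= s}.
      move=> p; rewrite primes_part mem_filter inE /= => /andP[hp].
      rewrite mem_primes => /and3P[pp _ pd]; rewrite mem_filter (coprime_dvdl pd cd) /=.
      apply/primes_inP; split=> //; first exact: INR_gt0 (prime_gt0 pp).
      by move: hp; rewrite inE negbK => /RlebP.
    rewrite (ln_logn a0 us sub); apply: rsum_le => p /sP[pp _ _] _.
    apply: Rmult_le_compat_r; first exact/Rlt_le/ln_prime_gt0.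
    by apply: le_INR; apply/leP; apply: dvdn_leq_log => //; exact: dvdn_part.
  move=> d _ _; apply: Rmult_le_pos; first exact: w_ge0.
  apply: rsum_ge0 => p /sP[pp _ _] _; apply: Rmult_le_pos; first exact: pos_INR.
  exact/Rlt_le/ln_prime_gt0.
have step2 : \rsum_(d <- upto Y | P d) (w d * \rsum_(p <- s) (INR (logn p d) * ln (INR p))) <=
   2 * ln Z * \rsum_(p <- s) V e p Y.
  rewrite (eq_bigr (fun d => \rsum_(p <- s) (ln (INR p) * (w d * INR (logn p d))))); last first.
    by move=> d _; rewrite -rsum_scal; apply: eq_bigr => p _; ring.
  rewrite exchange_big /= -rsum_scal; apply: rsum_le => p /sP[pp cp pZ] _.
  rewrite rsum_scal.
  have lp := ln_prime_gt0 pp; have p0 := INR_gt0 (prime_gt0 pp).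
  have lpZ : ln (INR p) <= ln Z by apply: ln_le.
  (* The smallest power of [p] above [Z] satisfies [m ln p <= ln Z + ln p <= 2 ln Z], uniformly in
     [p <= Z]. *)
  have [m [m1 m2]] := @ceil_div (ln Z) (ln (INR p)) lp ltac:(lra).
  have Zm : Z <= INR p ^ m.
    by rewrite pow_exp_ln // -{1}(exp_ln Z); [apply: exp_le | lra].
  have hs := @shell_logn_le e p y Z m pp cp y0 ltac:(lra) Zm.
  rewrite -/Y -/P in hs; have V0 := V_ge0 e p Y.
  apply: (Rle_trans _ (ln (INR p) * (INR m * V e p Y))); first by apply: Rmult_le_compat_l; [lra | exact: hs].
  by nra.
(* Up to [M] the trivial bound [V <= W] is used for each of the at most [40 M / ln M] primes. Above
   [M] the decay of [W] takes over, and the tail of [1 / (p ln p)] gives the same order. *)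
have step3 : \rsum_(p <- s) V e p Y <= (40 + 16 / kap) * (M / ln M) * W e Y.
  rewrite (bigID (fun p => Rleb (INR p) M)) /= !Rmult_plus_distr_r; apply: Rplus_le_compat.
    apply: (Rle_trans _ (\rsum_(p <- s | Rleb (INR p) M) W e Y)).
      by apply: rsum_le => p _ _; exact: V_le_W.
    rewrite rsum_const -size_filter; apply: Rmult_le_compat_r => //.
    apply: prime_count_le => //; first by rewrite filter_uniq.
    by move=> p; rewrite mem_filter => /andP[/RlebP pM /sP[pp _ _]].
  apply: (Rle_trans _ (\rsum_(p <- s | ~~ Rleb (INR p) M) (2 / (kap / M) * W e Y * / (INR p * ln (INR p))))).
    apply: rsum_le => p /sP[pp cp pZ] _.
    by have := V_le_decay pp cp Zy0 s0 H; lra.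
  rewrite rsum_scal -big_filter.
  have h := @sum_inv_plogp_le M [seq p <- s | ~~ Rleb (INR p) M] M2.
  have {}h := h ltac:(by rewrite filter_uniq).
  have {}h := h ltac:(by move=> p; rewrite mem_filter => /andP[/RlebP pM /sP[pp _ _]]; split=> //; lra).
  have -> : 16 / kap * (M / ln M) * W e Y = 2 / (kap / M) * W e Y * (8 / ln M) by field; lra.
  apply: Rmult_le_compat_l => //; apply: Rmult_le_pos => //.
  by apply: Rmult_le_pos; [lra | apply/Rlt_le/Rinv_0_lt_compat].
apply: (Rmult_le_reg_l (v / 8)); first by lra.
apply: (Rle_trans _ _ _ step1); apply: (Rle_trans _ _ _ step2).
have -> : v / 8 * (16 * ln Z / v * ((40 + 16 / kap) * (M / ln M)) * W e Y) =
  2 * ln Z * ((40 + 16 / kap) * (M / ln M) * W e Y) by field; lra.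
by apply: Rmult_le_compat_l; lra.
Qed.

Lemma exp_neg_le t : 0 < t -> exp (- t) <= 4 / (t * t).
Proof.
move=> t0; have h := exp_ineq1_le (t / 2).
have -> : exp (- t) = / (exp (t / 2) * exp (t / 2)).
  by rewrite -exp_plus exp_Ropp; congr (/ exp _); field.
have -> : 4 / (t * t) = / (t / 2 * (t / 2)) by field; lra.
by apply: Rinv_le_contravar; nra.
Qed.

(** For [Z = v^B] the shell bound is of order [(ln v / v) M / ln M], that is [M / v = eps], and the
    rough tail is exponentially small in [M / ln v]. *)
Lemma W_grow Lam : 0 < Lam -> exists B0, 0 < B0 /\ forall B, B0 <= B ->
  exists C, 0 < C /\ ev (fun v => forall e y,
  (0 < e)%N -> (size (primes e) <= 2)%N -> 0 < y -> v / 4 <= ln y ->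
  ln y + B * ln v <= Lam * v ->
  W e (exp (B * ln v) * y) <= (1 + C * eps v) * W e y).
Proof.
move=> Lam0; have [kap [k0 HW]] := W_decay Lam0.
(* This makes [16 / (kap B) <= kap / 32], so that the Euler product in the rough tail eats at most
   half of the Rankin saving [kap / 16] times [M / ln v]. *)
exists (1 + 512 / (kap * kap)); split.
  by have : 0 < 512 / (kap * kap) by [apply: Rdiv_lt_0_compat; nra]; lra.
move=> B BB.
have kk : 0 < 512 / (kap * kap) by apply: Rdiv_lt_0_compat; nra.
have B1 : 1 <= B by lra.
have Bk : 512 <= B * (kap * kap).
  have -> : 512 = 512 / (kap * kap) * (kap * kap) by field; lra.
  by apply: Rmult_le_compat_r; nra.
pose C1 := 32 * B * (40 + 16 / kap) + 1.
have C10 : 0 < C1.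
  rewrite /C1; have : 0 < 16 / kap by apply: Rdiv_lt_0_compat; lra.
  by move=> h; have : 0 < B * (40 + 16 / kap) by [nra]; lra.
exists (2 * C1); split; first by lra.
apply: (ev_mp HW); apply: (ev_mp ev_Mv); apply: (ev_mp (ev_M_const 2)).
apply: (ev_mp (ev_M_ge (8192 / (kap * kap)) 1)); apply: (ev_mp (ev_M_ge (2 * C1) 1)).
apply: ev_all => v; rewrite !pow_1 => MC Mk M2 [l1 v1 M1 [MM Mlev eM evM [lM1 lM2]]] HWv e y e0 se y0 ly1 ly2.
set Z := exp (B * ln v); set M := Mv v in MC Mk M2 M1 MM Mlev eM evM lM1 lM2 HWv *.
set L := ln v in l1 MC Mk MM eM lM1 lM2 ly2 *.
have lZ : ln Z = B * L by rewrite ln_exp.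
have vE : v = exp L by rewrite exp_ln; lra.
have MZ : M <= Z by apply: (Rle_trans _ _ _ Mlev); rewrite /Z -/L vE; apply: exp_le; nra.
have Zy : 0 < Z * y by apply: Rmult_lt_0_compat => //; exact: exp_pos.
have lZy : ln (Z * y) <= Lam * v.
  by rewrite ln_mult ?lZ //; [lra | exact: exp_pos].
have := @W_shell_le e y Z M v kap M2 MZ y0 ltac:(lra) k0 e0 ly1 (fun r => HWv e _ r e0 se Zy lZy).
rewrite lZ; set x := (X in _ <= X * _) => h.
have eps0 : 0 < eps v by nra.
have epsE : eps v = M / v by rewrite -evM; field; lra.
have epsE' : eps v = L / M by rewrite -eM; field; lra.
have xle : x <= C1 * eps v.
  have -> : C1 * eps v = 32 * B * (40 + 16 / kap) * eps v + 1 * eps v by rewrite /C1; ring.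
  rewrite /x; apply: Rplus_le_compat.
    have -> : 16 * (B * L) / v * ((40 + 16 / kap) * (M / ln M)) =
      16 * B * (40 + 16 / kap) * (M / v) * (L / ln M) by field; lra.
    rewrite -epsE.
    have -> : 32 * B * (40 + 16 / kap) * eps v = 16 * B * (40 + 16 / kap) * eps v * 2 by ring.
    apply: Rmult_le_compat_l.
      have k16 : 0 < 16 / kap by apply: Rdiv_lt_0_compat; lra.
      by apply: Rmult_le_pos; [nra | lra].
    by apply: (Rmult_le_reg_r (ln M)); [lra | rewrite /Rdiv Rmult_assoc Rinv_l; lra].
  have hexp : 16 * M / (kap * (B * L)) - kap / M / 16 * v <= - (kap / 32 * (M / L)).
    have -> : kap / M / 16 * v = kap / 16 * (M / L).
      have -> : v = M * M / L by rewrite MM; field; lra.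
      by field; lra.
    have -> : 16 * M / (kap * (B * L)) = 16 / (kap * B) * (M / L) by field; lra.
    have : 16 / (kap * B) <= kap / 32.
      apply: (Rmult_le_reg_r (kap * B)); first by nra.
      have -> : 16 / (kap * B) * (kap * B) = 16 by field; lra.
      by lra.
    have : 0 < M / L by apply: Rdiv_lt_0_compat; lra.
    by nra.
  apply: (Rle_trans _ (2 * exp (- (kap / 32 * (M / L))))).
    by apply: Rmult_le_compat_l; [lra | apply: exp_le].
  have ML : 0 < M / L by apply: Rdiv_lt_0_compat; lra.
  have := @exp_neg_le (kap / 32 * (M / L)) ltac:(nra) => h2.
  rewrite epsE'; apply: (Rle_trans _ (2 * (4 / (kap / 32 * (M / L) * (kap / 32 * (M / L)))))); first by lra.
  have -> : 2 * (4 / (kap / 32 * (M / L) * (kap / 32 * (M / L)))) = 8192 / (kap * kap) * L * (L / (M * M)) by field; lra.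
  have -> : 1 * (L / M) = M * (L / (M * M)) by field; lra.
  apply: Rmult_le_compat_r; last by lra.
  by apply/Rlt_le/Rdiv_lt_0_compat; nra.
(* The shell was bounded relative to [W] at its upper end; smallness of the ratio transfers the
   bound to the lower end. *)
have half : C1 * eps v <= / 2.
  rewrite epsE'; apply: (Rmult_le_reg_r M); first by lra.
  have -> : C1 * (L / M) * M = C1 * L by field; lra.
  by lra.
have WZ := W_ge0 e (Z * y); have Wy := W_ge0 e y.
have h3 : W e (Z * y) - W e y <= C1 * eps v * W e (Z * y) by nra.
have W2 : W e (Z * y) <= 2 * W e y by nra.
have : 0 <= C1 * eps v by nra.
nra.
Qed.

Lemma exp_mul_nat a k : exp (INR k * a) = exp a ^ k.
Proof.
by rewrite -Rpower_pow; [rewrite /Rpower ln_exp | exact: exp_pos].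
Qed.

(** Iterate the growth step about [ln r / (B ln v)] times. As [eps Mv = ln v], a range
    [ln r <= c Mv] needs only [O(1 / eps)] steps, and the product stays bounded. *)
Lemma W_long Lam : 0 < Lam -> exists c, 0 < c /\ ev (fun v => forall e Y r,
  (0 < e)%N -> (size (primes e) <= 2)%N -> 0 < Y -> v / 2 <= ln Y -> ln Y <= Lam * v ->
  1 <= r -> ln r <= c * Mv v -> W e Y <= 2 * W e (Y / r)).
Proof.
move=> Lam0; have [B [B0 /(_ B (Rle_refl B)) [C [C0 HW]]]] := W_grow Lam0.
have l2 := ln2_bounds.
(* With this [c] the steps cost [ln 2 / 2] in the exponent; the other half is left for rounding up
   their number. *)
pose c := B * ln 2 / (2 * C); have c0 : 0 < c by apply: Rdiv_lt_0_compat; nra.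
exists c; split => //.
apply: (ev_mp HW); apply: (ev_mp ev_Mv); apply: (ev_mp (ev_M_ge (2 * C / ln 2) 1)).
apply: (ev_mp (ev_v_M (8 * c))); apply: (ev_mp (ev_ln_pow (8 * B) 1)).
apply: ev_all => v; rewrite !pow_1 => vB vM ML [l1 v1 M1 [MM Mlev eM evM _]] {}HW e Y r e0 se Y0 lY1 lY2 r1 lr.
set M := Mv v in vM ML M1 MM Mlev eM evM lr *; set L := ln v in l1 vB ML MM eM HW *.
have lr0 : 0 <= ln r by rewrite -ln_1; apply: ln_le; lra.
have BL : 0 < B * L by nra.
have [k [k1 k2]] := @ceil_div (ln r) (B * L) BL lr0.
have eps0 : 0 < eps v by nra.
have it i : (i <= k)%N -> W e Y <= (1 + C * eps v) ^ i * W e (Y * exp (- (INR i * (B * L)))).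
  elim: i => [|i IH] ik; first by rewrite /= Rmult_0_l Ropp_0 exp_0 Rmult_1_r; lra.
  have {}IH := IH (ltnW ik).
  set y := Y * exp (- (INR i.+1 * (B * L))).
  have y0 : 0 < y by apply: Rmult_lt_0_compat => //; exact: exp_pos.
  have ly : ln y = ln Y - INR i.+1 * (B * L).
    by rewrite /y (ln_mult _ _ Y0 (exp_pos _)) ln_exp; ring.
  have ik' : INR i.+1 * (B * L) <= INR k * (B * L).
    by apply: Rmult_le_compat_r; [lra | apply: le_INR; apply/leP].
  have i1 : 1 <= INR i.+1 by exact: INR_ge1.
  have := HW e y e0 se y0 ltac:(rewrite ly; lra) ltac:(rewrite ly; nra).
  have -> : exp (B * L) * y = Y * exp (- (INR i * (B * L))).
    rewrite /y Rmult_comm Rmult_assoc -exp_plus; congr (_ * exp _); rewrite S_INR; ring.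
  move=> h; apply: (Rle_trans _ _ _ IH).
  rewrite -tech_pow_Rmult; have pi : 0 < (1 + C * eps v) ^ i by apply: pow_lt; nra.
  have -> : (1 + C * eps v) * (1 + C * eps v) ^ i * W e y = (1 + C * eps v) ^ i * ((1 + C * eps v) * W e y) by ring.
  by apply: Rmult_le_compat_l; lra.
have pw : (1 + C * eps v) ^ k <= 2.
  apply: (Rle_trans _ (exp (C * eps v) ^ k)).
    by apply: pow_incr; have := exp_ineq1_le (C * eps v); nra.
  rewrite -exp_mul_nat -[X in _ <= X]exp_ln; last by lra.
  apply: exp_le.
  have kB : INR k * (B * L) <= c * M + B * L by lra.
  have kE : INR k <= c * M / (B * L) + 1.
    apply: (Rmult_le_reg_r (B * L)) => //.
    by have -> : (c * M / (B * L) + 1) * (B * L) = c * M + B * L by field; lra.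
  have epsE : eps v = L / M by rewrite -eM; field; lra.
  apply: (Rle_trans _ ((c * M / (B * L) + 1) * (C * (L / M)))).
    by rewrite -epsE; apply: Rmult_le_compat_r => //; nra.
  have -> : (c * M / (B * L) + 1) * (C * (L / M)) = ln 2 / 2 + C * L / M by rewrite /c; field; lra.
  suff : C * L / M <= ln 2 / 2 by lra.
  apply: (Rmult_le_reg_r M); first by lra.
  have -> : C * L / M * M = ln 2 / 2 * (2 * C / ln 2 * L) by field; lra.
  by apply: Rmult_le_compat_l; lra.
apply: (Rle_trans _ _ _ (it k (leqnn k))).
apply: Rmult_le_compat => //.
- by apply: pow_le; nra.
- exact: W_ge0.
apply: W_mono; rewrite /Rdiv; apply: Rmult_le_compat_l; first by lra.
rewrite exp_Ropp; apply: Rinv_le_contravar; first by lra.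
by rewrite -{1}(exp_ln r); [apply: exp_le | lra].
Qed.

(** [W (e * q)] stays above half its value on a range of length [c Mv], so about [c Mv / ln q] of
    its copies, each with weight [1 / (q + 1)], fit into [W e X]. *)
Lemma W_prime_le Lam : 0 < Lam -> exists C, 0 < C /\ ev (fun v => forall e q X,
  (0 < e)%N -> prime q -> coprime q e -> (size (primes (e * q)) <= 2)%N -> INR q <= v ->
  0 < X -> v / 2 <= ln X -> ln X <= Lam * v ->
  W (e * q) X <= C * (INR q * ln (INR q)) / Mv v * W e X).
Proof.
move=> Lam0; have [c [c0 HW]] := W_long Lam0.
exists (8 / c); split; first by apply: Rdiv_lt_0_compat; lra.
apply: (ev_mp HW); apply: (ev_mp ev_Mv); apply: (ev_mp (ev_M_ge (/ c) 1)).
apply: ev_all => v; rewrite pow_1 => ML [l1 v1 M1 _] {}HW e q X e0 pq cq se qv X0 lX1 lX2.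
set M := Mv v in ML M1 HW *; set L := ln v in l1 ML *.
have lq := ln_prime_gt0 pq; have q0 := INR_gt0 (prime_gt0 pq).
have q1 := INR_ge1 (prime_gt0 pq).
have lqL : ln (INR q) <= L by apply: ln_le.
have cM : ln (INR q) <= c * M.
  apply: (Rle_trans _ _ _ lqL); apply: (Rmult_le_reg_l (/ c)); first exact: Rinv_0_lt_compat.
  by have -> : / c * (c * M) = M by field; lra.
have [J [J0 [J1 J2]]] := @floor_half (c * M / ln (INR q)) ltac:(apply/Rle_div_l'; lra).
have JR := INR_ge1 J0.
have eq0 : (0 < e * q)%N by rewrite muln_gt0 e0 prime_gt0.
have h := @V_ge e q X J (W (e * q) X / 2) pq cq X0.
have {}h : INR J * (W (e * q) X / 2 / (INR q + 1)) <= W e X.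
  apply: Rle_trans (V_le_W e q X); apply: h => j /andP[_ jJ].
  have := HW (e * q)%N X (INR q ^ j) eq0 se X0 lX1 lX2 (pow_R1_Rle _ _ q1).
  rewrite ln_pow_nat //; have : INR j * ln (INR q) <= c * M.
    have jJ' : INR j <= INR J by apply: le_INR; apply/leP.
    move: J1 => /(Rle_div_l' _ _ lq) J1; nra.
  by move=> h1 /(_ h1); lra.
set A := W (e * q) X in h *; have A0 : 0 <= A by exact: W_ge0.
have Jlow : c * M / (2 * ln (INR q)) <= INR J.
  have -> : c * M / (2 * ln (INR q)) = c * M / ln (INR q) / 2 by field; lra.
  by lra.
have qq : / (INR q + 1) >= / (2 * INR q).
  by apply: Rle_ge; apply: Rinv_le_contravar; lra.
have iq : 0 < / (2 * INR q) by apply: Rinv_0_lt_compat; lra.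
have h2 : c * M / (2 * ln (INR q)) * (A / 2 * / (2 * INR q)) <= W e X.
  apply: Rle_trans h; apply: Rmult_le_compat => //.
  - by apply/Rlt_le/Rdiv_lt_0_compat; nra.
  - by apply: Rmult_le_pos; lra.
  - by rewrite /Rdiv; apply: Rmult_le_compat_l; lra.
apply: (Rmult_le_reg_l (c * M / (2 * ln (INR q)) * (/ 2 * / (2 * INR q)))).
  apply: Rmult_lt_0_compat; first by apply: Rdiv_lt_0_compat; nra.
  by apply: Rmult_lt_0_compat; lra.
have -> : c * M / (2 * ln (INR q)) * (/ 2 * / (2 * INR q)) * (8 / c * (INR q * ln (INR q)) / M * W e X) = W e X by field; lra.
by have -> : c * M / (2 * ln (INR q)) * (/ 2 * / (2 * INR q)) * A = c * M / (2 * ln (INR q)) * (A / 2 * / (2 * INR q)) by field; lra.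
Qed.

(** * The kernel [min (u^al, 1/u)] *)

(** With [u = d / X], the branch [u^al] (for [d < X]) comes from the constraint on the radical of
    [m] and the branch [1 / u] (for [d > X]) from [m <= x]. *)
Definition gk (al u : R) : R := exp (Rmin (al * ln u) (- ln u)).
Definition H (al T : R) (e : nat) (X : R) : R := ksum T (gk al) e X.

Lemma gk_gt0 al u : 0 < gk al u.
Proof. exact: exp_pos. Qed.

Lemma gk_le1 al u : 0 < al -> gk al u <= 1.
Proof.
move=> al0; rewrite /gk -[X in _ <= X]exp_0; apply: exp_le.
case: (Rle_dec 0 (ln u)) => h.
  by apply: (Rle_trans _ _ _ (Rmin_r _ _)); lra.
by apply: (Rle_trans _ _ _ (Rmin_l _ _)); nra.
Qed.

Lemma H_ge0 al T e X : 0 <= H al T e X.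
Proof. by apply: ksum_ge0 => u; exact/Rlt_le/gk_gt0. Qed.

(** The multiples of [q] never lose under [X -> qX], so only the part prime to [q] is at risk. *)
Lemma H_step_up al T e q X : prime q -> coprime q e ->
  H al T e X - H al T (e * q) X <= H al T e (INR q * X).
Proof.
move=> pq cq; rewrite /H (ksum_split T (gk al) e X pq) (ksum_split T (gk al) e (INR q * X) pq).
rewrite ksum_dvd_shift //; have h1 := H_ge0 al T (e * q) X; have h2 := H_ge0 al T (e * q) (INR q * X).
rewrite /H in h1 h2; have q0 := INR_gt0 (prime_gt0 pq).
have : 0 <= ksum T (gk al) (e * q) X / (INR q + 1); last by lra.
by apply: Rmult_le_pos => //; apply/Rlt_le/Rinv_0_lt_compat; lra.
Qed.

(** Going down, the multiples of [q] lose [1 / (q + 1)] times the prime part at the new scale, and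
    that part itself, which belongs to [H] there, makes up for it. *)
Lemma H_step_down al T e q X : prime q -> coprime q e ->
  H al T e X - H al T (e * q) X <= H al T e (X / INR q).
Proof.
move=> pq cq; have q0 := INR_gt0 (prime_gt0 pq).
rewrite /H (ksum_split T (gk al) e X pq) (ksum_split T (gk al) e (X / INR q) pq).
have -> : ksum_dvd T (gk al) e q X = ksum_dvd T (gk al) e q (INR q * (X / INR q)).
  by congr ksum_dvd; field; lra.
rewrite ksum_dvd_shift //; have h1 := H_ge0 al T (e * q) (X / INR q).
rewrite /H in h1.
have : ksum T (gk al) (e * q) (X / INR q) / (INR q + 1) <= ksum T (gk al) (e * q) (X / INR q); last by lra.
apply: (Rmult_le_reg_r (INR q + 1)); first by lra.
by rewrite /Rdiv Rmult_assoc Rinv_l; nra.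
Qed.

Lemma INR_le3 a : (a <= 3)%N -> INR a <= 3.
Proof. by move=> /leP/le_INR /=; lra. Qed.

(** 2 and 3 cannot both divide an [e] with at most one prime factor. A bounded auxiliary prime keeps
    the losses of a step bounded by absolute factors. *)
Lemma aux_prime e : (0 < e)%N -> (size (primes e) <= 1)%N ->
  exists a, [/\ prime a, coprime a e, (a <= 3)%N & (size (primes (e * a)) <= 2)%N].
Proof.
move=> e0 se.
have [a [pa ca a3]] : exists a, [/\ prime a, coprime a e & (a <= 3)%N].
  case h2: (coprime 2 e); first by exists 2%N.
  case h3: (coprime 3 e); first by exists 3%N.
  have m2 : 2%N \in primes e by move: h2; rewrite coprime_prime_primes // => /negbFE.
  have m3 : 3%N \in primes e by move: h3; rewrite coprime_prime_primes // => /negbFE.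
  by case: (primes e) se m2 m3 => [//|p [|//]] _; rewrite !inE => /eqP<-.
exists a; split=> //.
have sub : {subset primes (e * a) <= a :: primes e}.
  by move=> p; rewrite (primesM _ e0 (prime_gt0 pa)) (primes_prime pa) !inE orbC.
by apply: leq_trans (uniq_leq_size (primes_uniq _) sub) _.
Qed.

(** On the shell [X / a < d <= X] with [a <= 3] the kernel is at least [3^(- al)]. *)
Lemma V_shell_le_ksum al T e a X : 0 < al -> 1 <= T -> prime a -> (a <= 3)%N -> 0 < X ->
  V e a X - V e a (X / INR a) <= exp (al * ln 3) * ksum_dvd T (gk al) e a X.
Proof.
move=> al0 T1 pa a3 X0; have a0 := INR_gt0 (prime_gt0 pa); have a1 := INR_ge1 (prime_gt0 pa).
have a3' : INR a <= 3 by exact: INR_le3.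
suff : V e a X <= V e a (X / INR a) + exp (al * ln 3) * ksum_dvd T (gk al) e a X by lra.
rewrite (VE e a X) (bigID (fun d => Rleb (INR d) (X / INR a))) /=; apply: Rplus_le_compat.
  rewrite VE; apply: rsum_le_incl; rewrite ?upto_uniq //; last by move=> d _ _; exact: w_ge0.
  move=> d /uptoP[d0 _] /andP[hd /RlebP le]; split=> //; last by lra.
  exact/uptoP.
rewrite /ksum_dvd -rsum_scal; apply: rsum_le_incl; rewrite ?upto_uniq //; last first.
  move=> d _ _; apply: Rmult_le_pos; first exact/Rlt_le/exp_pos.
  by apply: Rmult_le_pos; [exact: w_ge0 | exact/Rlt_le/gk_gt0].
move=> d /uptoP[d0 dX] /andP[hd /RlebP gt]; split=> //.
  by apply/uptoP; split=> //; nra.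
have d1 := INR_gt0 d0.
have -> : exp (al * ln 3) * (w d * gk al (INR d / X)) = w d * (exp (al * ln 3) * gk al (INR d / X)) by ring.
rewrite -{1}[w d]Rmult_1_r; apply: Rmult_le_compat_l; first exact: w_ge0.
rewrite /gk -exp_plus -[X in X <= _]exp_0; apply: exp_le.
have u1 : ln (INR d / X) <= 0.
  rewrite -ln_1; apply: ln_le; first by apply: Rdiv_lt_0_compat.
  by apply: (Rmult_le_reg_r X) => //; rewrite /Rdiv Rmult_assoc Rinv_l; lra.
have u2 : - ln 3 <= ln (INR d / X).
  rewrite -ln_Rinv; last by lra.
  apply: ln_le; first by apply: Rinv_0_lt_compat; lra.
  have dXa : X / INR a < INR d by lra.
  apply: (Rmult_le_reg_r (X * 3)); first by lra.
  have -> : / 3 * (X * 3) = X by field.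
  have -> : INR d / X * (X * 3) = 3 * INR d by field; lra.
  have : X < INR d * INR a; last by nra.
  have -> : X = X / INR a * INR a by field; lra.
  by apply: Rmult_lt_compat_r.
rewrite Rmin_left; nra.
Qed.

Lemma rsum_telescope (f : nat -> R) J :
  \rsum_(j <- iota 0 J) (f j - f j.+1) = f 0%N - f J.
Proof.
elim: J => [|J IH]; first by rewrite big_nil; ring.
by rewrite -addn1 iotaD big_cat /= big_seq1 IH add0n addn1; ring.
Qed.

(* On the multiples of a fixed prime [a] the kernel sum does not decrease under [X -> aX], so it
   is at least its average over the last [O(M)] scales, where [W] doubles. *)
Lemma H_lower al Lam : 0 < al -> 0 < Lam -> exists C, 0 < C /\ ev (fun v => forall T e X,
  1 <= T -> (0 < e)%N -> (size (primes e) <= 1)%N -> 0 < X -> v / 2 <= ln X -> ln X <= Lam * v ->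
  W e X <= C * Mv v * H al T e X).
Proof.
move=> al0 Lam0; have [kap [k0 HD]] := W_decay Lam0; have [C1 [C10 HQ]] := W_prime_le Lam0.
have l2 := ln2_bounds.
have E3 := exp_pos (al * ln 3); set E := exp (al * ln 3) in E3 *.
pose c := 3 / (kap * ln 2) + 1.
have c1 : 1 <= c by rewrite /c; have : 0 < 3 / (kap * ln 2) by [apply: Rdiv_lt_0_compat; nra]; lra.
exists (4 * E * c); split; first by nra.
apply: (ev_mp HD); apply: (ev_mp HQ); apply: (ev_mp ev_Mv); apply: (ev_mp (ev_M_const (36 * C1))).
apply: (ev_mp (ev_ln 2)).
apply: ev_all => v lv2 MC [l1 v1 M1 _] {}HQ {}HD T e X T1 e0 se X0 lX1 lX2.
have v3 : 3 <= v.
  by rewrite -(exp_ln v); [have := exp_ineq1_le (ln v); lra | lra].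
set M := Mv v in MC M1 HQ HD *.
have [a [pa ca a3 sea]] := aux_prime e0 se.
have a2 : 2 <= INR a by apply: (le_INR 2); apply/leP; exact: prime_gt1.
have a3' : INR a <= 3 by exact: INR_le3.
have la : ln 2 <= ln (INR a) by apply: ln_le; lra.
have lt : ln (INR a) <= 2.
  by have := exp_ineq1_le (ln (INR a)); rewrite exp_ln; lra.
set f := ksum_dvd T (gk al) e a.
have mono Z : f Z <= f (INR a * Z).
  rewrite /f ksum_dvd_shift //.
  have : 0 <= ksum T (gk al) (e * a) Z / (INR a + 1); last by lra.
  by apply: Rmult_le_pos; [exact: (H_ge0 al T) | apply/Rlt_le/Rinv_0_lt_compat; lra].
have fj j : f (X / INR a ^ j) <= f X.
  elim: j => [|j IH]; first by rewrite /= Rdiv_1_r; lra.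
  apply: Rle_trans IH; apply: (Rle_trans _ _ _ (mono _)); apply: Req_le; congr f.
  by rewrite /= /Rdiv Rinv_mult; field; split; [apply: pow_nonzero; lra | lra].
(* Over [J] scales [W] decays by at least [2 exp (-3)], which is below 1/4. *)
have [J [J1 J2]] := @ceil_div (3 * M / kap) (ln 2) ltac:(lra) ltac:(apply: Rmult_le_pos; [lra | exact/Rlt_le/Rinv_0_lt_compat]).
have JM : INR J <= c * M.
  apply: (Rmult_le_reg_r (ln 2)); first by lra.
  have -> : c * M * ln 2 = 3 * M / kap + M * ln 2 by rewrite /c; field; lra.
  have : 1 * ln 2 <= M * ln 2 by apply: Rmult_le_compat_r; lra.
  by lra.
have pwa j : 0 < INR a ^ j by apply: pow_lt; lra.
have sumV : V e a X - V e a (X / INR a ^ J) <= INR J * (E * f X).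
  have -> : V e a X - V e a (X / INR a ^ J) =
     \rsum_(j <- iota 0 J) (V e a (X / INR a ^ j) - V e a (X / INR a ^ j.+1)).
    by rewrite (rsum_telescope (fun j => V e a (X / INR a ^ j))) /= Rdiv_1_r.
  have -> : INR J = INR (count predT (iota 0 J)) by rewrite count_predT size_iota.
  rewrite -rsum_const; apply: rsum_le => j _ _.
  have -> : X / INR a ^ j.+1 = X / INR a ^ j / INR a by rewrite /= /Rdiv Rinv_mult; ring.
  apply: (Rle_trans _ _ _ (V_shell_le_ksum e al0 T1 pa a3 (Rdiv_lt_0_compat _ _ X0 (pwa j)))).
  by apply: Rmult_le_compat_l; [exact/Rlt_le/exp_pos | exact: fj].
have WJ : V e a (X / INR a ^ J) <= / 4 * W e X.
  apply: (Rle_trans _ _ _ (V_le_W _ _ _)).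
  have se2 : (size (primes e) <= 2)%N by exact: leq_trans se _.
  have aJ1 : 1 <= INR a ^ J by apply: pow_R1_Rle; lra.
  apply: (Rle_trans _ _ _ (HD e X (INR a ^ J) e0 se2 X0 lX2 aJ1)).
  apply: Rmult_le_compat_r; first exact: W_ge0.
  rewrite ln_pow_nat; last by lra.
  have h : 3 <= kap / M * (INR J * ln (INR a)).
    have -> : 3 = kap / M * (3 * M / kap) by field; lra.
    apply: Rmult_le_compat_l; first by apply/Rlt_le/Rdiv_lt_0_compat; lra.
    by have := pos_INR J; nra.
  have : exp (- (kap / M * (INR J * ln (INR a)))) <= / 8; last by lra.
  have e2 : 2 <= exp 1 by have := exp_ineq1_le 1; lra.
  apply: (Rle_trans _ (exp (- (1 + (1 + 1))))); first by apply: exp_le; lra.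
  rewrite exp_Ropp; apply: Rinv_le_contravar; first by lra.
  by rewrite !exp_plus; nra.
have Wa : W (e * a) X <= / 4 * W e X.
  apply: (Rle_trans _ _ _ (HQ e a X e0 pa ca sea ltac:(lra) X0 lX1 lX2)).
  apply: Rmult_le_compat_r; first exact: W_ge0.
  apply: (Rmult_le_reg_r M); first by lra.
  have -> : C1 * (INR a * ln (INR a)) / M * M = C1 * (INR a * ln (INR a)) by field; lra.
  have : INR a * ln (INR a) <= 6 by nra.
  by move=> h; have : C1 * (INR a * ln (INR a)) <= C1 * 6 by [apply: Rmult_le_compat_l; lra]; lra.
have WX := W_split e X pa; have WX0 := W_ge0 e X.
have fH : f X <= H al T e X.
  by rewrite /H (ksum_split T (gk al) e X pa) -/f; have := H_ge0 al T (e * a) X; rewrite /H; lra.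
have f0 : 0 <= f X by apply: ksum_dvd_ge0 => u; exact/Rlt_le/gk_gt0.
(* The multiples of [a] carry at least 3/4 of [W e X], and at most 1/4 of it lies below [X / a^J];
   the shells in between hold the remaining half. *)
have h1 : W e X <= 2 * (INR J * (E * f X)) by lra.
apply: (Rle_trans _ _ _ h1).
have -> : 4 * E * c * M * H al T e X = 2 * (c * M * (E * (2 * H al T e X))) by ring.
apply: Rmult_le_compat_l; first by lra.
apply: Rmult_le_compat => //; first exact: pos_INR.
- by nra.
- by apply: Rmult_le_compat_l; lra.
Qed.

Lemma gk_small al T u : 0 < al -> 0 < u -> 0 < T -> u <= / T -> gk al u <= exp (- (al * ln T)).
Proof.
move=> al0 u0 T0 uT; apply: exp_le; apply: (Rle_trans _ _ _ (Rmin_l _ _)).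
have : ln u <= - ln T by rewrite -ln_Rinv //; apply: ln_le.
by nra.
Qed.

(** Below [X / T] the kernel is at most [T^(- al)]; above it the bound 1 leaves a shell of [W]. *)
Lemma H_upper_shell al T e X : 0 < al -> 1 <= T -> 0 < X ->
  H al T e X <= exp (- (al * ln T)) * W e (X / T) + (W e (X * T) - W e (X / T)).
Proof.
move=> al0 T1 X0.
have XT : X / T <= X * T.
  apply: Rmult_le_compat_l; first by lra.
  by rewrite -[X in _ <= X]Rinv_inv; apply: Rinv_le_contravar; [apply: Rinv_0_lt_compat; lra |
     apply: (Rle_trans _ 1); [rewrite -Rinv_1; apply: Rinv_le_contravar; lra | lra]].
rewrite (W_shell e XT) /H /ksum (bigID (fun d => Rleb (INR d) (X / T))) /=.
have -> : forall x y, x + y - x = y by move=> x y; ring.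
apply: Rplus_le_compat.
  rewrite WE -rsum_scal; apply: rsum_le_incl; rewrite ?upto_uniq //; last first.
    by move=> d _ _; apply: Rmult_le_pos; [exact/Rlt_le/exp_pos | exact: w_ge0].
  move=> d /uptoP[d0 _] /andP[cd /RlebP le]; split=> //; first exact/uptoP.
  rewrite Rmult_comm; apply: Rmult_le_compat_r; first exact: w_ge0.
  apply: gk_small => //; [by apply: Rdiv_lt_0_compat => //; exact: INR_gt0 | lra |].
  apply: (Rmult_le_reg_r X) => //; rewrite /Rdiv Rmult_assoc Rinv_l; last by lra.
  by rewrite Rmult_1_r Rmult_comm.
apply: rsum_le => d _ _; have := gk_le1 (INR d / X) al0; have := w_gt0 d; have := gk_gt0 al (INR d / X); nra.
Qed.

(** The shell from [X / T] to [X T] takes two growth steps, hence [2 C + C^2]. Adding [1 / al] to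
    [B0] makes [T^(- al) <= 1 / v <= eps]. *)
Lemma H_upper al Lam : 0 < al -> 1 < Lam -> exists B0, 0 < B0 /\ forall B, B0 <= B ->
  exists C, 0 < C /\ ev (fun v => forall e X,
  (0 < e)%N -> (size (primes e) <= 2)%N -> 0 < X -> v / 2 <= ln X -> ln X <= (Lam - 1) * v ->
  H al (exp (B * ln v)) e X <= C * eps v * W e X).
Proof.
move=> al0 Lam1; have [B0 [B00 HB]] := @W_grow Lam ltac:(lra).
exists (B0 + / al); split; first by have := Rinv_0_lt_compat al al0; lra.
move=> B BB; have ial := Rinv_0_lt_compat al al0.
have [C [C0 HW]] := HB B ltac:(lra).
exists (1 + 2 * C + C * C); split; first by nra.
apply: (ev_mp HW); apply: (ev_mp ev_Mv); apply: (ev_mp (ev_ln_pow (4 * B) 1)); apply: (ev_mp (ev_M_ge 1 1)).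
apply: ev_all => v; rewrite !pow_1 => ML vB [l1 v1 M1 [MM Mlev eM evM _]] {}HW e X e0 se X0 lX1 lX2.
set T := exp (B * ln v).
have B0' : 0 < B by lra.
have T1 : 1 <= T by rewrite /T -exp_0; apply: exp_le; nra.
have T0 : 0 < T by lra.
have lT : ln T = B * ln v by rewrite ln_exp.
have XT0 : 0 < X / T by apply: Rdiv_lt_0_compat.
have lXT : ln (X / T) = ln X - B * ln v by rewrite ln_div // lT.
have h1 := HW e (X / T) e0 se XT0 ltac:(rewrite lXT; lra) ltac:(rewrite lXT; nra).
have h2 := HW e X e0 se X0 ltac:(lra) ltac:(nra).
rewrite -/T in h1 h2.
have E1 : T * (X / T) = X by field; lra.
rewrite E1 in h1.
have eps0 : 0 < eps v by nra.
have eps1 : eps v <= 1 by nra.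
have hH := @H_upper_shell al T e X al0 T1 X0; rewrite [X * T]Rmult_comm in hH.
have WX := W_ge0 e X; have WX' := W_ge0 e (X / T).
have WXT : W e (X / T) <= W e X.
  by apply: W_mono; apply: (Rmult_le_reg_r T) => //; rewrite /Rdiv Rmult_assoc Rinv_l; nra.
have small : exp (- (al * ln T)) <= eps v.
  apply: (Rle_trans _ (/ v)).
    rewrite lT -{2}(exp_ln v); last by lra.
    rewrite -exp_Ropp; apply: exp_le.
    have : 1 <= al * B; last by nra.
    have -> : 1 = al * / al by field; lra.
    by apply: Rmult_le_compat_l; lra.
  apply: (Rmult_le_reg_r v); first by lra.
  by rewrite Rinv_l; lra.
have h4 : C * eps v * W e (X / T) <= C * eps v * W e X by apply: Rmult_le_compat_l; nra.
have h5 : exp (- (al * ln T)) * W e (X / T) <= eps v * W e X.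
  by apply: Rmult_le_compat => //; exact/Rlt_le/exp_pos.
have h6 : 0 <= C * C * eps v * W e X by apply: Rmult_le_pos => //; nra.
lra.
Qed.

(** * Regularity at a fixed scale *)

(** What is known about [W] and [H] at one scale [v], with a single constant [C], so that the
    following arguments run at fixed [v]. The lower bound for [H] is confined to [e] with at most
    one prime factor because its proof spends a second prime. *)
Record regular (al Lam B C v : R) : Prop := Regular {
  reg_C : 1 <= C;
  reg_B : 1 <= B;
  reg_L : 1 <= ln v;
  reg_v : 1 <= v;
  reg_M : 1 <= Mv v;
  reg_Mv : Mv v <= v;
  reg_eM : eps v * Mv v = ln v;
  reg_ev : eps v * v = Mv v;
  reg_BL : 40 * B * ln v <= v;
  reg_CL : C ^ 6 * ln v ^ 9 <= Mv v;
  reg_grow : forall e y, (0 < e)%N -> (size (primes e) <= 2)%N -> 0 < y -> v / 4 <= ln y ->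
    ln y + B * ln v <= Lam * v -> W e (exp (B * ln v) * y) <= (1 + C * eps v) * W e y;
  reg_prime : forall e q X, (0 < e)%N -> prime q -> coprime q e ->
    (size (primes (e * q)) <= 2)%N -> INR q <= v -> 0 < X -> v / 2 <= ln X -> ln X <= Lam * v ->
    W (e * q) X <= C * (INR q * ln (INR q)) / Mv v * W e X;
  reg_decay : forall e Y r, (0 < e)%N -> (size (primes e) <= 2)%N -> 0 < Y -> ln Y <= Lam * v ->
    1 <= r -> W e (Y / r) <= 2 * exp (- (ln r / (C * Mv v))) * W e Y;
  reg_lo : forall e X, (0 < e)%N -> (size (primes e) <= 1)%N -> 0 < X -> v / 2 <= ln X ->
    ln X <= Lam * v -> W e X <= C * Mv v * H al (exp (B * ln v)) e X;
  reg_hi : forall e X, (0 < e)%N -> (size (primes e) <= 2)%N -> 0 < X -> v / 2 <= ln X ->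
    ln X <= (Lam - 1) * v -> H al (exp (B * ln v)) e X <= C * eps v * W e X
}.

Lemma ev_regular al Lam Bmin : 0 < al -> 1 < Lam ->
  exists B C, Bmin <= B /\ ev (regular al Lam B C).
Proof.
move=> al0 Lam1; have Lam0 : 0 < Lam by lra.
have [B1 [B10 HB1]] := W_grow Lam0; have [B2 [B20 HB2]] := H_upper al0 Lam1.
pose B := Rmax 1 (Rmax Bmin (Rmax B1 B2)).
have h1 : 1 <= B by exact: Rmax_l.
have h2 : Rmax Bmin (Rmax B1 B2) <= B by exact: Rmax_r.
have h3 := Rmax_l Bmin (Rmax B1 B2); have h4 := Rmax_r Bmin (Rmax B1 B2).
have h5 := Rmax_l B1 B2; have h6 := Rmax_r B1 B2.
have [C1 [C10 H1]] := HB1 B ltac:(lra); have [C2 [C20 H2]] := HB2 B ltac:(lra).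
have [C3 [C30 H3]] := W_prime_le Lam0; have [C4 [C40 H4]] := H_lower al0 Lam0.
have [kap [k0 H5]] := W_decay Lam0; have ik := Rinv_0_lt_compat kap k0.
exists B, (1 + C1 + C2 + C3 + C4 + / kap); split; first by lra.
set C := 1 + C1 + C2 + C3 + C4 + / kap.
apply: (ev_mp H1); apply: (ev_mp H2); apply: (ev_mp H3); apply: (ev_mp H4); apply: (ev_mp H5).
apply: (ev_mp ev_Mv); apply: (ev_mp (ev_ln_pow (40 * B) 1)); apply: (ev_mp (ev_M_ge (C ^ 6) 9)).
apply: ev_all => v MC; rewrite pow_1 => vB [l1 v1 M1 [MM Mlev eM evM _]] {}H5 {}H4 {}H3 {}H2 {}H1.
have eps0 : 0 < eps v by nra.
split=> //.
- by rewrite /C; lra.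
- move=> e y e0 se y0 ly1 ly2; apply: (Rle_trans _ _ _ (H1 e y e0 se y0 ly1 ly2)).
  by apply: Rmult_le_compat_r; [exact: W_ge0 | rewrite /C; nra].
- move=> e q X e0 pq cq se qv X0 lX1 lX2.
  apply: (Rle_trans _ _ _ (H3 e q X e0 pq cq se qv X0 lX1 lX2)).
  apply: Rmult_le_compat_r; first exact: W_ge0.
  apply: Rmult_le_compat_r; first by apply/Rlt_le/Rinv_0_lt_compat; lra.
  apply: Rmult_le_compat_r; last by rewrite /C; lra.
  by apply: Rmult_le_pos; [exact: pos_INR | exact/Rlt_le/ln_prime_gt0].
- move=> e Y r e0 se Y0 lY r1; apply: (Rle_trans _ _ _ (H5 e Y r e0 se Y0 lY r1)).
  apply: Rmult_le_compat_r; first exact: W_ge0.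
  apply: Rmult_le_compat_l; first by lra.
  apply: exp_le; apply: Ropp_le_contravar.
  have lr0 : 0 <= ln r by rewrite -ln_1; apply: ln_le; lra.
  have -> : kap / Mv v * ln r = ln r * / (/ kap * Mv v) by field; lra.
  apply: Rmult_le_compat_l => //; apply: Rinv_le_contravar; first by nra.
  by rewrite /C; apply: Rmult_le_compat_r; lra.
- move=> e X e0 se X0 lX1 lX2.
  have T1 : 1 <= exp (B * ln v) by rewrite -exp_0; apply: exp_le; nra.
  apply: (Rle_trans _ _ _ (H4 _ e X T1 e0 se X0 lX1 lX2)).
  apply: Rmult_le_compat_r; first exact: H_ge0.
  by apply: Rmult_le_compat_r; [lra | rewrite /C; lra].
- move=> e X e0 se X0 lX1 lX2; apply: (Rle_trans _ _ _ (H2 e X e0 se X0 lX1 lX2)).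
  apply: Rmult_le_compat_r; first exact: W_ge0.
  by apply: Rmult_le_compat_r; [lra | rewrite /C; lra].
Qed.

Lemma size_primes_mul e q : (0 < e)%N -> prime q ->
  (size (primes (e * q)) <= (size (primes e)).+1)%N.
Proof.
move=> e0 pq; have sub : {subset primes (e * q) <= q :: primes e}.
  by move=> p; rewrite (primesM _ e0 (prime_gt0 pq)) (primes_prime pq) !inE orbC.
exact: uniq_leq_size (primes_uniq _) sub.
Qed.

Lemma ln_le_self x : 0 < x -> ln x <= x.
Proof. by move=> x0; have := exp_ineq1_le (ln x); rewrite exp_ln; lra. Qed.

Lemma reg_eps_bounds al Lam B C v : regular al Lam B C v ->
  [/\ 0 < eps v, eps v <= 1, / v <= eps v & C ^ 6 * ln v ^ 8 * eps v <= 1].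
Proof.
move=> rg; have [C1 B1 L1 v1 M1 Mv_ eM ev_ BL CL _ _ _ _ _] := rg.
have e0 : 0 < eps v by nra.
have C6 : 1 <= C ^ 6 by apply: pow_R1_Rle.
have L8 : 1 <= ln v ^ 8 by apply: pow_R1_Rle.
have h : C ^ 6 * ln v ^ 8 * eps v <= 1.
  apply: (Rmult_le_reg_r (Mv v)); first by lra.
  rewrite Rmult_assoc eM; have -> : C ^ 6 * ln v ^ 8 * ln v = C ^ 6 * ln v ^ 9 by ring.
  by lra.
split=> //.
- have : 1 <= C ^ 6 * ln v ^ 8 by nra.
  by nra.
- apply: (Rmult_le_reg_r v); first by lra.
  by rewrite Rinv_l; lra.
Qed.

(** Chain [H (e * q)] to [W (e * q)] to [W e] to [H e]. The factor [1 / Mv] gained by removing [q]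
    cancels the [Mv] lost in the lower bound for [H], so one factor [eps] survives. *)
Lemma H_prime_le al Lam B C v e q X : regular al Lam B C v -> 3 <= Lam ->
  (0 < e)%N -> (size (primes e) <= 1)%N -> prime q -> coprime q e -> INR q <= v ->
  0 < X -> v / 2 <= ln X -> ln X <= 2 * v ->
  H al (exp (B * ln v)) (e * q) X <=
  C ^ 3 * eps v * (INR q * ln (INR q)) * H al (exp (B * ln v)) e X.
Proof.
move=> rg Lam3 e0 se pq cq qv X0 lX1 lX2; have [C1 _ L1 v1 M1 _ eM _ _ _ _ hp _ hlo hhi] := rg.
have [eps0 _ _ _] := reg_eps_bounds rg.
have eq0 : (0 < e * q)%N by rewrite muln_gt0 e0 prime_gt0.
have seq : (size (primes (e * q)) <= 2)%N by apply: leq_trans (size_primes_mul e0 pq) _.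
apply: (Rle_trans _ _ _ (hhi _ X eq0 seq X0 lX1 ltac:(nra))).
have h1 := hp e q X e0 pq cq seq qv X0 lX1 ltac:(nra).
have h2 := hlo e X e0 se X0 lX1 ltac:(nra).
set T := exp (B * ln v) in h2 *; set h := H al T e X in h2 *.
have q0 : 0 <= INR q * ln (INR q).
  by apply: Rmult_le_pos; [exact: pos_INR | exact/Rlt_le/ln_prime_gt0].
have -> : C ^ 3 * eps v * (INR q * ln (INR q)) * h =
   C * eps v * (C * (INR q * ln (INR q)) / Mv v * (C * Mv v * h)) by field; lra.
apply: Rmult_le_compat_l; first by nra.
apply: (Rle_trans _ _ _ h1); apply: Rmult_le_compat_l => //.
by apply: Rmult_le_pos; [nra | apply/Rlt_le/Rinv_0_lt_compat; lra].
Qed.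

(** Squares are the convenient weakening for products: [a^2 + b^2 <= a^2 b^2] for [a, b >= 2], so
    the errors of the factors of [n] add up to no more than the error of [n]. *)
Lemma H_prime_le_sq al Lam B C v e q X : regular al Lam B C v -> 3 <= Lam ->
  (0 < e)%N -> (size (primes e) <= 1)%N -> prime q -> coprime q e -> INR q <= v ->
  0 < X -> v / 2 <= ln X -> ln X <= 2 * v ->
  H al (exp (B * ln v)) (e * q) X <= C ^ 3 * eps v * (INR q * INR q) * H al (exp (B * ln v)) e X.
Proof.
move=> rg Lam3 e0 se pq cq qv X0 lX1 lX2.
apply: (Rle_trans _ _ _ (H_prime_le rg Lam3 e0 se pq cq qv X0 lX1 lX2)).
have [eps0 _ _ _] := reg_eps_bounds rg; have C1 := reg_C rg.
have q0 := INR_gt0 (prime_gt0 pq); have lq := ln_le_self q0.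
apply: Rmult_le_compat_r; first exact: H_ge0.
apply: Rmult_le_compat_l; first by apply: Rmult_le_pos; [apply: pow_le; lra | lra].
by apply: Rmult_le_compat_l; lra.
Qed.

Lemma H_mul_ge al Lam B C v e n X : regular al Lam B C v -> 3 <= Lam ->
  (0 < e)%N -> (size (primes e) <= 1)%N -> (0 < n)%N -> coprime n e -> INR n <= v ->
  0 < X -> v / 2 <= ln X -> ln X + ln (INR n) <= 2 * v ->
  (1 - C ^ 3 * eps v * (INR n * INR n)) * H al (exp (B * ln v)) e X <=
  H al (exp (B * ln v)) e (INR n * X).
Proof.
move=> rg Lam3 e0 se; have [eps0 _ _ _] := reg_eps_bounds rg; have C1 := reg_C rg.
have K0 : 0 < C ^ 3 * eps v by apply: Rmult_lt_0_compat => //; apply: pow_lt; lra.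
set K := C ^ 3 * eps v in K0 *; set T := exp (B * ln v).
have prime_case q X' : prime q -> coprime q e -> INR q <= v -> 0 < X' -> v / 2 <= ln X' ->
    ln X' <= 2 * v ->
    (1 - K * (INR q * INR q)) * H al T e X' <= H al T e (INR q * X').
  move=> pq cq qv X0 lX1 lX2; have := H_prime_le_sq rg Lam3 e0 se pq cq qv X0 lX1 lX2.
  by have := @H_step_up al T e q X' pq cq; rewrite -/K -/T; lra.
elim/ltn_ind: n X => n IH X n0 cn nv X0 lX1 lX2.
have h0 := H_ge0 al T e X.
have [n1|n1] := leqP n 1.
  have -> : n = 1%N by apply/eqP; rewrite eqn_leq n1.
  by rewrite /= !Rmult_1_l; nra.
have pq := pdiv_prime n1; set q := pdiv n in pq.
have /dvdnP[m nE] : (q %| n)%N := pdiv_dvd n.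
have m0 : (0 < m)%N by move: n0; rewrite nE muln_gt0 => /andP[].
have q1 := INR_ge1 (prime_gt0 pq); have mR := INR_ge1 m0.
have qn : INR n = INR q * INR m by rewrite nE INR_mul Rmult_comm.
have mn : (m < n)%N by rewrite nE -{1}[m]muln1 ltn_pmul2l // prime_gt1.
have cm : coprime m e by apply: coprime_dvdl cn; rewrite nE dvdn_mulr.
have cq : coprime q e by apply: coprime_dvdl cn; exact: pdiv_dvd.
have lnm : ln (INR n) = ln (INR q) + ln (INR m) by rewrite qn ln_mult; lra.
have lq0 := ln_prime_gt0 pq; have lm0 := ln_INR_ge0 m0.
have hm := IH m mn X m0 cm ltac:(nra) X0 lX1 ltac:(lra).
have mX0 : 0 < INR m * X by nra.
have lmX : ln (INR m * X) = ln (INR m) + ln X by rewrite ln_mult; lra.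
have hq := prime_case q (INR m * X) pq cq ltac:(nra) mX0 ltac:(lra) ltac:(lra).
have -> : INR n * X = INR q * (INR m * X) by rewrite qn; ring.
have hqm := H_ge0 al T e (INR q * (INR m * X)).
(* If the claimed error reaches 1, the left side is not positive. Otherwise all factors [1 - error]
   in the product are nonnegative and may be multiplied. *)
case: (Rle_dec 1 (K * (INR n * INR n))) => [big|small].
  apply: (Rle_trans _ 0) => //; rewrite -(Rmult_0_l (H al T e X)).
  by apply: Rmult_le_compat_r; lra.
have q2 : 2 <= INR q by apply: (le_INR 2); apply/leP; exact: prime_gt1.
have qqn : INR q * INR q <= INR n * INR n.
  have mm : 1 <= INR m * INR m by nra.
  have -> : INR n * INR n = INR q * INR q * (INR m * INR m) by rewrite qn; ring.
  by nra.
have Kq : K * (INR q * INR q) <= K * (INR n * INR n) by apply: Rmult_le_compat_l; lra.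
case: (ltnP 1 m) => [m1|m1]; last first.
  have m1' : m = 1%N by apply/eqP; rewrite eqn_leq m1.
  move: hq; rewrite m1' /= !Rmult_1_l => hq; apply: Rle_trans hq.
  by apply: Rmult_le_compat_r => //; lra.
have m2 : 2 <= INR m by apply: (le_INR 2); apply/leP.
apply: Rle_trans hq.
apply: (Rle_trans _ ((1 - K * (INR q * INR q)) * ((1 - K * (INR m * INR m)) * H al T e X))).
  rewrite -[X in _ <= X]Rmult_assoc; apply: Rmult_le_compat_r => //.
  have : INR q * INR q + INR m * INR m <= INR n * INR n.
    rewrite qn; set a := INR q * INR q; set b := INR m * INR m.
    have -> : INR q * INR m * (INR q * INR m) = a * b by rewrite /a /b; ring.
    have : 4 <= a by rewrite /a; nra.
    have : 4 <= b by rewrite /b; nra.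
    by nra.
  move=> hs; have := Rmult_le_compat_l K _ _ (Rlt_le _ _ K0) hs.
  have : 0 <= K * (INR q * INR q) * (K * (INR m * INR m)) by apply: Rmult_le_pos; nra.
  by lra.
by apply: Rmult_le_compat_l; lra.
Qed.

(** * Interpolation between integer dilations *)

Lemma exp_le_quadratic a u : Rabs u <= a -> exp u <= 1 + u + u * u * exp a.
Proof.
move=> ua; have ea := exp_pos a; have eu := exp_pos u.
have h1 : exp u <= 1 + u * exp u.
  have := exp_ineq1_le (- u); rewrite exp_Ropp => h.
  have : exp u * (1 + - u) <= 1.
    have := Rmult_le_compat_l (exp u) _ _ (Rlt_le _ _ eu) h.
    by rewrite Rinv_r; lra.
  by lra.
suff : u * (exp u - 1) <= u * u * exp a by lra.
have ule : u <= a by have := Rle_abs u; lra.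
have eua := exp_le ule.
case: (Rle_dec 0 u) => u0.
  apply: (Rle_trans _ (u * (u * exp u))); first by apply: Rmult_le_compat_l; lra.
  by have : 0 <= u * u by [nra]; nra.
have h2 := exp_ineq1_le u.
have a0 : 1 <= exp a by rewrite -exp_0; apply: exp_le; have := Rabs_pos u; lra.
have : u * (exp u - 1) <= u * u by nra.
by have : 0 <= u * u by [nra]; nra.
Qed.

Lemma ln_1p_ge y : - / 2 <= y -> y - 2 * (y * y) <= ln (1 + y).
Proof.
move=> y2; have i0 : 0 < / (1 + y) by apply: Rinv_0_lt_compat; lra.
have h := exp_ineq1_le (ln (/ (1 + y))); rewrite exp_ln // ln_Rinv in h; last by lra.
have : / (1 + y) <= 1 - y + 2 * (y * y); last by lra.
apply: (Rmult_le_reg_r (1 + y)); first by lra.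
rewrite Rinv_l; last by lra.
by have : 0 <= y * y * (1 + 2 * y) by [apply: Rmult_le_pos; nra]; nra.
Qed.

Lemma pow_neg_le_quadratic al y : 0 < al -> Rabs y <= / 2 ->
  exp (- (al * ln (1 + y))) <= 1 - al * y + (2 * al + 4 * (al * al) * exp al) * (y * y).
Proof.
move=> al0 ya; have y1 : - / 2 <= y by have := Rabs_def2; move: ya; rewrite /Rabs; case: Rcase_abs; lra.
have y2 : y <= / 2 by have := Rle_abs y; lra.
have hl := ln_1p_ge y1.
set u := - (al * y) + 2 * al * (y * y).
apply: (Rle_trans _ (exp u)); first by apply: exp_le; rewrite /u; nra.
have yy : 0 <= y * y by nra.
have ua : Rabs u <= al.
  have -> : u = al * (- y + 2 * (y * y)) by rewrite /u; ring.
  have h1 : - 1 <= - y + 2 * (y * y) by nra.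
  have h2 : - y + 2 * (y * y) <= 1 by nra.
  by apply: Rabs_le; split; nra.
have hu := exp_le_quadratic ua; have ea := exp_pos al.
have u2 : u * u <= 4 * (al * al) * (y * y).
  have -> : u * u = al * al * (y * y) * ((1 - 2 * y) * (1 - 2 * y)) by rewrite /u; ring.
  have : 0 <= al * al * (y * y) by apply: Rmult_le_pos; nra.
  have : (1 - 2 * y) * (1 - 2 * y) <= 4 by nra.
  by nra.
have : u * u * exp al <= 4 * (al * al) * (y * y) * exp al by apply: Rmult_le_compat_r; lra.
rewrite /u in hu *; lra.
Qed.

Lemma gk_le_inv al u : 0 < u -> gk al u <= / u.
Proof.
move=> u0; rewrite -{2}(exp_ln u) // -exp_Ropp; apply: exp_le; exact: Rmin_r.
Qed.

(** The second-order constant of [pow_neg_le_quadratic], times 4 because the nodes lie within 2 of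
    [t], hence within relative distance [2 / t]. *)
Definition interp_const (al : R) : R := 4 * (2 * al + 4 * (al * al) * exp al).

Lemma interp_const_ge0 al : 0 < al -> 0 <= interp_const al.
Proof.
move=> al0; rewrite /interp_const; have ea := exp_pos al.
by have : 0 <= al * al * exp al by [nra]; nra.
Qed.

(* The first branch of the kernel is linear in [t] and the second is convex with second derivative
   [O(t^-2)]; taking the minimum of the two only helps. *)
Lemma gk_interp al lam n n' t c : 0 < al -> 0 < c -> 4 <= t -> t - 2 <= n -> n <= t -> t <= n' ->
  n' <= t + 2 -> 0 <= lam <= 1 -> (1 - lam) * n + lam * n' = t ->
  (1 - lam) * gk al (c / n) + lam * gk al (c / n') <=
  (1 + interp_const al / (t * t)) * gk al (c / t).
Proof.
move=> al0 c0 t4 n1 n2 n3 n4 lam01 lamt.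
have ic0 := interp_const_ge0 al0.
have fac0 : 0 <= interp_const al / (t * t) by apply: Rmult_le_pos => //; apply/Rlt_le/Rinv_0_lt_compat; nra.
have g0 := gk_gt0 al (c / t).
have cq x : 0 < x -> 0 < c / x by move=> x0; apply: Rdiv_lt_0_compat.
case: (Rle_dec t c) => tc.
  have -> : gk al (c / t) = t / c.
    have l0 : 0 <= ln (c / t).
      rewrite -ln_1; apply: ln_le; first lra.
      by apply: (Rmult_le_reg_r t); [lra | rewrite /Rdiv Rmult_assoc Rinv_l; lra].
    rewrite /gk Rmin_right; last by nra.
    by rewrite exp_Ropp exp_ln; [field; lra | apply: cq; lra].
  have gn : gk al (c / n) <= n / c.
    by apply: (Rle_trans _ _ _ (gk_le_inv al (cq n ltac:(lra)))); apply: Req_le; field; lra.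
  have gn' : gk al (c / n') <= n' / c.
    by apply: (Rle_trans _ _ _ (gk_le_inv al (cq n' ltac:(lra)))); apply: Req_le; field; lra.
  have tc0 : 0 < t / c by apply: Rdiv_lt_0_compat; lra.
  apply: (Rle_trans _ ((1 - lam) * (n / c) + lam * (n' / c))).
    by apply: Rplus_le_compat; apply: Rmult_le_compat_l; lra.
  have -> : (1 - lam) * (n / c) + lam * (n' / c) = t / c.
    by rewrite -lamt; field; lra.
  by nra.
have gt : gk al (c / t) = exp (al * ln (c / t)).
  have l0 : ln (c / t) <= 0.
    rewrite -ln_1; apply: ln_le; first by apply: cq; lra.
    by apply: (Rmult_le_reg_r t); [lra | rewrite /Rdiv Rmult_assoc Rinv_l; lra].
  by rewrite /gk Rmin_left //; nra.
have gx x : 0 < x -> Rabs (x / t - 1) <= / 2 -> gk al (c / x) <= gk al (c / t) *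
    (1 - al * (x / t - 1) + (2 * al + 4 * (al * al) * exp al) * ((x / t - 1) * (x / t - 1))).
  move=> x0 hx; have := pow_neg_le_quadratic al0 hx.
  have -> : 1 + (x / t - 1) = x / t by ring.
  move=> h; apply: (Rle_trans _ (gk al (c / t) * exp (- (al * ln (x / t))))); last first.
    by apply: Rmult_le_compat_l; lra.
  rewrite gt -exp_plus; apply: exp_le; apply: (Rle_trans _ _ _ (Rmin_l _ _)).
  by apply: Req_le; rewrite !ln_div; lra.
set K := 2 * al + 4 * (al * al) * exp al in gx.
have K0 : 0 <= K by rewrite /interp_const -/K in ic0; lra.
have it : 0 < / t by apply: Rinv_0_lt_compat; lra.
have it4 : 2 * / t <= / 2.
  by apply: (Rmult_le_reg_r t); [lra | rewrite Rmult_assoc Rinv_l; lra].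
have yn x : t - 2 <= x -> x <= t + 2 -> - (2 * / t) <= x / t - 1 <= 2 * / t.
  move=> x1 x2; have -> : x / t - 1 = (x - t) * / t by field; lra.
  by split; nra.
have hn : gk al (c / n) <= gk al (c / t) * (1 - al * (n / t - 1) + K * ((n / t - 1) * (n / t - 1))).
  by apply: gx; [lra | apply: Rabs_le; have := yn n ltac:(lra) ltac:(lra); lra].
have hn' : gk al (c / n') <= gk al (c / t) * (1 - al * (n' / t - 1) + K * ((n' / t - 1) * (n' / t - 1))).
  by apply: gx; [lra | apply: Rabs_le; have := yn n' ltac:(lra) ltac:(lra); lra].
have sq x : t - 2 <= x -> x <= t + 2 -> (x / t - 1) * (x / t - 1) <= 4 / (t * t).
  move=> x1 x2; have := yn x x1 x2.
  have -> : 4 / (t * t) = (2 * / t) * (2 * / t) by field; lra.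
  by nra.
have s1 := sq n ltac:(lra) ltac:(lra); have s2 := sq n' ltac:(lra) ltac:(lra).
apply: (Rle_trans _ ((1 - lam) * (gk al (c / t) * (1 - al * (n / t - 1) + K * (4 / (t * t)))) +
   lam * (gk al (c / t) * (1 - al * (n' / t - 1) + K * (4 / (t * t)))))).
  apply: Rplus_le_compat; apply: Rmult_le_compat_l; try lra.
  - apply: (Rle_trans _ _ _ hn); apply: Rmult_le_compat_l; first by lra.
    by have := Rmult_le_compat_l K _ _ K0 s1; lra.
  - apply: (Rle_trans _ _ _ hn'); apply: Rmult_le_compat_l; first by lra.
    by have := Rmult_le_compat_l K _ _ K0 s2; lra.
apply: Req_le.
have -> : interp_const al / (t * t) = K * (4 / (t * t)) by rewrite /interp_const -/K; field; lra.
have lin : (1 - lam) * (n / t - 1) + lam * (n' / t - 1) = 0.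
  have -> : (1 - lam) * (n / t - 1) + lam * (n' / t - 1) = ((1 - lam) * n + lam * n') / t - 1 by field; lra.
  by rewrite lamt; field; lra.
set G := gk al (c / t); set S4 := K * (4 / (t * t)).
have -> : (1 - lam) * (G * (1 - al * (n / t - 1) + S4)) + lam * (G * (1 - al * (n' / t - 1) + S4)) =
  G * (1 - al * ((1 - lam) * (n / t - 1) + lam * (n' / t - 1)) + S4) by ring.
by rewrite lin; ring.
Qed.

(** The sums are cut at different points. Up to [n X T] the kernels are compared term by term; the
    later terms of the sum at [n' X] have kernel at most [3 / T] and form the last error term. *)
Lemma H_interp al T e X lam n n' t : 0 < al -> 0 < T -> 0 < X -> 4 <= t -> t - 2 <= n -> n <= t ->
  t <= n' -> n' <= t + 2 -> 0 <= lam <= 1 -> (1 - lam) * n + lam * n' = t ->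
  (1 - lam) * H al T e (n * X) + lam * H al T e (n' * X) <=
  (1 + interp_const al / (t * t)) * H al T e (t * X) + 3 / T * W e (n' * X * T).
Proof.
move=> al0 T0 X0 t4 n1 n2 n3 n4 lam01 lamt.
have ic0 := interp_const_ge0 al0.
have fac0 : 0 <= interp_const al / (t * t) by apply: Rmult_le_pos => //; apply/Rlt_le/Rinv_0_lt_compat; nra.
have nn' : n * X * T <= n' * X * T by apply: Rmult_le_compat_r; [lra | nra].
rewrite /H [ksum T (gk al) e (n' * X)]/ksum (bigID (fun d => Rleb (INR d) (n * X * T))) /=.
have -> : \rsum_(d <- upto (n' * X * T) | coprime d e && Rleb (INR d) (n * X * T)) (w d * gk al (INR d / (n' * X))) =
   \rsum_(d <- upto (n * X * T) | coprime d e) (w d * gk al (INR d / (n' * X))).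
  rewrite -[LHS]big_filter -[RHS]big_filter; apply: perm_big; apply: uniq_perm;
    try by rewrite (filter_uniq _ (upto_uniq _)).
  move=> d; rewrite [LHS]mem_filter [RHS]mem_filter !mem_upto.
  case: (RlebP (INR d) (n * X * T)) => h; rewrite ?andbF ?andbT //.
  by case: (RlebP (INR d) (n' * X * T)) => h'; [rewrite ?andbT | exfalso; lra].
rewrite Rmult_plus_distr_l -Rplus_assoc; apply: Rplus_le_compat.
  rewrite /ksum -!rsum_scal -big_split /=.
  apply: rsum_le_incl; rewrite ?upto_uniq //; last first.
    move=> d _ _; apply: Rmult_le_pos; first by lra.
    by apply: Rmult_le_pos; [exact: w_ge0 | exact/Rlt_le/gk_gt0].
  move=> d /uptoP[d0 dY] cd; split=> //.
    apply/uptoP; split=> //; apply: (Rle_trans _ _ _ dY).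
    by apply: Rmult_le_compat_r; [lra | nra].
  have dx x : 0 < x -> INR d / (x * X) = INR d / X / x by move=> x0; field; lra.
  rewrite !dx; try lra.
  have dX : 0 < INR d / X by apply: Rdiv_lt_0_compat => //; exact: INR_gt0.
  have := @gk_interp al lam n n' t (INR d / X) al0 dX t4 n1 n2 n3 n4 lam01 lamt.
  by have := w_gt0 d; nra.
rewrite WE -!rsum_scal; apply: rsum_le_incl; rewrite ?upto_uniq //; last first.
  move=> d _ _; apply: Rmult_le_pos; last exact: w_ge0.
  by apply/Rlt_le/Rdiv_lt_0_compat; lra.
move=> d dY /andP[cd /RlebP dn]; split=> //; have [d0 _] := elimT (uptoP _ _) dY.
have wd := w_gt0 d; have d1 := INR_gt0 d0.
have nX : 0 < n' * X by nra.
have hg : gk al (INR d / (n' * X)) <= 3 / T.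
  apply: (Rle_trans _ _ _ (gk_le_inv al (Rdiv_lt_0_compat _ _ d1 nX))).
  have -> : / (INR d / (n' * X)) = n' * X / INR d by field; lra.
  apply: (Rmult_le_reg_r (INR d * T)); first by nra.
  have -> : n' * X / INR d * (INR d * T) = n' * X * T by field; lra.
  have -> : 3 / T * (INR d * T) = 3 * INR d by field; lra.
  (* From [n >= 2] and [n' <= n + 4]. *)
  have : n' * X * T <= 3 * (n * X * T); last by lra.
  have XT : 0 < X * T by nra.
  by nra.
have g0 := gk_gt0 al (INR d / (n' * X)).
apply: (Rle_trans _ (w d * gk al (INR d / (n' * X)))).
  by have := Rmult_lt_0_compat _ _ wd g0; set x := w d * _ => x0; nra.
by rewrite Rmult_comm; apply: Rmult_le_compat_r; lra.
Qed.

Lemma reg_W_T al Lam B C v e X : regular al Lam B C v -> 2 <= Lam ->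
  (0 < e)%N -> (size (primes e) <= 2)%N -> 0 < X -> v / 4 <= ln X -> ln X <= 3 / 2 * v ->
  W e (X * exp (B * ln v) * exp (B * ln v)) <= 4 * W e X.
Proof.
move=> rg Lam2 e0 se X0 lX1 lX2; have [C1 B1 L1 v1 _ _ _ _ BL _ hg _ _ _ _] := rg.
have [eps0 _ _ hC] := reg_eps_bounds rg.
set T := exp (B * ln v) in hg *; have T0 : 0 < T by exact: exp_pos.
have lT : ln T = B * ln v by rewrite ln_exp.
have BL0 : 0 <= B * ln v by nra.
have h1 := hg e X e0 se X0 lX1 ltac:(nra).
have TX0 : 0 < T * X by nra.
have lTX : ln (T * X) = B * ln v + ln X by rewrite ln_mult // lT.
have h2 := hg e (T * X) e0 se TX0 ltac:(lra) ltac:(rewrite lTX; nra).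
have -> : X * T * T = T * (T * X) by ring.
have Ce : C * eps v <= 1.
  have : C * eps v <= C ^ 6 * ln v ^ 8 * eps v; last by lra.
  apply: Rmult_le_compat_r; first by lra.
  have : C * 1 <= C ^ 6; last first.
    have : 1 <= ln v ^ 8 by apply: pow_R1_Rle.
    by have : 1 <= C ^ 6 by [apply: pow_R1_Rle]; nra.
  by rewrite Rmult_1_r -{1}(pow_1 C); apply: Rle_pow; [lra | lia].
have W0 := W_ge0 e X; have W1 := W_ge0 e (T * X).
by nra.
Qed.

(** A lower bound at both nodes passes to [t] at the cost of the interpolation error and of the
    cut-off error. The latter is [O(W / T)]; since [W <= C Mv H] and [B >= 2] gives [T >= v^2], it
    is at most [12 C / v] times [H]. *)
Lemma H_real_ge al Lam B C v e X t n n' mu : regular al Lam B C v -> 0 < al -> 4 <= Lam -> 2 <= B ->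
  (0 < e)%N -> (size (primes e) <= 1)%N -> 0 < X -> v / 2 <= ln X -> ln X <= 3 / 2 * v ->
  4 <= t -> t + 2 <= v -> t - 2 <= n -> n <= t -> t < n' -> n' <= t + 2 -> 0 <= mu <= 1 ->
  mu * H al (exp (B * ln v)) e X <= H al (exp (B * ln v)) e (n * X) ->
  mu * H al (exp (B * ln v)) e X <= H al (exp (B * ln v)) e (n' * X) ->
  (mu - interp_const al / (t * t) - 12 * C / v) * H al (exp (B * ln v)) e X <=
  H al (exp (B * ln v)) e (t * X).
Proof.
move=> rg al0 Lam4 B2 e0 se X0 lX1 lX2 t4 tv n1 n2 n3 n4 mu01 hn hn'.
have [C1 B1 L1 v1 M1 Mv_ _ _ BL _ _ _ _ hlo _] := rg.
set T := exp (B * ln v) in hn hn' *; have T0 : 0 < T by exact: exp_pos.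
have vE : v = exp (ln v) by rewrite exp_ln; lra.
have Tv : v * v <= T by rewrite {1 2}vE -exp_plus /T; apply: exp_le; nra.
have Tv1 : v <= T by nra.
pose lam := (t - n) / (n' - n).
have lamE : lam * (n' - n) = t - n by rewrite /lam; field; lra.
have lam01 : 0 <= lam <= 1.
  split; first by apply: Rmult_le_pos; [lra | apply/Rlt_le/Rinv_0_lt_compat; lra].
  by apply: (Rmult_le_reg_r (n' - n)); [lra | rewrite lamE; lra].
have hi := @H_interp al T e X lam n n' t al0 T0 X0 t4 n1 n2 ltac:(lra) n4 lam01 ltac:(lra).
have W4 : W e (n' * X * T) <= 4 * W e X.
  apply: Rle_trans (reg_W_T rg _ e0 (leq_trans se _) X0 _ lX2) => //; try lra.
  apply: W_mono; rewrite -/T; apply: Rmult_le_compat_r; first by lra.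
  by rewrite Rmult_comm; apply: Rmult_le_compat_l; lra.
have hW := hlo e X e0 se X0 lX1 ltac:(nra).
set h := H al T e X in hn hn' hW *; have h0 : 0 <= h by exact: H_ge0.
have ht0 := H_ge0 al T e (t * X); set ht := H al T e (t * X) in hi ht0 *.
have err : 3 / T * W e (n' * X * T) <= 12 * C / v * h.
  have W0 := W_ge0 e X.
  apply: (Rle_trans _ (3 / T * (4 * (C * Mv v * h)))).
    by apply: Rmult_le_compat_l; [apply/Rlt_le/Rdiv_lt_0_compat; lra | lra].
  apply: (Rle_trans _ (3 / (v * v) * (4 * (C * v * h)))); last first.
    by apply: Req_le; field; lra.
  apply: Rmult_le_compat.
  - by apply/Rlt_le/Rdiv_lt_0_compat; lra.
  - by apply: Rmult_le_pos; [lra | apply: Rmult_le_pos => //; nra].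
  - by apply: Rmult_le_compat_l; [lra | apply: Rinv_le_contravar; nra].
  - apply: Rmult_le_compat_l; first by lra.
    by apply: Rmult_le_compat_r => //; apply: Rmult_le_compat_l; lra.
have ic0 := interp_const_ge0 al0.
set a := interp_const al / (t * t) in hi *.
have a0 : 0 <= a by apply: Rmult_le_pos => //; apply/Rlt_le/Rinv_0_lt_compat; nra.
have hmu : mu * h <= (1 - lam) * H al T e (n * X) + lam * H al T e (n' * X).
  have := Rmult_le_compat_l (1 - lam) _ _ ltac:(lra) hn.
  by have := Rmult_le_compat_l lam _ _ ltac:(lra) hn'; lra.
set b := 12 * C / v in err *.
have b0 : 0 <= b by apply/Rlt_le/Rdiv_lt_0_compat; lra.
have hfin : (mu - b) * h <= (1 + a) * ht by lra.
apply: (Rmult_le_reg_l (1 + a)); first by lra.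
apply: Rle_trans hfin.
have -> : (1 + a) * ((mu - a - b) * h) = (1 + a) * (mu - a - b) * h by ring.
by apply: Rmult_le_compat_r => //; nra.
Qed.

Lemma coprime_or_succ e m : (0 < e)%N -> (size (primes e) <= 1)%N -> (0 < m)%N ->
  coprime m e || coprime m.+1 e.
Proof.
move=> e0 se m0; apply/orP; case h1: (coprime m e); [by left | right].
move: h1; rewrite coprime_has_primes // => /negbFE/hasP[p pe pm].
rewrite coprime_has_primes //; apply/hasPn => q qe; apply/negP => qm.
have pq : q = p by case: (primes e) se pe qe => [//|x [|//]] _; rewrite !inE => /eqP-> /eqP->.
move: pm qm; rewrite pq !mem_primes => /and3P[pp _ pm] /and3P[_ _ ps].
have : (p %| 1)%N by rewrite -(dvdn_addr 1 pm) addn1.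
by rewrite Euclid_dvd1.
Qed.

(** Of two consecutive integers, one is prime to [e]. Having two candidates on each side of [t] is
    the reason why nodes at distance up to 2 are allowed. *)
Lemma near_coprime e t : (0 < e)%N -> (size (primes e) <= 1)%N -> 4 <= t ->
  exists n n', [/\ (0 < n)%N, coprime n e, coprime n' e & [/\ t - 2 <= INR n, INR n <= t,
    t < INR n' & INR n' <= t + 2]].
Proof.
move=> e0 se t4; have [m [m1 m2]] := @nat_floor t ltac:(lra).
have m3 : (2 < m)%N by apply/ltP/INR_lt; rewrite /=; lra.
case: m m1 m2 m3 => [//|m] m1 m2 m3; rewrite S_INR in m1 m2.
have [n [cn n0 nl]] : exists n, [/\ coprime n e, (0 < n)%N & INR m <= INR n <= INR m + 1].
  have m0 : (0 < m)%N by case: (m) m3.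
  case/orP: (coprime_or_succ e0 se m0) => h; [exists m | exists m.+1]; split=> //; first by lra.
  by rewrite S_INR; lra.
have [n' [cn' n'l]] : exists n', coprime n' e /\ INR m + 2 <= INR n' <= INR m + 3.
  have := @coprime_or_succ e m.+2 e0 se erefl.
  case/orP => h; [exists m.+2 | exists m.+3]; split=> //; rewrite !S_INR; lra.
by exists n, n'; split=> //; split; lra.
Qed.

(** One step loses at most [a^2 C^3 eps <= 9 C^3 eps], and the losses add up by Bernoulli's
    inequality. *)
Lemma H_iter_down al Lam B C v e a i X : regular al Lam B C v -> 3 <= Lam -> 9 * C ^ 3 * eps v <= 1 ->
  3 <= v -> (0 < e)%N -> (size (primes e) <= 1)%N -> prime a -> coprime a e -> (a <= 3)%N ->
  0 < X -> v / 2 <= ln X - INR i * ln (INR a) -> ln X <= 2 * v ->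
  (1 - INR i * (9 * C ^ 3 * eps v)) * H al (exp (B * ln v)) e X <=
  H al (exp (B * ln v)) e (X / INR a ^ i).
Proof.
move=> rg Lam3 small v3 e0 se pa ca a3 X0 lX1 lX2.
have [eps0 _ _ _] := reg_eps_bounds rg; have C1 := reg_C rg; have a3' := INR_le3 a3.
have a1 := INR_ge1 (prime_gt0 pa); have la := ln_prime_gt0 pa.
have C3 : 0 < C ^ 3 by apply: pow_lt; lra.
set K := 9 * C ^ 3 * eps v in small *; have K0 : 0 <= K by rewrite /K; nra.
set T := exp (B * ln v).
elim: i lX1 => [|i IH] lX1; first by rewrite /= Rdiv_1_r; lra.
have {}IH := IH ltac:(rewrite S_INR in lX1; lra).
have pi : 0 < INR a ^ i by apply: pow_lt; lra.
have XI : 0 < X / INR a ^ i by apply: Rdiv_lt_0_compat.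
have lXI : ln (X / INR a ^ i) = ln X - INR i * ln (INR a) by rewrite ln_div // ln_pow_nat //; lra.
rewrite S_INR in lX1.
have i0 : 0 <= INR i * ln (INR a) by apply: Rmult_le_pos; [exact: pos_INR | lra].
have := H_prime_le_sq rg Lam3 e0 se pa ca ltac:(lra) XI ltac:(lra) ltac:(lra).
have := @H_step_down al T e a (X / INR a ^ i) pa ca.
have -> : X / INR a ^ i / INR a = X / INR a ^ i.+1 by rewrite /= /Rdiv Rinv_mult; ring.
rewrite -/T => h1 h2.
set hi := H al T e (X / INR a ^ i) in IH h1 h2 *; have hi0 : 0 <= hi by exact: H_ge0.
have h3 : C ^ 3 * eps v * (INR a * INR a) * hi <= K * hi.
  apply: Rmult_le_compat_r => //; have -> : K = C ^ 3 * eps v * (3 * 3) by rewrite /K; ring.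
  by apply: Rmult_le_compat_l; nra.
have h0 := H_ge0 al T e X.
have iR := pos_INR i; have KK : 0 <= INR i * K by nra.
have h4 : (1 - K) * ((1 - INR i * K) * H al T e X) <= (1 - K) * hi by apply: Rmult_le_compat_l; lra.
have h5 : (1 - INR i.+1 * K) * H al T e X <= (1 - K) * ((1 - INR i * K) * H al T e X).
  rewrite -[X in _ <= X]Rmult_assoc; apply: Rmult_le_compat_r => //; rewrite S_INR; nra.
by lra.
Qed.

Lemma H_iter_up al Lam B C v e a i X : regular al Lam B C v -> 3 <= Lam -> 9 * C ^ 3 * eps v <= 1 ->
  3 <= v -> (0 < e)%N -> (size (primes e) <= 1)%N -> prime a -> coprime a e -> (a <= 3)%N ->
  0 < X -> v / 2 <= ln X -> ln X + INR i * ln (INR a) <= 2 * v ->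
  (1 - INR i * (9 * C ^ 3 * eps v)) * H al (exp (B * ln v)) e X <=
  H al (exp (B * ln v)) e (INR a ^ i * X).
Proof.
move=> rg Lam3 small v3 e0 se pa ca a3 X0 lX1 lX2.
have [eps0 _ _ _] := reg_eps_bounds rg; have C1 := reg_C rg; have a3' := INR_le3 a3.
have a1 := INR_ge1 (prime_gt0 pa); have la := ln_prime_gt0 pa.
have C3 : 0 < C ^ 3 by apply: pow_lt; lra.
set K := 9 * C ^ 3 * eps v in small *; have K0 : 0 <= K by rewrite /K; nra.
set T := exp (B * ln v).
elim: i lX2 => [|i IH] lX2; first by rewrite /= Rmult_1_l; lra.
have {}IH := IH ltac:(rewrite S_INR in lX2; lra).
have pi : 0 < INR a ^ i by apply: pow_lt; lra.
have XI : 0 < INR a ^ i * X by nra.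
have lXI : ln (INR a ^ i * X) = INR i * ln (INR a) + ln X by rewrite ln_mult // ln_pow_nat //; lra.
rewrite S_INR in lX2.
have i0 : 0 <= INR i * ln (INR a) by apply: Rmult_le_pos; [exact: pos_INR | lra].
have := H_prime_le_sq rg Lam3 e0 se pa ca ltac:(lra) XI ltac:(lra) ltac:(lra).
have := @H_step_up al T e a (INR a ^ i * X) pa ca.
have -> : INR a * (INR a ^ i * X) = INR a ^ i.+1 * X by rewrite /=; ring.
rewrite -/T => h1 h2.
set hi := H al T e (INR a ^ i * X) in IH h1 h2 *; have hi0 : 0 <= hi by exact: H_ge0.
have h3 : C ^ 3 * eps v * (INR a * INR a) * hi <= K * hi.
  apply: Rmult_le_compat_r => //; have -> : K = C ^ 3 * eps v * (3 * 3) by rewrite /K; ring.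
  by apply: Rmult_le_compat_l; nra.
have h0 := H_ge0 al T e X.
have iR := pos_INR i; have KK : 0 <= INR i * K by nra.
have h4 : (1 - K) * ((1 - INR i * K) * H al T e X) <= (1 - K) * hi by apply: Rmult_le_compat_l; lra.
have h5 : (1 - INR i.+1 * K) * H al T e X <= (1 - K) * ((1 - INR i * K) * H al T e X).
  rewrite -[X in _ <= X]Rmult_assoc; apply: Rmult_le_compat_r => //; rewrite S_INR; nra.
by lra.
Qed.

(** 124 = 54 + 16 + 54: the shift down, the integer dilation, the shift up. The other terms come
    from interpolation and from the cut-off. *)
Definition weak_const (al C : R) : R := 124 * C ^ 3 + interp_const al + 12 * C.

(* Scale down by a power of the auxiliary prime [a], dilate by a real number of size [eps^(-1/4)],
   and scale up by a power of [a] again. *)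
Lemma H_dilate_weak al Lam B C v e X t : regular al Lam B C v -> 0 < al -> 4 <= Lam -> 2 <= B ->
  256 * eps v <= 1 -> 9 * C ^ 3 * eps v <= 1 -> (0 < e)%N -> (size (primes e) <= 1)%N ->
  0 < X -> 6 / 10 * v <= ln X -> ln X <= 13 / 10 * v -> 1 <= t -> t <= v ->
  (1 - weak_const al C * sqrt (eps v)) * H al (exp (B * ln v)) e X <=
  H al (exp (B * ln v)) e (t * X).
Proof.
move=> rg al0 Lam4 B2 e256 e9 e0 se X0 lX1 lX2 t1 tv.
have [C1 B1 L1 v1 M1 Mv_ _ _ BL _ _ _ _ _ _] := rg.
have [eps0 eps1 iv hC] := reg_eps_bounds rg.
have l2 := ln2_bounds.
set T := exp (B * ln v); set L := ln v in L1 BL hC *.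
pose s := sqrt (eps v); have s0 : 0 < s by apply: sqrt_lt_R0.
have ss : s * s = eps v by apply: sqrt_def; lra.
have s16 : s <= / 16 by nra.
(* [P = eps^(-1/4)] balances the loss [eps P^2] of integer dilation against the interpolation error
   [P^-2]; both equal [s = sqrt eps]. *)
pose q := sqrt s; have q0 : 0 < q by apply: sqrt_lt_R0.
have qq : q * q = s by apply: sqrt_def; lra.
have q4 : q <= / 4 by nra.
pose P := / q; have P4 : 4 <= P.
  by rewrite -(Rinv_inv 4); apply: Rinv_le_contravar; lra.
have PP : P * P * s = 1 by rewrite -qq /P; field; lra.
have Pv : 64 * P <= v.
  have : P * P * (P * P) <= v.
    have -> : P * P * (P * P) = / eps v.
      by rewrite -ss -qq /P; field; lra.
    by rewrite -[X in _ <= X]Rinv_inv; apply: Rinv_le_contravar => //; apply: Rinv_0_lt_compat; lra.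
  have : 16 <= P * P by nra.
  by nra.
have v3 : 3 <= v by lra.
have [a [pa ca a3 _]] := aux_prime e0 se.
have a2 : 2 <= INR a by apply: (le_INR 2); apply/leP; exact: prime_gt1.
have a3' := INR_le3 a3.
have la : ln 2 <= ln (INR a) by apply: ln_le; lra.
have la2 : ln (INR a) <= 2.
  by have := exp_ineq1_le (ln (INR a)); rewrite exp_ln; lra.
have lP0 : 0 <= ln P by rewrite -ln_1; apply: ln_le; lra.
have lPL : ln P <= L by apply: ln_le; lra.
have lt0 : 0 <= ln t by rewrite -ln_1; apply: ln_le; lra.
have ltL : ln t <= L by apply: ln_le; lra.
have L40 : 40 * L <= v by nra.
(* After going down by [a^i >= P], the dilation still to be made is [t a^i >= P], even for [t] near
   1. Dividing out [a^j] leaves [u] in [[P, 3P]], since [a <= 3]. *)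
have [i [i1 i2]] := @ceil_div (ln P) (ln (INR a)) ltac:(lra) lP0.
have qj0 : 0 <= (ln t + INR i * ln (INR a) - ln P) / ln (INR a).
  by apply: Rmult_le_pos; [lra | apply/Rlt_le/Rinv_0_lt_compat; lra].
have [j [j1 j2]] := nat_floor qj0.
have j1' : INR j * ln (INR a) <= ln t + INR i * ln (INR a) - ln P.
  by rewrite Rmult_comm; apply/Rle_div_l'; [lra | ].
have j2' : ln t + INR i * ln (INR a) - ln P < (INR j + 1) * ln (INR a).
  have := Rmult_lt_compat_r (ln (INR a)) _ _ ltac:(lra) j2.
  by have -> : (ln t + INR i * ln (INR a) - ln P) / ln (INR a) * ln (INR a) =
       ln t + INR i * ln (INR a) - ln P by field; lra.
pose u := exp (ln t + INR i * ln (INR a) - INR j * ln (INR a)).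
have uP : P <= u by rewrite -{1}(exp_ln P); [apply: exp_le; lra | lra].
have uP3 : u <= 3 * P.
  apply: (Rle_trans _ (exp (ln P + ln (INR a)))); first by apply: exp_le; lra.
  by rewrite exp_plus !exp_ln; nra.
have pw k : INR a ^ k = exp (INR k * ln (INR a)) by exact: pow_exp_ln.
pose Y := X / INR a ^ i.
have Y0 : 0 < Y by apply: Rdiv_lt_0_compat => //; apply: pow_lt; lra.
have lY : ln Y = ln X - INR i * ln (INR a).
  by rewrite ln_div //; [rewrite pw ln_exp | rewrite pw; exact: exp_pos].
have tXE : t * X = INR a ^ j * (u * Y).
  rewrite /Y /u !pw -{1}(exp_ln t); last by lra.
  rewrite /Rdiv -exp_Ropp.
  have -> : exp (INR j * ln (INR a)) * (exp (ln t + INR i * ln (INR a) - INR j * ln (INR a)) *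
     (X * exp (- (INR i * ln (INR a))))) = exp (INR j * ln (INR a)) * exp (ln t + INR i * ln (INR a) - INR j * ln (INR a)) *
     exp (- (INR i * ln (INR a))) * X by ring.
  by rewrite -!exp_plus; congr (exp _ * _); ring.
have hd := @H_iter_down al Lam B C v e a i X rg ltac:(lra) e9 v3 e0 se pa ca a3 X0 ltac:(lra) ltac:(lra).
rewrite -/T -/Y in hd.
have [n [n' [n0 cn cn' [n1 n2 n3 n4]]]] := @near_coprime e u e0 se ltac:(lra).
have C3 : 0 < C ^ 3 by apply: pow_lt; lra.
have n'0 : (0 < n')%N by apply/ltP/INR_lt; rewrite /=; lra.
pose mu := 1 - 16 * C ^ 3 * s.
have hh := H_ge0 al T e Y.
have hmu m : (0 < m)%N -> coprime m e -> INR m <= u + 2 -> mu * H al T e Y <= H al T e (INR m * Y).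
  move=> m0 cm mu2; have m1 := INR_ge1 m0.
  have lm : ln (INR m) <= ln v by apply: ln_le; lra.
  have := @H_mul_ge al Lam B C v e m Y rg ltac:(lra) e0 se m0 cm ltac:(lra) Y0 ltac:(lra) ltac:(rewrite -/L in lm; lra).
  rewrite -/T; apply: Rle_trans; apply: Rmult_le_compat_r => //.
  rewrite /mu; suff : C ^ 3 * eps v * (INR m * INR m) <= 16 * C ^ 3 * s by lra.
  have -> : 16 * C ^ 3 * s = C ^ 3 * eps v * (4 * P * (4 * P)).
    by rewrite -ss; have -> : C ^ 3 * (s * s) * (4 * P * (4 * P)) = 16 * C ^ 3 * s * (P * P * s) by [ring]; rewrite PP; ring.
  apply: Rmult_le_compat_l; first by apply: Rmult_le_pos; lra.
  by apply: Rmult_le_compat; lra.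
have hu : (1 - (16 * C ^ 3 + interp_const al + 12 * C) * s) * H al T e Y <= H al T e (u * Y).
  case: (Rle_dec 0 mu) => mu0; last first.
    apply: (Rle_trans _ 0); last exact: H_ge0.
    rewrite -(Rmult_0_l (H al T e Y)); apply: Rmult_le_compat_r => //.
    rewrite /mu in mu0; have ic0 := interp_const_ge0 al0.
    have : 0 <= (interp_const al + 12 * C) * s by apply: Rmult_le_pos; lra.
    by lra.
  have mu1 : mu <= 1.
    by rewrite /mu; have := Rmult_lt_0_compat _ _ C3 s0; lra.
  have := @H_real_ge al Lam B C v e Y u (INR n) (INR n') mu rg al0 Lam4 B2 e0 se Y0 ltac:(lra) ltac:(lra)
    ltac:(lra) ltac:(lra) n1 n2 n3 n4 (conj mu0 mu1) (hmu n n0 cn ltac:(lra)) (hmu n' n'0 cn' n4).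
  rewrite -/T; apply: Rle_trans; apply: Rmult_le_compat_r => //.
  have h1 : interp_const al / (u * u) <= interp_const al * s.
    have ic0 := interp_const_ge0 al0.
    apply: Rmult_le_compat_l => //.
    have PP0 : 0 < P * P by apply: Rmult_lt_0_compat; lra.
    have -> : s = / (P * P) by apply: (Rmult_eq_reg_l (P * P)); [rewrite PP Rinv_r; lra | lra].
    by apply: Rinv_le_contravar => //; apply: Rmult_le_compat; lra.
  have h2 : 12 * C / v <= 12 * C * s.
    rewrite /Rdiv; apply: Rmult_le_compat_l; first by lra.
    apply: (Rle_trans _ _ _ iv); rewrite -ss -[X in _ <= X]Rmult_1_r.
    by apply: Rmult_le_compat_l; lra.
  by rewrite /mu; lra.
have uY0 : 0 < u * Y by apply: Rmult_lt_0_compat; lra.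
have luY : ln (u * Y) = ln u + ln Y by rewrite ln_mult //; lra.
have lu0 : 0 <= ln u by rewrite -ln_1; apply: ln_le; lra.
have luL : ln u <= L by apply: ln_le; lra.
have hup := @H_iter_up al Lam B C v e a j (u * Y) rg ltac:(lra) e9 v3 e0 se pa ca a3 uY0 ltac:(lra) ltac:(lra).
rewrite -/T -tXE in hup.
set K := 9 * C ^ 3 * eps v in e9 hd hup.
have K0 : 0 <= K by apply: Rmult_le_pos; lra.
have iR := pos_INR i; have jR := pos_INR j.
have half k : 0 <= k -> k * ln (INR a) <= L + 2 -> k <= 6 * L.
  move=> k0 hk; have : k * / 2 <= k * ln (INR a) by apply: Rmult_le_compat_l; lra.
  by lra.
have iL : INR i <= 6 * L by apply: half; lra.
have jL : INR j <= 6 * L by apply: half; lra.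
(* There are [O(ln v)] shifts, each losing a multiple of [eps = s^2]; this inequality turns their
   total into a multiple of [s]. *)
have Ls : L * s <= 1.
  have C6 : 1 <= C ^ 6 by apply: pow_R1_Rle.
  have LL : L * L <= L ^ 8.
    have -> : L ^ 8 = L * L * (L ^ 6) by ring.
    have L6 : 1 <= L ^ 6 by apply: pow_R1_Rle.
    have LL0 : 0 <= L * L by apply: Rmult_le_pos; lra.
    by have := Rmult_le_compat_l _ _ _ LL0 L6; lra.
  have LLe : L * L * eps v <= 1.
    apply: Rle_trans hC; apply: Rmult_le_compat_r; first by lra.
    apply: (Rle_trans _ _ _ LL); rewrite -[X in X <= _]Rmult_1_l.
    by apply: Rmult_le_compat_r; [apply: pow_le; lra | lra].
  have LsLs : L * s * (L * s) <= 1 by have -> : L * s * (L * s) = L * L * eps v by [rewrite -ss; ring].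
  have Ls0 : 0 <= L * s by apply: Rmult_le_pos; lra.
  clear -LsLs Ls0; nra.
have cost k : 0 <= k -> k <= 6 * L -> k * K <= 54 * C ^ 3 * s.
  move=> k0 kL; apply: (Rle_trans _ (6 * L * K)); first by apply: Rmult_le_compat_r.
  rewrite /K -ss; have -> : 6 * L * (9 * C ^ 3 * (s * s)) = 54 * C ^ 3 * s * (L * s) by ring.
  rewrite -[X in _ <= X]Rmult_1_r; apply: Rmult_le_compat_l => //.
  by apply: Rmult_le_pos; lra.
have ci := cost _ iR iL; have cj := cost _ jR jL.
set al1 := INR i * K in ci hd; set al2 := INR j * K in cj hup.
set al3 := (16 * C ^ 3 + interp_const al + 12 * C) * s in hu.
have ic0 := interp_const_ge0 al0.
have al10 : 0 <= al1 by apply: Rmult_le_pos.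
have al20 : 0 <= al2 by apply: Rmult_le_pos.
have al30 : 0 <= al3 by apply: Rmult_le_pos; lra.
have hX := H_ge0 al T e X; have htX := H_ge0 al T e (t * X); have huY := H_ge0 al T e (u * Y).
have tot : weak_const al C * sqrt (eps v) >= al1 + al2 + al3 by rewrite /weak_const -/s /al3; lra.
case: (Rle_dec (al1 + al2 + al3) 1) => big; last first.
  apply: (Rle_trans _ 0) => //; rewrite -(Rmult_0_l (H al T e X)).
  by apply: Rmult_le_compat_r; lra.
apply: (Rle_trans _ ((1 - (al1 + al2 + al3)) * H al T e X)).
  by apply: Rmult_le_compat_r; lra.
apply: Rle_trans hup.
apply: (Rle_trans _ ((1 - al2) * ((1 - al3) * ((1 - al1) * H al T e X)))).
  rewrite -[X in _ <= X]Rmult_assoc -[X in _ <= X]Rmult_assoc; apply: Rmult_le_compat_r => //.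
  have := Rmult_le_pos _ _ al10 al20; have := Rmult_le_pos _ _ al10 al30; have := Rmult_le_pos _ _ al20 al30.
  move=> q1 q2 q3.
  have h123 : (1 - al2 - al3) * (1 - al1) <= (1 - al2) * (1 - al3) * (1 - al1) by apply: Rmult_le_compat_r; lra.
  by lra.
apply: Rmult_le_compat_l; first by lra.
apply: Rle_trans hu; apply: Rmult_le_compat_l => //; lra.
Qed.

(** * Slow variation of [H] *)

(* [H (pX) - H X] equals the [p]-free part of [H (pX)] minus [1 - 1/(p+1)] times that of [H X];
   the weak dilation bound makes this nonnegative. *)
Lemma H_prime_mono al Lam B C v p X : regular al Lam B C v -> 0 < al -> 4 <= Lam -> 2 <= B ->
  256 * eps v <= 1 -> 9 * C ^ 3 * eps v <= 1 -> prime p -> INR p <= v ->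
  weak_const al C * sqrt (eps v) * (INR p + 1) <= 1 ->
  0 < X -> 6 / 10 * v <= ln X -> ln X <= 13 / 10 * v ->
  H al (exp (B * ln v)) 1 X <= H al (exp (B * ln v)) 1 (INR p * X).
Proof.
move=> rg al0 Lam4 B2 e256 e9 pp pv hp X0 lX1 lX2; set T := exp (B * ln v).
have p0 : (0 < 1 * p)%N by rewrite mul1n prime_gt0.
have sp : (size (primes (1 * p)) <= 1)%N by rewrite mul1n primes_prime.
have p1 := INR_ge1 (prime_gt0 pp).
have := H_dilate_weak rg al0 Lam4 B2 e256 e9 p0 sp X0 lX1 lX2 p1 pv.
rewrite -/T /H (ksum_split T (gk al) 1 X pp) (ksum_split T (gk al) 1 (INR p * X) pp).
rewrite ksum_dvd_shift ?coprimen1 //.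
have h0 := H_ge0 al T (1 * p) X; rewrite /H in h0.
set h := ksum T (gk al) (1 * p) X in h0 *; set h' := ksum T (gk al) (1 * p) (INR p * X).
set k := weak_const al C * sqrt (eps v) in hp * => hw.
have kp : k <= / (INR p + 1).
  by apply: (Rmult_le_reg_r (INR p + 1)); [lra | rewrite Rinv_l; lra].
have : (1 - / (INR p + 1)) * h <= (1 - k) * h by apply: Rmult_le_compat_r; lra.
rewrite /Rdiv; lra.
Qed.

Lemma H_mul_mono al Lam B C v n X : regular al Lam B C v -> 0 < al -> 4 <= Lam -> 2 <= B ->
  256 * eps v <= 1 -> 9 * C ^ 3 * eps v <= 1 -> (0 < n)%N -> INR n <= v ->
  weak_const al C * sqrt (eps v) * (INR n + 1) <= 1 ->
  0 < X -> 6 / 10 * v <= ln X -> ln X + ln (INR n) <= 13 / 10 * v ->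
  H al (exp (B * ln v)) 1 X <= H al (exp (B * ln v)) 1 (INR n * X).
Proof.
move=> rg al0 Lam4 B2 e256 e9.
have k0 : 0 <= weak_const al C * sqrt (eps v).
  have C1 := reg_C rg; have ic := interp_const_ge0 al0.
  apply: Rmult_le_pos; last exact: sqrt_pos.
  by rewrite /weak_const; have : 0 < C ^ 3 by [apply: pow_lt; lra]; lra.
elim/ltn_ind: n X => n IH X n0 nv hn X0 lX1 lX2.
have [n1|n1] := leqP n 1.
  have -> : n = 1%N by apply/eqP; rewrite eqn_leq n1.
  by rewrite /= Rmult_1_l; lra.
have pq := pdiv_prime n1; set q := pdiv n in pq.
have /dvdnP[m nE] : (q %| n)%N := pdiv_dvd n.
have m0 : (0 < m)%N by move: n0; rewrite nE muln_gt0 => /andP[].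
have q1 := INR_ge1 (prime_gt0 pq); have mR := INR_ge1 m0.
have qn : INR n = INR q * INR m by rewrite nE INR_mul Rmult_comm.
have mn : (m < n)%N by rewrite nE -{1}[m]muln1 ltn_pmul2l // prime_gt1.
have lnm : ln (INR n) = ln (INR q) + ln (INR m) by rewrite qn ln_mult; lra.
have lq0 := ln_prime_gt0 pq; have lm0 := ln_INR_ge0 m0.
have mle : INR m <= INR n by rewrite qn; nra.
have qle : INR q <= INR n by rewrite qn; nra.
have hk x : x <= INR n -> weak_const al C * sqrt (eps v) * (x + 1) <= 1.
  by move=> xn; apply: Rle_trans hn; apply: Rmult_le_compat_l => //; lra.
have hm := IH m mn X m0 ltac:(lra) (hk _ mle) X0 lX1 ltac:(lra).
have mX0 : 0 < INR m * X by apply: Rmult_lt_0_compat; lra.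
have lmX : ln (INR m * X) = ln (INR m) + ln X by rewrite ln_mult; lra.
have := H_prime_mono rg al0 Lam4 B2 e256 e9 pq ltac:(lra) (hk _ qle) mX0 ltac:(lra) ltac:(lra).
by have -> : INR n * X = INR q * (INR m * X) by [rewrite qn; ring]; lra.
Qed.

Lemma rsum_iota_recr (F : nat -> R) j :
  \rsum_(k <- iota 0 j.+1) F k = \rsum_(k <- iota 0 j) F k + F j.
Proof. by have := @rsum_nat_rec F 0 j (leq0n j); rewrite !subn0. Qed.

(** With [E = 2^al], the branch [u^al] sums to at most [E / (E - 1)] over dyadic points and the
    branch [1 / u] to at most 2. *)
Definition dyadic_const (al : R) : R := exp (al * ln 2) / (exp (al * ln 2) - 1) + 2.

Lemma dyadic_const_gt0 al : 0 < al -> 0 < dyadic_const al.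
Proof.
move=> al0; have l2 := ln2_bounds; have e0 := exp_pos (al * ln 2).
have : 1 < exp (al * ln 2) by rewrite -exp_0; apply: exp_increasing; nra.
move=> h; rewrite /dyadic_const; have : 0 < exp (al * ln 2) / (exp (al * ln 2) - 1); last by lra.
by apply: Rdiv_lt_0_compat; lra.
Qed.

(* Each side of the kernel is dominated by the increments of a bounded monotone function. *)
Lemma sum_gk_dyadic al c i : 0 < al -> 0 < c ->
  \rsum_(k <- iota 0 i) gk al (c * 2 ^ k) <= dyadic_const al.
Proof.
move=> al0 c0; have l2 := ln2_bounds.
have E1 : 1 < exp (al * ln 2) by rewrite -exp_0; apply: exp_increasing; nra.
set E := exp (al * ln 2) in E1 *.
pose x k := ln c + INR k * ln 2.
have xS k : x k.+1 = x k + ln 2 by rewrite /x S_INR; ring.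
pose Ph k := Rmin (exp (al * x k)) E; pose Ps k := Rmin (exp (- x k)) 1.
have term k : gk al (c * 2 ^ k) <= / (E - 1) * (Ph k.+1 - Ph k) + 2 * (Ps k - Ps k.+1).
  have -> : gk al (c * 2 ^ k) = exp (Rmin (al * x k) (- x k)).
    rewrite /gk; have -> : ln (c * 2 ^ k) = x k by rewrite ln_mult ?ln_pow_nat //; [lra | apply: pow_lt; lra].
    by [].
  have a1 : exp (al * x k.+1) = exp (al * x k) * E by rewrite xS -exp_plus; congr exp; ring.
  have a2 : exp (- x k.+1) = exp (- x k) * / 2.
    by rewrite xS Ropp_plus_distr exp_plus (exp_Ropp (ln 2)) exp_ln; lra.
  have e1 := exp_pos (al * x k); have e2 := exp_pos (- x k).
  have iE : 0 < / (E - 1) by apply: Rinv_0_lt_compat; lra.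
  have mPh : 0 <= Ph k.+1 - Ph k.
    rewrite /Ph a1; have : exp (al * x k) <= exp (al * x k) * E by nra.
    by move=> h; have := Rle_min_compat_r _ _ E h; lra.
  have mPs : 0 <= Ps k - Ps k.+1.
    rewrite /Ps a2; have : exp (- x k) * / 2 <= exp (- x k) by lra.
    by move=> h; have := Rle_min_compat_r _ _ 1 h; lra.
  case: (Rle_dec (x k) 0) => xk.
    have -> : Rmin (al * x k) (- x k) = al * x k by rewrite Rmin_left //; nra.
    have b1 : exp (al * x k) <= 1 by rewrite -exp_0; apply: exp_le; nra.
    have -> : Ph k.+1 = exp (al * x k) * E by rewrite /Ph a1 Rmin_left //; nra.
    have -> : Ph k = exp (al * x k) by rewrite /Ph Rmin_left //; lra.
    have -> : / (E - 1) * (exp (al * x k) * E - exp (al * x k)) = exp (al * x k) by field; lra.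
    by lra.
  have -> : Rmin (al * x k) (- x k) = - x k by rewrite Rmin_right //; nra.
  have b1 : exp (- x k) <= 1 by rewrite -exp_0; apply: exp_le; lra.
  have p1 : Ps k.+1 = exp (- x k) * / 2 by rewrite /Ps a2 Rmin_left //; lra.
  have p2 : Ps k = exp (- x k) by rewrite /Ps Rmin_left //; lra.
  have := Rmult_le_pos _ _ (Rlt_le _ _ iE) mPh; rewrite p1 p2; lra.
apply: (Rle_trans _ (\rsum_(k <- iota 0 i) (/ (E - 1) * (Ph k.+1 - Ph k) + 2 * (Ps k - Ps k.+1)))).
  by apply: rsum_le => k _ _; exact: term.
rewrite big_split /= !rsum_scal rsum_telescope.
rewrite (eq_bigr (fun k => -1 * (Ph k - Ph k.+1))); last by move=> k _; ring.
rewrite rsum_scal rsum_telescope.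
have iE : 0 < / (E - 1) by apply: Rinv_0_lt_compat; lra.
have h1 : Ph i <= E by exact: Rmin_r.
have h2 : 0 <= Ph 0%N by apply/Rlt_le/Rmin_glb_lt; [exact: exp_pos | lra].
have h3 : Ps 0%N <= 1 by exact: Rmin_r.
have h4 : 0 <= Ps i by apply/Rlt_le/Rmin_glb_lt; [exact: exp_pos | lra].
rewrite /dyadic_const -/E /Rdiv.
have : / (E - 1) * (-1 * (Ph 0%N - Ph i)) <= / (E - 1) * E by apply: Rmult_le_compat_l; lra.
lra.
Qed.

(** After exchanging the sums, each [d] meets the kernel at dyadic points, where the total is
    bounded whatever [i] is. Hence a whole run of halvings costs no more than one shell of [W].
    Below [X / T^2] all the arguments are at most [1 / T], since [2^k <= T], and the kernel is
    tiny. *)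
Lemma H_sum_dyadic al T e X i : 0 < al -> 1 <= T -> 0 < X -> 2 ^ i <= T ->
  \rsum_(k <- iota 0 i) H al T e (X / 2 ^ k) <=
  dyadic_const al * (W e (X * T) - W e (X / T / T)) + INR i * exp (- (al * ln T)) * W e X.
Proof.
move=> al0 T1 X0 iT; have dc := dyadic_const_gt0 al0.
have T0 : 0 < T by lra.
have iT1 : 0 < / T <= 1.
  by split; [exact: Rinv_0_lt_compat | rewrite -Rinv_1; apply: Rinv_le_contravar; lra].
have XTT : X / T / T <= X.
  rewrite /Rdiv Rmult_assoc -[X in _ <= X]Rmult_1_r; apply: Rmult_le_compat_l; nra.
have XT : X <= X * T by nra.
have pw k : 1 <= 2 ^ k by apply: pow_R1_Rle; lra.
apply: (Rle_trans _ (\rsum_(k <- iota 0 i) \rsum_(d <- upto (X * T) | coprime d e) (w d * gk al (INR d / X * 2 ^ k)))).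
  apply: rsum_le => k _ _; apply: rsum_le_incl; rewrite ?upto_uniq //; last first.
    by move=> d _ _; apply: Rmult_le_pos; [exact: w_ge0 | exact/Rlt_le/gk_gt0].
  have pk := pw k.
  move=> d /uptoP[d0 dX] cd; split=> //.
    apply/uptoP; split=> //; apply: (Rle_trans _ _ _ dX).
    apply: Rmult_le_compat_r; first by lra.
    by apply: (Rmult_le_reg_r (2 ^ k)); [lra | rewrite /Rdiv Rmult_assoc Rinv_l; nra].
  by apply: Req_le; congr (_ * gk _ _); field; lra.
rewrite exchange_big /= (bigID (fun d => Rleb (INR d) (X / T / T))) /= Rplus_comm.
rewrite (@W_shell e (X / T / T) (X * T)); last by lra.
have -> : forall x y, x + y - x = y by move=> x y; ring.
apply: Rplus_le_compat.
  rewrite -rsum_scal; apply: rsum_le => d /uptoP[d0 _] _.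
  rewrite rsum_scal Rmult_comm; apply: Rmult_le_compat_r; first exact: w_ge0.
  by apply: sum_gk_dyadic => //; apply: Rdiv_lt_0_compat => //; exact: INR_gt0.
rewrite WE -rsum_scal; apply: rsum_le_incl; rewrite ?upto_uniq //; last first.
  move=> d _ _; apply: Rmult_le_pos; last exact: w_ge0.
  by apply: Rmult_le_pos; [exact: pos_INR | exact/Rlt_le/exp_pos].
move=> d /uptoP[d0 _] /andP[cd /RlebP dle]; split=> //; first by apply/uptoP; split=> //; lra.
rewrite rsum_scal Rmult_comm; apply: Rmult_le_compat_r; first exact: w_ge0.
have -> : INR i = INR (count predT (iota 0 i)) by rewrite count_predT size_iota.
rewrite -rsum_const; apply: rsum_le => k; rewrite mem_iota add0n => /andP[_ ki] _.
have d1 := INR_gt0 d0.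
have kT : 2 ^ k <= T by apply: Rle_trans iT; apply: Rle_pow; [lra | apply/leP; exact: ltnW].
apply: gk_small => //.
  by apply: Rmult_lt_0_compat; [apply: Rdiv_lt_0_compat | have := pw k; lra].
have -> : / T = X / T / T / X * T by field; lra.
apply: Rmult_le_compat => //.
- by apply/Rlt_le/Rdiv_lt_0_compat.
- by have := pw k; lra.
- by apply: Rmult_le_compat_r => //; exact/Rlt_le/Rinv_0_lt_compat.
Qed.

(** The first factor bounds the summed losses in terms of [eps] times [W 2], and [2 C^2] converts
    [W 2] back into [H]. *)
Definition down_const (al C : R) : R := (7 * C * dyadic_const al + 1) * (2 * (C * C)).

(** Each halving loses at most the odd part of [H] at that scale. Estimated one at a time, these
    losses would give [i eps]; their sum over all scales is instead controlled by a single shell of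
    [W]. *)
Lemma H_down_pow2 al Lam B C v X i : regular al Lam B C v -> 0 < al -> 4 <= Lam ->
  2 <= al * B -> C * eps v <= 1 -> 2 <= v -> 2 ^ i <= exp (B * ln v) ->
  0 < X -> 7 / 10 * v <= ln X -> ln X <= 3 / 2 * v ->
  (1 - down_const al C * eps v) * H al (exp (B * ln v)) 1 X <= H al (exp (B * ln v)) 1 (X / 2 ^ i).
Proof.
move=> rg al0 Lam4 alB Ce v2 iT X0 lX1 lX2.
have [C1 B1 L1 v1 M1 Mv_ eM _ BL _ hg hp _ hlo _] := rg.
have [eps0 eps1 iv _] := reg_eps_bounds rg; have l2 := ln2_bounds.
set T := exp (B * ln v) in hg hlo iT *.
have lT : ln T = B * ln v by rewrite ln_exp.
have T0 : 0 < T by exact: exp_pos.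
have T1 : 1 <= T by rewrite /T -exp_0; apply: exp_le; nra.
have p2 : prime 2 by [].
have s2 : (size (primes (1 * 2)) <= 2)%N by [].
have tel j : H al T 1 X - \rsum_(k <- iota 0 j) H al T (1 * 2) (X / 2 ^ k) <= H al T 1 (X / 2 ^ j).
  elim: j => [|j IH]; first by rewrite big_nil /= Rdiv_1_r; lra.
  rewrite rsum_iota_recr.
  have := @H_step_down al T 1 2 (X / 2 ^ j) p2 erefl.
  have -> : X / 2 ^ j / INR 2 = X / 2 ^ j.+1.
    by rewrite (_ : INR 2 = 2) // /= /Rdiv Rinv_mult; ring.
  by lra.
have hs := @H_sum_dyadic al T (1 * 2) X i al0 T1 X0 iT.
have lTT : ln (X / T / T) = ln X - 2 * (B * ln v).
  by rewrite !ln_div ?lT //; [ring | apply: Rdiv_lt_0_compat].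
have XTT0 : 0 < X / T / T by apply: Rdiv_lt_0_compat => //; apply: Rdiv_lt_0_compat.
have XT0 : 0 < X / T by apply: Rdiv_lt_0_compat.
(* Three growth steps, from [X / T^2] up to [X T]; later [(1 + de)^3 <= 1 + 7 de] for [de <= 1]. *)
have g1 := hg (1 * 2)%N (X / T / T) erefl s2 XTT0 ltac:(rewrite lTT; lra) ltac:(rewrite lTT; nra).
have lXT : ln (X / T) = ln X - B * ln v by rewrite ln_div // lT.
have g2 := hg (1 * 2)%N (X / T) erefl s2 XT0 ltac:(rewrite lXT; lra) ltac:(rewrite lXT; nra).
have g3 := hg (1 * 2)%N X erefl s2 X0 ltac:(lra) ltac:(nra).
have E1 : T * (X / T / T) = X / T by field; lra.
have E2 : T * (X / T) = X by field; lra.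
rewrite E1 in g1; rewrite E2 in g2; rewrite [T * X]Rmult_comm in g3.
set w0 := W (1 * 2) (X / T / T) in g1 hs; set w1 := W (1 * 2) (X / T) in g1 g2.
set w2 := W (1 * 2) X in g2 g3 hs; set w3 := W (1 * 2) (X * T) in g3 hs.
have w00 : 0 <= w0 by exact: W_ge0.
have w20 : 0 <= w2 by exact: W_ge0.
have w02 : w0 <= w2.
  apply: W_mono; rewrite /Rdiv Rmult_assoc -[X in _ <= X]Rmult_1_r; apply: Rmult_le_compat_l; first lra.
  have : 0 < / T <= 1 by split; [exact: Rinv_0_lt_compat | rewrite -Rinv_1; apply: Rinv_le_contravar; lra].
  by nra.
set de := C * eps v in g1 g2 g3 Ce; have de0 : 0 <= de by rewrite /de; nra.
have w30 : w3 - w0 <= 7 * de * w2.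
  have a2 : w2 <= (1 + de) * ((1 + de) * w0) by apply: (Rle_trans _ _ _ g2); apply: Rmult_le_compat_l; lra.
  have a3 : w3 <= (1 + de) * ((1 + de) * ((1 + de) * w0)).
    by apply: (Rle_trans _ _ _ g3); apply: Rmult_le_compat_l; lra.
  have a4 : (1 + de) * ((1 + de) * (1 + de)) <= 1 + 7 * de by clear -de0 Ce; nra.
  have a5 := Rmult_le_compat_r _ _ _ w00 a4.
  have a6 : 7 * de * w0 <= 7 * de * w2 by apply: Rmult_le_compat_l; lra.
  by lra.
have dc := dyadic_const_gt0 al0.
(* Here [2 <= al B] makes [T^(- al) <= v^-2], which absorbs the [O(ln v)] halvings. *)
have small : INR i * exp (- (al * ln T)) <= eps v.
  have iL : INR i <= 2 * (B * ln v).
    have : INR i * ln 2 <= B * ln v.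
      by rewrite -lT -ln_pow_nat; [apply: ln_le => //; apply: pow_lt; lra | lra].
    have := pos_INR i; clear -l2; nra.
  have ev2 : exp (- (al * ln T)) <= / v * / v.
    rewrite lT; have -> : / v * / v = exp (- (2 * ln v)).
      rewrite exp_Ropp; have -> : 2 * ln v = ln v + ln v by ring.
      by rewrite exp_plus exp_ln ?Rinv_mult; lra.
    by apply: exp_le; clear -alB L1; nra.
  apply: (Rle_trans _ (2 * (B * ln v) * (/ v * / v))).
    by apply: Rmult_le_compat => //; [exact: pos_INR | exact/Rlt_le/exp_pos].
  apply: Rle_trans iv; rewrite -Rmult_assoc -[X in _ <= X]Rmult_1_l.
  apply: Rmult_le_compat_r; first by apply/Rlt_le/Rinv_0_lt_compat; lra.
  apply: (Rmult_le_reg_r v); first by lra.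
  by rewrite Rmult_assoc Rinv_l; lra.
have hq := hp 1%N 2%N X erefl p2 erefl s2 v2 X0 ltac:(lra) ltac:(nra).
have hl := hlo 1%N X erefl erefl X0 ltac:(lra) ltac:(nra).
have hX := H_ge0 al T 1 X; set h := H al T 1 X in hl hX *.
have w2h : w2 <= 2 * (C * C) * h.
  apply: (Rle_trans _ (C * (2 * ln 2) / Mv v * (C * Mv v * h))).
    apply: (Rle_trans _ _ _ hq); apply: Rmult_le_compat_l => //.
    apply: Rmult_le_pos; last by apply/Rlt_le/Rinv_0_lt_compat; lra.
    by apply: Rmult_le_pos; [lra | rewrite -[INR 2]/2; lra].
  have -> : C * (2 * ln 2) / Mv v * (C * Mv v * h) = 2 * (C * C) * h * ln 2 by field; lra.
  rewrite -[X in _ <= X]Rmult_1_r; apply: Rmult_le_compat_l; last by lra.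
  by apply: Rmult_le_pos => //; clear -C1; nra.
have tot : \rsum_(k <- iota 0 i) H al T (1 * 2) (X / 2 ^ k) <= down_const al C * eps v * h.
  apply: (Rle_trans _ _ _ hs).
  apply: (Rle_trans _ ((7 * C * dyadic_const al + 1) * eps v * w2)).
    have b1 := Rmult_le_compat_l _ _ _ (Rlt_le _ _ dc) w30.
    have b2 := Rmult_le_compat_r _ _ _ w20 small.
    by rewrite /de in b1; lra.
  have -> : down_const al C * eps v * h = (7 * C * dyadic_const al + 1) * eps v * (2 * (C * C) * h).
    by rewrite /down_const; ring.
  apply: Rmult_le_compat_l => //; apply: Rmult_le_pos; last by lra.
  by have : 0 <= C * dyadic_const al by [apply: Rmult_le_pos; lra]; lra.
by have := tel i; rewrite -/h; lra.
Qed.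

Lemma H_up_pow2 al Lam B C v X j : regular al Lam B C v -> 0 < al -> 4 <= Lam -> 2 <= B ->
  256 * eps v <= 1 -> 9 * C ^ 3 * eps v <= 1 -> 2 <= v ->
  weak_const al C * sqrt (eps v) * 3 <= 1 ->
  0 < X -> 6 / 10 * v <= ln X -> ln X + INR j * ln 2 <= 13 / 10 * v ->
  H al (exp (B * ln v)) 1 X <= H al (exp (B * ln v)) 1 (2 ^ j * X).
Proof.
move=> rg al0 Lam4 B2 e256 e9 v2 hw X0 lX1; have l2 := ln2_bounds.
elim: j => [|j IH] lX2; first by rewrite /= Rmult_1_l; lra.
rewrite S_INR in lX2; have j0 := pos_INR j.
apply: (Rle_trans _ _ _ (IH ltac:(lra))).
have -> : 2 ^ j.+1 * X = INR 2 * (2 ^ j * X) by rewrite (_ : INR 2 = 2) //=; ring.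
have pj : 0 < 2 ^ j by apply: pow_lt; lra.
have jX : 0 < 2 ^ j * X by apply: Rmult_lt_0_compat.
have ljX : ln (2 ^ j * X) = INR j * ln 2 + ln X by rewrite ln_mult ?ln_pow_nat //; lra.
have jl : 0 <= INR j * ln 2 by apply: Rmult_le_pos; lra.
apply: (H_prime_mono rg) => //; rewrite ?ljX; try lra.
by rewrite -[INR 2]/2; have -> : 2 + 1 = 3 by ring.
Qed.

Definition slow_const (al C : R) : R :=
  16 * (weak_const al C * weak_const al C) * interp_const al + 12 * C + down_const al C.

(** The same three moves as for the weak bound, now at cost [O(eps)]: the shift down by a power of 2
    is summed over scales, the integer dilations near [u] and the shift up lose nothing, and
    interpolation at size [eps^(-1/2)] costs [u^-2]. *)
Lemma H_dilate_ge al Lam B C v X t : regular al Lam B C v -> 0 < al -> 4 <= Lam -> 2 <= B ->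
  2 <= al * B -> 9 * C ^ 3 * eps v <= 1 ->
  256 * (weak_const al C * weak_const al C) * eps v <= 1 ->
  0 < X -> 8 / 10 * v <= ln X -> ln X <= 12 / 10 * v -> 1 <= t -> ln t <= v / 40 ->
  (1 - slow_const al C * eps v) * H al (exp (B * ln v)) 1 X <= H al (exp (B * ln v)) 1 (t * X).
Proof.
move=> rg al0 Lam4 B2 alB e9 ew X0 lX1 lX2 t1 lt.
have [C1 B1 L1 v1 M1 Mv_ eM _ BL _ _ _ _ _ _] := rg.
have [eps0 eps1 iv _] := reg_eps_bounds rg; have l2 := ln2_bounds.
have ic0 := interp_const_ge0 al0; have dc := dyadic_const_gt0 al0.
have C3 : 1 <= C ^ 3 by apply: pow_R1_Rle.
set k := weak_const al C in ew *; have k1 : 124 <= k by rewrite /k /weak_const; lra.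
set T := exp (B * ln v).
pose s := sqrt (eps v); have s0 : 0 < s by apply: sqrt_lt_R0.
have ss : s * s = eps v by apply: sqrt_def; lra.
have ks : 16 * (k * s) <= 1.
  have : 16 * (k * s) * (16 * (k * s)) <= 1.
    by have -> : 16 * (k * s) * (16 * (k * s)) = 256 * (k * k) * eps v by [rewrite -ss; ring].
  have : 0 <= 16 * (k * s) by apply: Rmult_le_pos; [lra | apply: Rmult_le_pos; lra].
  move: (16 * (k * s)) => x x0 xx; clear -x0 xx; nra.
have ks0 : 0 < k * s by apply: Rmult_lt_0_compat; lra.
have e256 : 256 * eps v <= 1.
  have kk : 1 <= k * k by clear -k1; nra.
  have := Rmult_le_compat_r _ _ _ (Rlt_le _ _ eps0) kk; lra.
have Ce : C * eps v <= 1.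
  have CC : C <= C ^ 3 by rewrite -{1}(pow_1 C); apply: Rle_pow; [lra | lia].
  have := Rmult_le_compat_r _ _ _ (Rlt_le _ _ eps0) CC; lra.
(* The nodes satisfy [n + 1 <= 2 P + 3 <= 4 P], so that [k s (n + 1) <= 1], which is the condition
   for lossless dilation by [n]. *)
pose P := / (k * s) / 4.
have P4 : 4 <= P.
  have : 16 <= / (k * s); last by rewrite /P; lra.
  by rewrite -(Rinv_inv 16); apply: Rinv_le_contravar; lra.
have kP : k * s * (4 * P) = 1 by rewrite /P; field; lra.
have sle : eps v <= k * s.
  have s1 : s <= 1 by clear -s0 ss eps1; nra.
  have -> : eps v = s * s by lra.
  by apply: Rmult_le_compat_r; lra.
have Pv : 4 * P <= v.
  have -> : 4 * P = / (k * s) by rewrite /P; field; lra.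
  apply: (Rle_trans _ (/ eps v)); first by apply: Rinv_le_contravar.
  by rewrite -[X in _ <= X]Rinv_inv; apply: Rinv_le_contravar => //; apply: Rinv_0_lt_compat; lra.
have v2 : 2 <= v by lra.
have lP0 : 0 <= ln P by rewrite -ln_1; apply: ln_le; lra.
have lPL : ln P <= ln v by apply: ln_le; lra.
have lt0 : 0 <= ln t by rewrite -ln_1; apply: ln_le; lra.
have L40 : 40 * ln v <= v.
  by apply: Rle_trans BL; apply: Rmult_le_compat_r; lra.
have [i [i1 i2]] := @ceil_div (ln P) (ln 2) ltac:(lra) lP0.
have qj0 : 0 <= (ln t + INR i * ln 2 - ln P) / ln 2.
  by apply: Rmult_le_pos; [lra | apply/Rlt_le/Rinv_0_lt_compat; lra].
have [j [j1 j2]] := nat_floor qj0.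
have j1' : INR j * ln 2 <= ln t + INR i * ln 2 - ln P.
  by rewrite Rmult_comm; apply/Rle_div_l'; [lra | ].
have j2' : ln t + INR i * ln 2 - ln P < (INR j + 1) * ln 2.
  have := Rmult_lt_compat_r (ln 2) _ _ ltac:(lra) j2.
  by have -> : (ln t + INR i * ln 2 - ln P) / ln 2 * ln 2 = ln t + INR i * ln 2 - ln P by field; lra.
pose u := exp (ln t + INR i * ln 2 - INR j * ln 2).
have uP : P <= u by rewrite -{1}(exp_ln P); [apply: exp_le; lra | lra].
have uP2 : u <= 2 * P.
  apply: (Rle_trans _ (exp (ln P + ln 2))); first by apply: exp_le; lra.
  by rewrite exp_plus !exp_ln; lra.
have pw n : 2 ^ n = exp (INR n * ln 2) by rewrite -Rpower_pow //; lra.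
pose Y := X / 2 ^ i.
have Y0 : 0 < Y by apply: Rdiv_lt_0_compat => //; apply: pow_lt; lra.
have lY : ln Y = ln X - INR i * ln 2.
  by rewrite ln_div //; [rewrite pw ln_exp | rewrite pw; exact: exp_pos].
have tXE : t * X = 2 ^ j * (u * Y).
  rewrite /Y /u !pw -{1}(exp_ln t); last by lra.
  rewrite /Rdiv -exp_Ropp.
  have -> : exp (INR j * ln 2) * (exp (ln t + INR i * ln 2 - INR j * ln 2) *
     (X * exp (- (INR i * ln 2)))) = exp (INR j * ln 2) * exp (ln t + INR i * ln 2 - INR j * ln 2) *
     exp (- (INR i * ln 2)) * X by ring.
  by rewrite -!exp_plus; congr (exp _ * _); ring.
have BL1 : ln v + 1 <= B * ln v.
  have : 2 * ln v <= B * ln v by apply: Rmult_le_compat_r; lra.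
  by lra.
have iT : 2 ^ i <= T by rewrite pw; apply: exp_le; lra.
have hd := H_down_pow2 rg al0 Lam4 alB Ce v2 iT X0 ltac:(lra) ltac:(lra).
rewrite -/T -/Y in hd.
have [n [n' [n0 _ _ [n1 n2 n3 n4]]]] := @near_coprime 1 u erefl erefl ltac:(lra).
have n'0 : (0 < n')%N by apply/ltP/INR_lt; rewrite /=; lra.
have hh := H_ge0 al T 1 Y.
have hmu m : (0 < m)%N -> INR m <= u + 2 -> 1 * H al T 1 Y <= H al T 1 (INR m * Y).
  move=> m0 mu2; have m1 := INR_ge1 m0.
  have lm : ln (INR m) <= ln v by apply: ln_le; lra.
  rewrite Rmult_1_l; apply: (H_mul_mono rg) => //; try lra.
  rewrite -/k -/s -kP; apply: Rmult_le_compat_l; lra.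
have hu := @H_real_ge al Lam B C v 1 Y u (INR n) (INR n') 1 rg al0 Lam4 B2 erefl erefl Y0 ltac:(lra) ltac:(lra)
    ltac:(lra) ltac:(lra) n1 n2 n3 n4 ltac:(lra) (hmu n n0 ltac:(lra)) (hmu n' n'0 n4).
rewrite -/T in hu.
have uY0 : 0 < u * Y by apply: Rmult_lt_0_compat; lra.
have luY : ln (u * Y) = ln u + ln Y by rewrite ln_mult //; lra.
have lu0 : 0 <= ln u by rewrite -ln_1; apply: ln_le; lra.
have luL : ln u <= ln v by apply: ln_le; lra.
have hup := @H_up_pow2 al Lam B C v (u * Y) j rg al0 Lam4 B2 e256 e9 v2 ltac:(rewrite -/k -/s; lra) uY0 ltac:(lra) ltac:(lra).
rewrite -/T -tXE in hup.
set b1 := interp_const al / (u * u) in hu.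
have b1le : b1 <= 16 * (k * k) * interp_const al * eps v.
  have -> : 16 * (k * k) * interp_const al * eps v = interp_const al * / (P * P).
    have -> : / (P * P) = 16 * (k * k) * (s * s) by rewrite /P; field; lra.
    by rewrite ss; ring.
  have PP0 : 0 < P * P by apply: Rmult_lt_0_compat; lra.
  apply: Rmult_le_compat_l => //; apply: Rinv_le_contravar => //.
  by apply: Rmult_le_compat; lra.
have b2le : 12 * C / v <= 12 * C * eps v by rewrite /Rdiv; apply: Rmult_le_compat_l; lra.
set d := down_const al C * eps v in hd.
have d0 : 0 <= d.
  apply: Rmult_le_pos; last by lra.
  rewrite /down_const; apply: Rmult_le_pos; last by clear -C1; nra.
  by have : 0 <= C * dyadic_const al by [apply: Rmult_le_pos; lra]; lra.
pose b := 16 * (k * k) * interp_const al * eps v + 12 * C * eps v.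
have b0 : 0 <= b.
  rewrite /b; have q1 : 0 <= k * k * interp_const al by apply: Rmult_le_pos => //; clear -k1; nra.
  have := Rmult_le_pos _ _ q1 (Rlt_le _ _ eps0).
  have := Rmult_le_pos C _ ltac:(lra) (Rlt_le _ _ eps0); lra.
have sE : slow_const al C * eps v = b + d by rewrite /slow_const /b /d -/k; ring.
have hX := H_ge0 al T 1 X; have htX := H_ge0 al T 1 (t * X).
rewrite sE; case: (Rle_dec b 1) => bb; last first.
  apply: (Rle_trans _ 0) => //; rewrite -(Rmult_0_l (H al T 1 X)).
  by apply: Rmult_le_compat_r; lra.
apply: Rle_trans hup; apply: (Rle_trans _ ((1 - b) * H al T 1 Y)); last first.
  by apply: Rle_trans hu; apply: Rmult_le_compat_r => //; rewrite /b; lra.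
apply: (Rle_trans _ ((1 - b) * ((1 - d) * H al T 1 X))); last by apply: Rmult_le_compat_l; lra.
rewrite -[X in _ <= X]Rmult_assoc; apply: Rmult_le_compat_r => //.
have := Rmult_le_pos _ _ b0 d0; lra.
Qed.

Lemma ev_eps c : ev (fun v => c * eps v <= 1).
Proof.
apply: (ev_mp ev_Mv); apply: (ev_mp (ev_M_ge (Rabs c) 1)); apply: ev_all => v.
rewrite pow_1 => h [l1 v1 M1 [_ _ eM _ _]].
apply: (Rmult_le_reg_r (Mv v)); first by lra.
rewrite Rmult_assoc eM Rmult_1_l; apply: Rle_trans h.
by apply: Rmult_le_compat_r; [lra | exact: Rle_abs].
Qed.

Lemma exists_pow2 t : 1 <= t -> exists j, t <= 2 ^ j <= 2 * t.
Proof.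
move=> t1; have l2 := ln2_bounds.
have lt0 : 0 <= ln t by rewrite -ln_1; apply: ln_le; lra.
have [j [j1 j2]] := @ceil_div (ln t) (ln 2) ltac:(lra) lt0; exists j.
have -> : 2 ^ j = exp (INR j * ln 2) by rewrite -Rpower_pow //; lra.
split; first by rewrite -{1}(exp_ln t); [apply: exp_le | lra].
have -> : 2 * t = exp (ln t + ln 2) by rewrite exp_plus !exp_ln; lra.
exact: exp_le.
Qed.

Lemma Rabs_bounds x a : Rabs x <= a -> - a <= x <= a.
Proof. by rewrite /Rabs; case: Rcase_abs => ?; lra. Qed.

Lemma two_sided h ht hj a b k : 0 <= h -> 0 <= ht -> 0 <= hj -> 0 <= a -> 0 <= b ->
  a + b <= k -> 8 * k <= 1 -> (1 - a) * h <= ht -> (1 - a) * ht <= hj -> (1 - b) * hj <= h ->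
  Rabs (ht - h) <= 2 * k * h.
Proof.
move=> h0 ht0 hj0 a0 b0 abk k8 h1 h2 h3.
have h4 : (1 - b) * ((1 - a) * ht) <= h by apply: Rle_trans h3; apply: Rmult_le_compat_l; lra.
have ab0 : 0 <= a * b * ht by apply: Rmult_le_pos => //; apply: Rmult_le_pos.
have h5 : ht - h <= k * ht by have := Rmult_le_compat_r _ _ _ ht0 abk; lra.
have ht2 : ht <= 2 * h by nra.
have h6 : k * ht <= k * (2 * h) by apply: Rmult_le_compat_l; lra.
have h7 : a * h <= k * h by apply: Rmult_le_compat_r; lra.
by apply: Rabs_le; lra.
Qed.

(** Only lower bounds under dilation are at hand. The upper bound for [H (tX)] comes from the cycle
    [X -> tX -> 2^j X -> X], whose last arrow is a shift down by a power of 2. *)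
Lemma H_slow al Lam A Bmin : 0 < al -> 4 <= Lam -> 0 <= A ->
  exists B C K, [/\ Bmin <= B, 0 < K & ev (fun v => regular al Lam B C v /\ forall X t,
    0 < X -> 9 / 10 * v <= ln X -> ln X <= 11 / 10 * v -> 0 < t -> Rabs (ln t) <= A * ln v ->
    Rabs (H al (exp (B * ln v)) 1 (t * X) - H al (exp (B * ln v)) 1 X) <=
    K * eps v * H al (exp (B * ln v)) 1 X)].
Proof.
move=> al0 Lam4 A0.
have ial := Rinv_0_lt_compat al al0.
(* [B >= A + 1] gives [2^j <= 2 t <= T] for the closing shift, and the summand [2 / al] gives
   [2 <= al B]. *)
have [B [C [BB HR]]] := @ev_regular al Lam (Rmax Bmin (A + 2 + 2 * / al)) al0 ltac:(lra).
have B1 : Bmin <= B by apply: Rle_trans BB; exact: Rmax_l.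
have B2 : A + 2 + 2 * / al <= B by apply: Rle_trans BB; exact: Rmax_r.
have alB : 2 <= al * B.
  have -> : 2 = al * (2 * / al) by field; lra.
  by apply: Rmult_le_compat_l; lra.
pose K0 := Rabs (slow_const al C) + Rabs (down_const al C) + 1.
have K00 : 1 <= K0 by rewrite /K0; have := Rabs_pos (slow_const al C); have := Rabs_pos (down_const al C); lra.
exists B, C, (4 * K0); split=> //; first by lra.
apply: (ev_mp HR); apply: (ev_mp (ev_eps (9 * C ^ 3))).
apply: (ev_mp (ev_eps (256 * (weak_const al C * weak_const al C)))).
apply: (ev_mp (ev_eps (8 * K0))); apply: (ev_mp (ev_ln_pow (200 * (A + 1)) 1)); apply: (ev_mp (ev_ln 1)).
apply: ev_all => v l1; rewrite pow_1 => vA eK ew e9 rg; split=> //.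
have v1 := reg_v rg; have [eps0 eps1 _ _] := reg_eps_bounds rg; have l2 := ln2_bounds.
set T := exp (B * ln v).
have Ce : C * eps v <= 1.
  have C1 := reg_C rg; have CC : C <= C ^ 3 by rewrite -{1}(pow_1 C); apply: Rle_pow; [lra | lia].
  have := Rmult_le_compat_r _ _ _ (Rlt_le _ _ eps0) CC.
  have : 0 <= C ^ 3 * eps v by apply: Rmult_le_pos; [apply: pow_le; lra | lra].
  by lra.
have v2 : 2 <= v by have := exp_ineq1_le (ln v); rewrite exp_ln; lra.
have Al : 0 <= A * ln v by apply: Rmult_le_pos; lra.
have main X t : 0 < X -> 85 / 100 * v <= ln X -> ln X <= 115 / 100 * v -> 1 <= t -> ln t <= A * ln v ->
    Rabs (H al T 1 (t * X) - H al T 1 X) <= 2 * K0 * eps v * H al T 1 X.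
  move=> X0 lX1 lX2 t1 lt.
  have lt0 : 0 <= ln t by rewrite -ln_1; apply: ln_le; lra.
  have tX0 : 0 < t * X by apply: Rmult_lt_0_compat; lra.
  have ltX : ln (t * X) = ln t + ln X by rewrite ln_mult; lra.
  have lo := H_dilate_ge rg al0 Lam4 ltac:(lra) alB e9 ew X0 ltac:(lra) ltac:(lra) t1 ltac:(lra).
  (* The next power of 2 is reached from [t] by a dilation [s] in [[1, 2]]. *)
  have [j [j1 j2]] := exists_pow2 t1.
  pose s := 2 ^ j / t.
  have s1 : 1 <= s by apply/Rle_div_l'; lra.
  have s2 : s <= 2 by apply: (Rmult_le_reg_r t); [lra | rewrite /s /Rdiv Rmult_assoc Rinv_l; lra].
  have ls : ln s <= ln 2 by apply: ln_le; lra.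
  have hi1 := H_dilate_ge rg al0 Lam4 ltac:(lra) alB e9 ew tX0 ltac:(lra) ltac:(lra) s1 ltac:(lra).
  have sE : s * (t * X) = 2 ^ j * X by rewrite /s; field; lra.
  rewrite sE in hi1.
  have j0 : 0 < 2 ^ j by lra.
  have jX0 : 0 < 2 ^ j * X by apply: Rmult_lt_0_compat.
  have lj : ln (2 ^ j) <= ln 2 + ln t by rewrite -ln_mult; [apply: ln_le | lra | lra].
  have lj0 : 0 <= ln (2 ^ j) by apply: (Rle_trans _ _ _ lt0); apply: ln_le; lra.
  have ljX : ln (2 ^ j * X) = ln (2 ^ j) + ln X by rewrite ln_mult.
  have BA : (A + 1) * ln v <= B * ln v by apply: Rmult_le_compat_r; lra.
  have jT : 2 ^ j <= T.
    by rewrite -(exp_ln (2 ^ j)) // /T; apply: exp_le; lra.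
  have hi2 := H_down_pow2 rg al0 Lam4 alB Ce v2 jT jX0 ltac:(lra) ltac:(lra).
  have jE : 2 ^ j * X / 2 ^ j = X by field; lra.
  rewrite jE -/T in hi2; rewrite -/T in hi1 lo.
  set h := H al T 1 X in lo hi2 *; set ht := H al T 1 (t * X) in lo hi1 *.
  set hj := H al T 1 (2 ^ j * X) in hi1 hi2.
  have h0 : 0 <= h by exact: H_ge0.
  have ht0 : 0 <= ht by exact: H_ge0.
  have hj0 : 0 <= hj by exact: H_ge0.
  have weaken x y z : (1 - x * eps v) * y <= z -> 0 <= y -> (1 - Rabs x * eps v) * y <= z.
    move=> hx y0; apply: Rle_trans hx; apply: Rmult_le_compat_r => //.
    by have := Rmult_le_compat_r _ _ _ (Rlt_le _ _ eps0) (Rle_abs x); lra.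
  have := @two_sided h ht hj (Rabs (slow_const al C) * eps v) (Rabs (down_const al C) * eps v) (K0 * eps v).
  have -> : 2 * (K0 * eps v) = 2 * K0 * eps v by ring.
  apply=> //; try exact: weaken.
  - by apply: Rmult_le_pos; [exact: Rabs_pos | lra].
  - by apply: Rmult_le_pos; [exact: Rabs_pos | lra].
  - by rewrite -Rmult_plus_distr_r; apply: Rmult_le_compat_r; [lra | rewrite /K0; lra].
  - by lra.
move=> X t X0 lX1 lX2 t0 /Rabs_bounds[lt1 lt2].
have h0 : 0 <= H al T 1 X by exact: H_ge0.
have k0 : 0 <= K0 * eps v by apply: Rmult_le_pos; lra.
case: (Rle_dec 1 t) => t1.
  apply: (Rle_trans _ _ _ (main X t X0 ltac:(lra) ltac:(lra) t1 lt2)).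
  by apply: Rmult_le_compat_r; lra.
(* For [t < 1], dilate [tX] by [1 / t]. The bound is then relative to [H (tX)], which is at most
   [2 H (X)]; this doubles the constant. *)
have it1 : 1 <= / t by rewrite -Rinv_1; apply: Rinv_le_contravar; lra.
have tX0 : 0 < t * X by apply: Rmult_lt_0_compat.
have ltX : ln (t * X) = ln t + ln X by rewrite ln_mult.
have lt0 : ln t <= 0 by rewrite -ln_1; apply: ln_le; lra.
have := main (t * X) (/ t) tX0 ltac:(lra) ltac:(lra) it1 ltac:(rewrite ln_Rinv; lra).
have -> : / t * (t * X) = X by field; lra.
have ht0 : 0 <= H al T 1 (t * X) by exact: H_ge0.
set h := H al T 1 X in h0 *; set ht := H al T 1 (t * X) in ht0 *.
have -> : 2 * K0 * eps v * ht = 2 * (K0 * eps v) * ht by ring.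
have -> : 4 * K0 * eps v * h = 4 * (K0 * eps v) * h by ring.
have k8 : 8 * (K0 * eps v) <= 1 by lra.
move: (K0 * eps v) k0 k8 => k k0 k8 /Rabs_bounds[a1 a2].
have ht2 : ht <= 2 * h by clear -k0 k8 a1 a2 h0 ht0; nra.
have := Rmult_le_compat_l (2 * k) _ _ ltac:(lra) ht2 => h3.
by apply: Rabs_le; lra.
Qed.

(** * Square-free integers coprime to a given integer *)

Lemma rad_gt0 m : (0 < rad m)%N.
Proof.
rewrite /sqfree_kernel big_seq_cond prodn_cond_gt0 // => p /andP[].
by rewrite mem_primes => /andP[/prime_gt0].
Qed.

Lemma logn_prod_primes p (s : seq nat) : uniq s -> all prime s ->
  logn p (\prod_(q <- s) q) = (p \in s).
Proof.
elim: s => [|q s IH]; first by rewrite big_nil logn1.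
rewrite cons_uniq /= => /andP[qs us] /andP[pq ps].
have s0 : (0 < \prod_(r <- s) r)%N.
  by rewrite big_seq_cond prodn_cond_gt0 // => r /andP[/(allP ps)/prime_gt0].
rewrite big_cons (lognM _ (prime_gt0 pq) s0) (logn_prime _ pq) IH // inE.
by case: eqP => // ->; rewrite (negPf qs).
Qed.

Lemma logn_rad p m : logn p (rad m) = (p \in primes m).
Proof. by rewrite logn_prod_primes ?primes_uniq ?all_prime_primes. Qed.

Lemma primes_rad m : primes (rad m) = primes m.
Proof. by apply/eq_primes => p; rewrite -!logn_gt0 logn_rad logn_gt0; case: (p \in primes m). Qed.

Definition sqf (l : nat) : bool := rad l == l.

Lemma sqfP l : (0 < l)%N -> reflect (forall p, (logn p l <= 1)%N) (sqf l).
Proof.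
move=> l0; apply: (iffP eqP) => [<- p|h]; first by rewrite logn_rad leq_b1.
apply: eqn_from_log; rewrite ?rad_gt0 // => p; rewrite logn_rad -logn_gt0.
by have := h p; case: (logn p l) => [|[|]].
Qed.

(** The exponent 1 at [p] expresses coprimality and the exponent 2 square-freeness, so one sieve
    handles both conditions. *)
Definition sieved (a : nat -> nat) (ps : seq nat) (l : nat) : bool :=
  all (fun p => ~~ (p ^ a p %| l)%N) ps.

(** A power of [L] is kept as the error because it is multiplicative and also valid for [L < 1],
    where the count is 0. The exponent lies below 1, and above 1/2 so that the sum of [p^(-3/2)]
    arising from squares converges. *)
Lemma card_upto L : 0 < L -> Rabs (\rsum_(l <- upto L) 1 - L) <= exp (3 / 4 * ln L).
Proof.
move=> L0; have [n [n1 n2]] := @nat_floor L ltac:(lra).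
have -> : \rsum_(l <- upto L) 1 = INR n.
  rewrite (perm_big (iota 1 n)) /=; last first.
    apply: uniq_perm; rewrite ?upto_uniq ?iota_uniq // => l.
    rewrite mem_iota add1n ltnS; apply/uptoP/andP => -[h1 h2]; split=> //.
      by rewrite -ltnS; apply/ltP/INR_lt; rewrite S_INR; lra.
    by apply: (Rle_trans _ (INR n)) => //; apply: le_INR; apply/leP.
  by rewrite rsum_const count_predT size_iota; lra.
case: (Rle_dec 1 L) => L1.
  have l0 : 0 <= ln L by rewrite -ln_1; apply: ln_le; lra.
  apply: (Rle_trans _ 1); first by apply: Rabs_le; lra.
  by rewrite -exp_0; apply: exp_le; lra.
have n0 : n = 0%N by case: n n1 n2 => // n; rewrite S_INR => n1 _; have := pos_INR n; lra.
rewrite n0 /=; have l0 : ln L <= 0 by rewrite -ln_1; apply: ln_le; lra.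
apply: (Rle_trans _ L); first by apply: Rabs_le; lra.
by rewrite -{1}(exp_ln L) //; apply: exp_le; lra.
Qed.

(** Sieve one prime at a time: the count at [L] minus the count at [L / p^(a p)]. As the error is a
    power of [L], a prime only multiplies it by [1 + p^(- 3 a / 4)]. *)
Lemma sieve_count a (ps : seq nat) L : uniq ps -> all prime ps -> 0 < L ->
  Rabs (\rsum_(l <- upto L | sieved a ps l) 1 - L * \rprod_(p <- ps) (1 - / INR p ^ a p)) <=
  exp (3 / 4 * ln L) * \rprod_(p <- ps) (1 + exp (- (3 / 4 * (INR (a p) * ln (INR p))))).
Proof.
elim: ps L => [|p ps IH] L.
  move=> _ _ L0; rewrite !big_nil !Rmult_1_r.
  by rewrite (eq_bigl predT) //; exact: card_upto.
rewrite cons_uniq /= => /andP[pps us] /andP[pp aps] L0.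
have p0 := INR_gt0 (prime_gt0 pp).
have pa0 : (0 < p ^ a p)%N by rewrite expn_gt0 prime_gt0.
have q0 : 0 < INR p ^ a p by apply: pow_lt.
have Lp : 0 < L / INR p ^ a p by apply: Rdiv_lt_0_compat.
have -> : \rsum_(l <- upto L | sieved a (p :: ps) l) 1 =
   \rsum_(l <- upto L | sieved a ps l) 1 - \rsum_(l <- upto (L / INR p ^ a p) | sieved a ps l) 1.
  have -> : \rsum_(l <- upto L | sieved a ps l) 1 =
     \rsum_(l <- upto L | (p ^ a p %| l)%N && sieved a ps l) 1 +
     \rsum_(l <- upto L | sieved a (p :: ps) l) 1.
    rewrite (bigID (fun l => p ^ a p %| l)%N) /=; congr (_ + _); apply: eq_bigl => l.
      by rewrite andbC.
    by rewrite /sieved /= andbC.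
  suff -> : \rsum_(l <- upto L | (p ^ a p %| l)%N && sieved a ps l) 1 =
     \rsum_(l <- upto (L / INR p ^ a p) | sieved a ps l) 1 by ring.
  rewrite (sum_multiples _ _ _ pa0) INR_exp; apply: eq_bigl => l; rewrite /sieved; apply: eq_in_all => q qps; rewrite Gauss_dvdr //.
  have pq := allP aps q qps.
  apply: coprimeXl; apply: coprimeXr; rewrite (prime_coprime _ pq) (dvdn_prime2 pq pp).
  by apply/eqP => qp; move: pps; rewrite -qp qps.
have h1 := IH L us aps L0; have h2 := IH _ us aps Lp.
rewrite !big_cons; set Pr := \rprod_(q <- ps) (1 - _) in h1 h2 *.
set Er := \rprod_(q <- ps) (1 + _) in h1 h2 *.
set A := \big[Rplus/0]_(l <- upto L | _) _ in h1 *; set A' := \big[Rplus/0]_(l <- upto _ | _) _ in h2 *.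
have -> : A - A' - L * ((1 - / INR p ^ a p) * Pr) = (A - L * Pr) - (A' - L / INR p ^ a p * Pr).
  by field; lra.
apply: (Rle_trans _ _ _ (Rabs_triang _ _)); rewrite Rabs_Ropp.
have e1 : exp (3 / 4 * ln (L / INR p ^ a p)) = exp (3 / 4 * ln L) * exp (- (3 / 4 * (INR (a p) * ln (INR p)))).
  by rewrite -exp_plus ln_div // ln_pow_nat //; congr exp; ring.
rewrite e1 in h2; lra.
Qed.

Definition primes_le (N : nat) : seq nat := [seq p <- iota 1 N | prime p].
(** A partial Euler product for [1 / zeta(2)]. It depends on [N], but one [N] serves both points
    being compared, so bounds between 1/2 and 1 suffice. *)
Definition sqf_density (N : nat) : R := \rprod_(p <- primes_le N) (1 - / INR p ^ 2).

Lemma mem_primes_le N p : (p \in primes_le N) = prime p && (p <= N)%N.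
Proof.
rewrite mem_filter mem_iota add1n ltnS; case pp: (prime p) => //=.
by rewrite prime_gt0.
Qed.

Lemma primes_le_uniq N : uniq (primes_le N).
Proof. by rewrite filter_uniq // iota_uniq. Qed.

Lemma primes_le_prime N : all prime (primes_le N).
Proof. exact: filter_all. Qed.

Lemma sqf_densityS N :
  sqf_density N.+1 = sqf_density N * (if prime N.+1 then 1 - / INR N.+1 ^ 2 else 1).
Proof.
rewrite /sqf_density /primes_le; have -> : iota 1 N.+1 = iota 1 N ++ [:: N.+1].
  by rewrite -[in iota 1 _](addn1 N) iotaD add1n.
by rewrite filter_cat big_cat [filter _ [:: _]]/=; case: ifP => _; rewrite ?big_seq1 ?big_nil.
Qed.

(** Extending the product to all integers from 2 to [n + 1] only decreases it, and that product
    telescopes to [(n + 2) / (2 (n + 1))]. *)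
Lemma sqf_density_ge N : / 2 <= sqf_density N.
Proof.
suff H n : (INR n + 2) / (2 * (INR n + 1)) <= sqf_density n.+1.
  case: N => [|N]; first by rewrite /sqf_density big_nil; lra.
  apply: Rle_trans (H N); have n0 := pos_INR N; apply: (Rmult_le_reg_r (2 * (INR N + 1))); first by lra.
  by rewrite /Rdiv Rmult_assoc Rinv_l; lra.
elim: n => [|n IH]; first by rewrite /sqf_density /primes_le /= big_nil; lra.
have n0 := pos_INR n.
have step : (INR n.+1 + 2) / (2 * (INR n.+1 + 1)) =
   (INR n + 2) / (2 * (INR n + 1)) * (1 - / INR n.+2 ^ 2).
  by rewrite !S_INR; field; lra.
have i01 : 0 <= / INR n.+2 ^ 2 <= 1.
  rewrite !S_INR; split; first by apply/Rlt_le/Rinv_0_lt_compat; apply: pow_lt; lra.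
  by rewrite -Rinv_1; apply: Rinv_le_contravar; [lra | rewrite /=; nra].
have lo : 0 <= (INR n + 2) / (2 * (INR n + 1)) by apply/Rlt_le/Rdiv_lt_0_compat; lra.
rewrite step sqf_densityS; case: ifP => _.
  by apply: Rmult_le_compat_r; lra.
rewrite Rmult_1_r; apply: Rle_trans IH; rewrite -[X in _ <= X]Rmult_1_r.
by apply: Rmult_le_compat_l; lra.
Qed.

Lemma rprod_le (I : eqType) (r : seq I) (F G : I -> R) :
  (forall i, i \in r -> 0 <= F i <= G i) ->
  0 <= \rprod_(i <- r) F i <= \rprod_(i <- r) G i.
Proof.
elim: r => [|i r IH] h; first by rewrite !big_nil; lra.
have := IH (fun j jr => h j (mem_behead (s := i :: r) jr)); have := h i (mem_head _ _).
rewrite !big_cons => h1 h2; split; first by apply: Rmult_le_pos; lra.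
by apply: Rmult_le_compat; lra.
Qed.

Lemma sqf_density_le1 N : sqf_density N <= 1.
Proof.
have := @rprod_le _ (primes_le N) (fun p => 1 - / INR p ^ 2) (fun _ => 1).
rewrite big1_eq => h; apply: (proj2 (h _)) => p; rewrite mem_primes_le => /andP[pp _].
have p1 := INR_ge1 (prime_gt0 pp); have : 0 < / INR p ^ 2 <= 1; last by lra.
split; first by apply: Rinv_0_lt_compat; apply: pow_lt; lra.
by rewrite -Rinv_1; apply: Rinv_le_contravar; [lra | rewrite /=; nra].
Qed.

Lemma rprod_exp_le (s : seq nat) (f : nat -> R) :
  (forall p, p \in s -> 0 <= f p) ->
  \rprod_(p <- s) (1 + f p) <= exp (\rsum_(p <- s) f p).
Proof.
elim: s => [|p s IH] h; first by rewrite !big_nil exp_0; lra.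
have h' q : q \in s -> 0 <= f q by move=> qs; apply: h; rewrite inE qs orbT.
rewrite !big_cons exp_plus; apply: Rmult_le_compat; last exact: IH.
- by have := h p (mem_head _ _); lra.
- apply: (proj1 (@rprod_le _ s (fun q => 1 + f q) (fun q => 1 + f q) _)) => q qs.
  by have := h' q qs; lra.
- exact: exp_ineq1_le.
Qed.

(** 33 = 1 + 32: the prime 2 adds at most 1, and for the others [p^(-3/2) <= 2 / (p ln p)], with sum
    at most [2 * 8 / ln 2 <= 32]. *)
Definition sieve_err : R := exp 33.

Lemma rprod_pow32_le N : \rprod_(p <- primes_le N) (1 + exp (- (3 / 2 * ln (INR p)))) <= sieve_err.
Proof.
apply: (Rle_trans _ _ _ (rprod_exp_le _)); first by move=> p _; exact/Rlt_le/exp_pos.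
apply: exp_le; have l2 := ln2_bounds.
rewrite (bigID (fun p => p == 2%N)) /=.
have h1 : \rsum_(p <- primes_le N | p == 2%N) exp (- (3 / 2 * ln (INR p))) <= 1.
  apply: (Rle_trans _ (\rsum_(p <- [:: 2%N]) 1)); last by rewrite big_seq1; lra.
  apply: rsum_le_incl; rewrite ?primes_le_uniq //; last by move=> *; lra.
  move=> p _ /eqP->; rewrite mem_head; split=> //; rewrite -exp_0; apply: exp_le.
  by rewrite -[INR 2]/2; lra.
have h2 : \rsum_(p <- primes_le N | p != 2%N) exp (- (3 / 2 * ln (INR p))) <= 32; last by lra.
apply: (Rle_trans _ (2 * \rsum_(p <- [seq p <- primes_le N | p != 2%N]) (/ (INR p * ln (INR p))))).
  rewrite -rsum_scal -big_filter; apply: rsum_le => p; rewrite mem_filter mem_primes_le.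
  move=> /andP[_ /andP[pp _]] _; have p0 := INR_gt0 (prime_gt0 pp); have lp := ln_prime_gt0 pp.
  have -> : - (3 / 2 * ln (INR p)) = - ln (INR p) + - (ln (INR p) / 2) by field.
  rewrite exp_plus exp_Ropp exp_ln // exp_Ropp.
  have -> : 2 * / (INR p * ln (INR p)) = / INR p * / (ln (INR p) / 2) by field; lra.
  apply: Rmult_le_compat_l; first exact/Rlt_le/Rinv_0_lt_compat.
  apply: Rinv_le_contravar; first by lra.
  by have := exp_ineq1_le (ln (INR p) / 2); lra.
have := @sum_inv_plogp_le 2 [seq p <- primes_le N | p != 2%N] (Rle_refl 2).
rewrite filter_uniq ?primes_le_uniq // => /(_ erefl) h.
have : \rsum_(p <- [seq p <- primes_le N | p != 2%N]) (/ (INR p * ln (INR p))) <= 8 / ln 2.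
  apply: h => p; rewrite mem_filter mem_primes_le => /andP[p2 /andP[pp _]]; split=> //.
  apply: (lt_INR 2); apply/ltP; have := prime_gt1 pp.
  by rewrite leq_eqVlt eq_sym (negPf p2).
have : 8 / ln 2 <= 16.
  by apply: (Rmult_le_reg_r (ln 2)); [lra | rewrite /Rdiv Rmult_assoc Rinv_l; lra].
lra.
Qed.

Definition Q (d : nat) (L : R) : R := \rsum_(l <- upto L | sqf l && coprime l d) 1.

Lemma rprod_dvd (N d : nat) (f : nat -> R) : (0 < d)%N -> (d <= N)%N ->
  \rprod_(p <- primes_le N) (if (p %| d)%N then f p else 1) = \rprod_(p <- primes d) f p.
Proof.
move=> d0 dN; rewrite -big_mkcond -big_filter; apply: perm_big; apply: uniq_perm.
- by rewrite filter_uniq // primes_le_uniq.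
- exact: primes_uniq.
move=> p; rewrite mem_filter mem_primes_le mem_primes d0 /=.
case pd: (p %| d)%N => /=; last by rewrite andbF.
by rewrite (leq_trans (dvdn_leq d0 pd) dN).
Qed.

Lemma INR_rad d : INR (rad d) = \rprod_(p <- primes d) INR p.
Proof.
rewrite /sqfree_kernel; elim: (primes d) => [|p s IH]; first by rewrite !big_nil.
by rewrite !big_cons INR_mul IH.
Qed.

Lemma rad_w d : INR (rad d) * w d = \rprod_(p <- primes d) (INR p / (INR p + 1)).
Proof. by rewrite INR_rad /w -big_split. Qed.

(** Sieve with exponent 1 at the primes of [d] and 2 elsewhere. A prime of [d] contributes
    [1 + p^(-3/4) <= 2 <= p] to the error, whence the factor [rad d]. With [L, d <= N] every
    relevant prime is among those sieved. *)
Lemma Q_approx d N L : (0 < d)%N -> (d <= N)%N -> 0 < L -> L <= INR N ->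
  Rabs (Q d L - sqf_density N * (INR (rad d) * w d) * L) <=
  sieve_err * INR (rad d) * exp (3 / 4 * ln L).
Proof.
move=> d0 dN L0 LN; pose a p := if (p %| d)%N then 1%N else 2%N.
have := @sieve_count a (primes_le N) L (primes_le_uniq N) (primes_le_prime N) L0.
have -> : \rsum_(l <- upto L | sieved a (primes_le N) l) 1 = Q d L.
  rewrite /Q big_seq_cond [RHS]big_seq_cond; apply: eq_bigl => l.
  case lL: (l \in upto L) => //=; have [l0 lL'] := elimT (uptoP _ _) lL.
  have lN : (l <= N)%N by apply/leP/INR_le; lra.
  apply/allP/andP.
    move=> h; split.
      apply/sqfP => // p; rewrite leqNgt; apply/negP => p2.
      have pl : p \in primes l by rewrite -logn_gt0; exact: ltnW.
      move: (pl); rewrite mem_primes => /and3P[pp _ pdl].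
      have := h p; rewrite mem_primes_le pp (leq_trans (dvdn_leq l0 pdl) lN) => /(_ erefl).
      rewrite pfactor_dvdn // /a; case: ifP => _; first by rewrite (ltnW p2).
      by rewrite p2.
    rewrite coprime_has_primes //; apply/hasPn => p; rewrite mem_primes => /and3P[pp _ pd].
    apply/negP; rewrite /= mem_primes => /and3P[_ _ pl].
    have := h p; rewrite mem_primes_le pp (leq_trans (dvdn_leq d0 pd) dN) => /(_ erefl).
    by rewrite /a pd expn1 pl.
  move=> [/(sqfP l0) sl cl] p; rewrite mem_primes_le => /andP[pp _].
  rewrite pfactor_dvdn // /a; case: ifP => pd; last by rewrite -ltnNge ltnS sl.
  rewrite -ltnNge ltnS leqn0 logn_coprime //.
  by apply: (coprime_dvdl pd); rewrite coprime_sym.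
have -> : \rprod_(p <- primes_le N) (1 - / INR p ^ a p) = sqf_density N * (INR (rad d) * w d).
  rewrite rad_w -(rprod_dvd _ d0 dN) /sqf_density -big_split /=.
  rewrite big_seq_cond [RHS]big_seq_cond; apply: eq_bigr => p; rewrite mem_primes_le andbT.
  move=> /andP[pp _]; have p0 := INR_gt0 (prime_gt0 pp); rewrite /a.
  by case: ifP => _ /=; field; lra.
rewrite [L * _]Rmult_comm => h; apply: (Rle_trans _ _ _ h).
rewrite Rmult_comm; apply: Rmult_le_compat_r; first exact/Rlt_le/exp_pos.
apply: (Rle_trans _ (\rprod_(p <- primes_le N) ((1 + exp (- (3 / 2 * ln (INR p)))) *
   (if (p %| d)%N then INR p else 1)))).
  apply: (proj2 (rprod_le _)) => p; rewrite mem_primes_le => /andP[pp _].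
  have lp := ln_prime_gt0 pp; have p2 : 2 <= INR p by apply: (le_INR 2); apply/leP; exact: prime_gt1.
  have e1 := exp_pos (- (3 / 2 * ln (INR p))).
  rewrite /a; case: ifP => _; split.
  - by have := exp_pos (- (3 / 4 * (INR 1 * ln (INR p)))); lra.
  - have : exp (- (3 / 4 * (INR 1 * ln (INR p)))) <= 1 by rewrite -exp_0; apply: exp_le => /=; lra.
    by nra.
  - by have := exp_pos (- (3 / 4 * (INR 2 * ln (INR p)))); lra.
  - have -> : 3 / 4 * (INR 2 * ln (INR p)) = 3 / 2 * ln (INR p) by rewrite -[INR 2]/2; field.
    by lra.
rewrite big_split /= rprod_dvd // -INR_rad.
by apply: Rmult_le_compat_r; [exact: pos_INR | exact: rprod_pow32_le].
Qed.

(** * The decomposition [m = d * rad d * l] *)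

(** A prime divides [dpart m] exactly when its square divides [m]; [lpart m] collects the primes of
    exponent one. *)
Definition dpart (m : nat) : nat := (m %/ rad m)%N.
Definition lpart (m : nat) : nat := (rad m %/ rad (dpart m))%N.

Lemma rad_dvd m : (0 < m)%N -> (rad m %| m)%N.
Proof.
move=> m0; apply: prod_primes_dvd; first exact: primes_uniq.
by move=> p; rewrite mem_primes => /and3P[-> _].
Qed.

Lemma dpartK m : (0 < m)%N -> m = (dpart m * rad m)%N.
Proof. by move=> m0; rewrite divnK // rad_dvd. Qed.

Lemma dpart_gt0 m : (0 < m)%N -> (0 < dpart m)%N.
Proof. by move=> m0; move: (m0); rewrite {1}(dpartK m0) muln_gt0 => /andP[]. Qed.

Lemma rad_dpart_dvd m : (0 < m)%N -> (rad (dpart m) %| rad m)%N.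
Proof.
move=> m0; apply: prod_primes_dvd; first exact: primes_uniq.
move=> p; rewrite mem_primes => /and3P[pp _ pd]; rewrite pp /=.
have : p \in primes (rad m).
  by rewrite primes_rad mem_primes pp m0 (dpartK m0) dvdn_mulr.
by rewrite mem_primes => /and3P[].
Qed.

Lemma lpartK m : (0 < m)%N -> rad m = (rad (dpart m) * lpart m)%N.
Proof. by move=> m0; rewrite mulnC divnK // rad_dpart_dvd. Qed.

Lemma lpart_gt0 m : (0 < m)%N -> (0 < lpart m)%N.
Proof. by move=> m0; have := rad_gt0 m; rewrite {1}(lpartK m0) muln_gt0 => /andP[]. Qed.

Lemma lpart_sqf m : (0 < m)%N -> sqf (lpart m).
Proof.
move=> m0; apply/(sqfP (lpart_gt0 m0)) => p.
have : (logn p (lpart m) <= logn p (rad m))%N.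
  by apply: dvdn_leq_log; [exact: rad_gt0 | rewrite (lpartK m0) dvdn_mull].
by move=> h; apply: (leq_trans h); rewrite logn_rad leq_b1.
Qed.

Lemma lpart_coprime m : (0 < m)%N -> coprime (lpart m) (dpart m).
Proof.
move=> m0; have l0 := lpart_gt0 m0; have d0 := dpart_gt0 m0.
rewrite coprime_has_primes //; apply/hasPn => p pd; apply/negP => pl.
have := logn_rad p m; rewrite (lpartK m0) (lognM _ (rad_gt0 _) l0) logn_rad pd.
by move: pl; rewrite /= -logn_gt0; case: (logn p (lpart m)) => // n _; case: (p \in primes m).
Qed.

Lemma rad_compose d l : (0 < d)%N -> (0 < l)%N -> sqf l -> coprime l d ->
  rad (d * (rad d * l)) = (rad d * l)%N.
Proof.
move=> d0 l0 sl cl; have r0 := rad_gt0 d.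
have rl0 : (0 < rad d * l)%N by rewrite muln_gt0 r0.
apply: eqn_from_log; rewrite ?rad_gt0 // => p.
rewrite logn_rad (lognM _ r0 l0) logn_rad (primesM _ d0 rl0) (primesM _ r0 l0) primes_rad orbA orbb.
have lp : logn p l = (p \in primes l).
  by rewrite -logn_rad; move: sl => /eqP->.
rewrite lp; case pd: (p \in primes d) => //=.
suff -> : p \in primes l = false by [].
by apply/negP => pl; move: cl; rewrite coprime_has_primes // => /hasPn/(_ p pd); rewrite /= pl.
Qed.

Lemma dpart_compose d l : (0 < d)%N -> (0 < l)%N -> sqf l -> coprime l d ->
  dpart (d * (rad d * l)) = d.
Proof.
move=> d0 l0 sl cl; rewrite /dpart rad_compose // mulnK // muln_gt0 rad_gt0 l0 //.
Qed.

Lemma w_rad d : w (rad d) = w d.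
Proof. by rewrite /w primes_rad. Qed.

Lemma w_decompose m : (0 < m)%N -> w m = w (dpart m) * w (lpart m).
Proof.
move=> m0; rewrite -w_rad (lpartK m0) w_coprime ?rad_gt0 ?lpart_gt0 // ?w_rad //.
have d0 := dpart_gt0 m0; rewrite coprime_sym; apply: coprime_dvdr (lpart_coprime m0).
exact: rad_dvd.
Qed.

Lemma w_le_inv_rad d : w d <= / INR (rad d).
Proof.
rewrite INR_rad /w.
have -> : / (\rprod_(p <- primes d) INR p) = \rprod_(p <- primes d) (/ INR p).
  elim: (primes d) => [|p s IH]; first by rewrite !big_nil Rinv_1.
  by rewrite !big_cons Rinv_mult IH.
apply: (proj2 (rprod_le _)) => p; rewrite mem_primes => /andP[pp _].
have p0 := INR_gt0 (prime_gt0 pp).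
by split; [apply/Rlt_le/Rinv_0_lt_compat | apply: Rinv_le_contravar]; lra.
Qed.

(** The largest admissible real value of [l]. With [k = rad d * l] and [m = d k], solving
    [k <= m^theta] for [k] gives the first entry of the minimum, and [m <= x] the second. *)
Definition kcut (theta x : R) (d : nat) : R :=
  exp (Rmin (theta / (1 - theta) * ln (INR d)) (ln x - ln (INR d))) / INR (rad d).

Lemma kernel_cond theta x d l : 0 < theta < 1 -> 0 < x -> (0 < d)%N -> (0 < l)%N ->
  sqf l -> coprime l d ->
  let m := (d * (rad d * l))%N in
  (INR m <= x /\ INR (rad m) <= Rpower (INR m) theta) <-> INR l <= kcut theta x d.
Proof.
move=> th x0 d0 l0 sl cl m; rewrite /m rad_compose //.
set k := (rad d * l)%N; have r0 := INR_gt0 (rad_gt0 d); have lR := INR_gt0 l0; have dR := INR_gt0 d0.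
have k0 : 0 < INR k by rewrite INR_mul; nra.
have E1 : INR (d * k) <= x <-> ln (INR k) <= ln x - ln (INR d).
  have -> : ln (INR k) = ln (INR (d * k)) - ln (INR d) by rewrite INR_mul ln_mult //; ring.
  have dk0 : 0 < INR (d * k) by rewrite INR_mul; nra.
  split => h; first by have := ln_le dk0 h; lra.
  by rewrite -(exp_ln x) // -(exp_ln (INR (d * k))) //; apply: exp_le; lra.
have E2 : INR k <= Rpower (INR (d * k)) theta <-> ln (INR k) <= theta / (1 - theta) * ln (INR d).
  have -> : Rpower (INR (d * k)) theta = exp (theta * (ln (INR d) + ln (INR k))).
    by rewrite /Rpower INR_mul ln_mult.
  have aux : ln (INR k) <= theta * (ln (INR d) + ln (INR k)) <->
     ln (INR k) <= theta / (1 - theta) * ln (INR d).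
    have -> : theta / (1 - theta) * ln (INR d) = theta * ln (INR d) / (1 - theta) by field; lra.
    by split => h; [apply/Rle_div_l'; lra | move/Rle_div_l': h => h; have := h ltac:(lra); lra].
  rewrite -aux; split => h.
    by have := ln_le k0 h; rewrite ln_exp.
  by rewrite -(exp_ln (INR k)) //; apply: exp_le; rewrite ln_exp in h *.
have E3 : INR l <= kcut theta x d <->
    ln (INR k) <= Rmin (theta / (1 - theta) * ln (INR d)) (ln x - ln (INR d)).
  rewrite /kcut; split => h.
    move/Rle_div_l': h => /(_ r0); rewrite -INR_mul => h.
    by have := ln_le k0 h; rewrite ln_exp.
  by apply/Rle_div_l' => //; rewrite -INR_mul -(exp_ln (INR k)) //; apply: exp_le.
rewrite E1 E2 E3; split => [[h1 h2]|h]; first exact: Rmin_glb.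
by split; apply: (Rle_trans _ _ _ h); [exact: Rmin_r | exact: Rmin_l].
Qed.

Lemma S_count_sum theta x : 0 < theta < 1 -> 0 < x ->
  INR (S_count theta x) = \rsum_(d <- upto x) Q d (kcut theta x d).
Proof.
move=> th x0; pose c m := Rleb (INR (rad m)) (Rpower (INR m) theta).
have -> : INR (S_count theta x) = \rsum_(m <- upto x | c m) 1.
  rewrite rsum_const Rmult_1_r; congr INR; rewrite /upto count_filter; apply: eq_count => m.
  by rewrite /= andbC.
have -> : \rsum_(m <- upto x | c m) 1 =
   \rsum_(m <- upto x | c m) \rsum_(d <- upto x) (if dpart m == d then 1 else 0).
  rewrite big_seq_cond [RHS]big_seq_cond; apply: eq_bigr => m /andP[/uptoP[m0 mx] _].
  rewrite (bigD1_seq (dpart m)) ?upto_uniq //=.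
    by rewrite eqxx big1 ?Rplus_0_r // => d; rewrite eq_sym => /negPf->.
  apply/uptoP; split; first exact: dpart_gt0.
  apply: Rle_trans mx; apply: le_INR; apply/leP; apply: dvdn_leq => //.
  by rewrite {2}(dpartK m0) dvdn_mulr.
rewrite exchange_big /=; rewrite big_seq_cond [RHS]big_seq_cond; apply: eq_bigr => d.
move=> /andP[/uptoP[d0 dx] _]; rewrite -big_mkcondr /Q.
rewrite -big_filter -[RHS]big_filter -[RHS](big_map (fun l => d * (rad d * l))%N predT (fun=> 1)).
apply: perm_big; apply: uniq_perm.
- by rewrite (filter_uniq _ (upto_uniq _)).
- rewrite map_inj_in_uniq ?(filter_uniq _ (upto_uniq _)) // => l l' _ _ /eqP.
  by rewrite eqn_pmul2l // eqn_pmul2l ?rad_gt0 // => /eqP.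
move=> m; rewrite [LHS]mem_filter; apply/andP/mapP.
- move=> [/andP[/RlebP cm /eqP dm] /uptoP[m0 mx]]; exists (lpart m); last first.
    by rewrite {1}(dpartK m0) {1}(lpartK m0) dm.
  have sl := lpart_sqf m0; have cl := lpart_coprime m0; rewrite dm in cl.
  rewrite mem_filter sl cl /=; apply/uptoP; split; first exact: lpart_gt0.
  apply/(kernel_cond th x0 d0 (lpart_gt0 m0) sl cl) => /=.
  by have -> : (d * (rad d * lpart m))%N = m by rewrite -dm -lpartK // -dpartK.
- move=> [l]; rewrite mem_filter => /andP[/andP[sl cl] /uptoP[l0 lL]] ->.
  have [h1 h2] := proj2 (kernel_cond th x0 d0 l0 sl cl) lL.
  rewrite dpart_compose // eqxx andbT; split; first exact/RlebP.
  by apply/uptoP; split=> //; rewrite !muln_gt0 d0 rad_gt0.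
Qed.

(** * Approximation of the counting function *)

(** The entries are at least [j + 1, j + 2, ...], and for these the product telescopes. For the
    primes of [d] this bounds the ratio of [1 / rad d] to [w d] by one plus the number of primes. *)
Lemma rprod_sorted_le j (s : seq nat) : path ltn j s ->
  \rprod_(p <- s) (1 + / INR p) <= 1 + INR (size s) / (INR j + 1).
Proof.
elim: s j => [|p s IH] j /=; first by rewrite big_nil /Rdiv; lra.
move=> /andP[jp ps]; rewrite big_cons; have := IH p ps; have j0 := pos_INR j.
have pj : INR j + 1 <= INR p by rewrite -S_INR; apply: le_INR; apply/leP.
rewrite [X in _ -> _ <= 1 + X / _]S_INR; set k := INR (size s); have k0 : 0 <= k by exact: pos_INR.
move=> h; have ip : 0 < / INR p by apply: Rinv_0_lt_compat; lra.
apply: (Rle_trans _ ((1 + / INR p) * (1 + k / (INR p + 1)))); first by apply: Rmult_le_compat_l; lra.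
have -> : (1 + / INR p) * (1 + k / (INR p + 1)) = 1 + (k + 1) * / INR p by field; lra.
apply: Rplus_le_compat_l; apply: Rmult_le_compat_l; first by lra.
by apply: Rinv_le_contravar; lra.
Qed.

Lemma size_primes_le d : (0 < d)%N -> INR (size (primes d)) <= 2 * ln (INR d).
Proof.
move=> d0; have l2 := ln2_bounds.
rewrite (ln_logn d0 (primes_uniq d) (fun p pin => pin)) -rsum_scal.
apply: (Rle_trans _ (\rsum_(p <- primes d) 1)).
  by rewrite rsum_const count_predT; lra.
apply: rsum_le => p pin _; have l1 : 1 <= INR (logn p d) by apply: INR_ge1; rewrite logn_gt0.
move: pin; rewrite mem_primes => /andP[pp _].
have p2 : 2 <= INR p by apply: (le_INR 2); apply/leP; exact: prime_gt1.
have : ln 2 <= ln (INR p) by apply: ln_le; lra.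
by nra.
Qed.

Lemma inv_rad_le d : (0 < d)%N -> / INR (rad d) <= (1 + 2 * ln (INR d)) * w d.
Proof.
move=> d0.
have -> : / INR (rad d) = (\rprod_(p <- primes d) (1 + / INR p)) * w d.
  rewrite INR_rad /w -big_split /=.
  have : all prime (primes d) by exact: all_prime_primes.
  elim: (primes d) => [|p s IH] /=; first by rewrite !big_nil Rinv_1.
  move=> /andP[pp ps]; have p0 := INR_gt0 (prime_gt0 pp).
  by rewrite !big_cons Rinv_mult IH //; congr (_ * _); field; lra.
apply: Rmult_le_compat_r; first exact: w_ge0.
have ps : path ltn 0%N (primes d).
  rewrite path_min_sorted ?sorted_primes //; apply/allP => p; rewrite mem_primes => /andP[pp _].
  exact: prime_gt0.
have := rprod_sorted_le ps; rewrite [INR 0]/= Rplus_0_l Rdiv_1_r.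
by have := size_primes_le d0; lra.
Qed.

Lemma w_ge_inv_rad_sq d : / (INR (rad d) * INR (rad d)) <= w d.
Proof.
rewrite INR_rad /w.
have : all prime (primes d) by exact: all_prime_primes.
elim: (primes d) => [|p s IH] /=; first by rewrite !big_nil Rmult_1_r Rinv_1; lra.
move=> /andP[pp ps]; have {}IH := IH ps; rewrite !big_cons.
have p2 : 2 <= INR p by apply: (le_INR 2); apply/leP; exact: prime_gt1.
set r := \big[Rmult/1]_(_ <- _) _ in IH *.
have r0 : 0 < r by apply: rprod_gt0 => q /(allP ps)/prime_gt0/INR_gt0.
have -> : / (INR p * r * (INR p * r)) = / (INR p * INR p) * / (r * r) by field; lra.
apply: Rmult_le_compat => //.
- by apply/Rlt_le/Rinv_0_lt_compat; nra.
- by apply/Rlt_le/Rinv_0_lt_compat; nra.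
- by apply: Rinv_le_contravar; nra.
Qed.

Lemma harmonic_le Y : 1 <= Y -> \rsum_(l <- upto Y) (/ INR l) <= 1 + ln Y.
Proof.
move=> Y1; have [n [n1 n2]] := @nat_floor Y ltac:(lra).
have n0 : (0 < n)%N by apply/ltP/INR_lt; rewrite /=; lra.
apply: (Rle_trans _ (1 + ln (INR n))); last first.
  by apply: Rplus_le_compat_l; apply: ln_le => //; exact: INR_gt0.
rewrite (perm_big (iota 1 n)) /=; last first.
  apply: uniq_perm; rewrite ?upto_uniq ?iota_uniq // => l.
  rewrite mem_iota add1n ltnS; apply/uptoP/andP => -[h1 h2]; split=> //.
    by rewrite -ltnS; apply/ltP/INR_lt; rewrite S_INR; lra.
  by apply: (Rle_trans _ (INR n)) => //; apply: le_INR; apply/leP.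
case: n n0 {n1 n2} => // n _; elim: n => [|n IH]; first by rewrite big_seq1 /= ln_1; lra.
have -> : iota 1 n.+2 = iota 1 n.+1 ++ [:: n.+2].
  by rewrite -[in iota 1 n.+2](addn1 n.+1) iotaD add1n.
rewrite big_cat big_seq1 /=; rewrite /= in IH.
have m0 : 0 < INR n.+1 by exact: INR_gt0.
have m0' : 0 < INR n.+2 by exact: INR_gt0.
have h : / INR n.+2 <= ln (INR n.+2) - ln (INR n.+1).
  rewrite -ln_div //.
  have -> : INR n.+2 / INR n.+1 = / (1 - / INR n.+2) by rewrite [INR n.+2]S_INR; field; lra.
  have i1 : / INR n.+2 < 1.
    by rewrite -Rinv_1; apply: Rinv_lt_contravar; rewrite ?S_INR; have := pos_INR n; lra.
  rewrite ln_Rinv; last by lra.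
  by have := exp_ineq1_le (ln (1 - / INR n.+2)); rewrite exp_ln; lra.
move: IH h; rewrite -[INR n.+2]/(match n.+1 with 0 => 1 | S _ => INR n.+1 + 1 end).
by rewrite /=; lra.
Qed.

(** A large radical forces a small [dpart], at most [Y / r], since their product is [m]. The weight
    splits along [dpart] and [lpart], and the latter contributes a harmonic sum. *)
Lemma sum_w_large_rad Y r : 1 <= Y -> 0 < r ->
  \rsum_(d <- upto Y | ~~ Rleb (INR (rad d)) r) w d <= W 1 (Y / r) * (1 + ln Y).
Proof.
move=> Y1 r0.
apply: (Rle_trans _ (\rsum_(x <- [seq (d, l) | d <- upto (Y / r), l <- upto Y]) (w x.1 * / INR x.2))).
  apply: (rsum_le_inj (phi := fun m => (dpart m, lpart m))).
  - exact: upto_uniq.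
  - by apply: pairs_uniq; rewrite ?upto_uniq.
  - move=> m /uptoP[m0 mY] /RlebP hr; split=> //=.
      apply/allpairsP; exists (dpart m, lpart m); split=> //=; apply/uptoP; split.
      + exact: dpart_gt0.
      + apply/Rle_div_l' => //; apply: Rle_trans mY.
        rewrite [X in _ <= X](_ : _ = INR (rad m) * INR (dpart m)); last first.
          by rewrite -INR_mul mulnC -dpartK.
        by apply: Rmult_le_compat_r; [exact: pos_INR | lra].
      + exact: lpart_gt0.
      + apply: Rle_trans mY; apply: le_INR; apply/leP; apply: dvdn_leq => //.
        by apply: dvdn_trans (rad_dvd m0); rewrite (lpartK m0) dvdn_mull.
    rewrite (w_decompose m0); apply: Rmult_le_compat_l; first exact: w_ge0.
    by have := w_le_inv_rad (lpart m); move: (lpart_sqf m0) => /eqP->.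
  - move=> m m' /uptoP[m0 _] /uptoP[m'0 _] _ _ [h1 h2].
    by rewrite (dpartK m0) (dpartK m'0) (lpartK m0) (lpartK m'0) h1 h2.
  - move=> [d l] /allpairsP[[a b] [_ /uptoP[b0 _] [_ ->]]] _ /=.
    by apply: Rmult_le_pos; [exact: w_ge0 | apply/Rlt_le/Rinv_0_lt_compat/INR_gt0].
rewrite (rsum_pairs _ _ (fun d l => w d * / INR l)).
rewrite (eq_bigr (fun d => (\rsum_(l <- upto Y) (/ INR l)) * w d)); last first.
  by move=> d _; rewrite rsum_scal Rmult_comm.
rewrite rsum_scal Rmult_comm.
have -> : \rsum_(d <- upto (Y / r)) w d = W 1 (Y / r).
  by rewrite WE; apply: eq_bigl => d; rewrite coprimen1.
by apply: Rmult_le_compat_l; [exact: W_ge0 | exact: harmonic_le].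
Qed.

(** From one [T]-adic shell to the next [W] at most doubles while [1 / d] falls by [T >= 4], so the
    first shell dominates. *)
Lemma far_sum T X x y n : 4 <= T -> 0 < X -> 0 < y -> x <= y * T ^ n ->
  (forall z, y <= z -> z < x -> W 1 (T * z) <= 2 * W 1 z) ->
  \rsum_(d <- upto x | ~~ Rleb (INR d) y) (w d * (X / INR d)) <= 4 * (X / y) * W 1 y.
Proof.
move=> T4 X0; elim: n y => [|n IH] y y0 xy Hg.
  rewrite big_seq_cond big1.
    by apply: Rmult_le_pos; [apply/Rlt_le/Rmult_lt_0_compat; [lra | exact: Rdiv_lt_0_compat] | exact: W_ge0].
  move=> d /andP[/uptoP[_ dx] /RlebP hd]; exfalso; apply: hd; move: xy; rewrite /=; lra.
case: (Rlt_dec y x) => yx; last first.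
  rewrite big_seq_cond big1.
    by apply: Rmult_le_pos; [apply/Rlt_le/Rmult_lt_0_compat; [lra | exact: Rdiv_lt_0_compat] | exact: W_ge0].
  by move=> d /andP[/uptoP[_ dx] /RlebP hd]; exfalso; apply: hd; lra.
have Ty0 : 0 < T * y by nra.
have yTy : y <= T * y by nra.
have h2 := Hg y (Rle_refl y) yx.
have W0 := W_ge0 1 y.
have Xy : 0 < X / y by exact: Rdiv_lt_0_compat.
have IH' := IH (T * y) Ty0 ltac:(move: xy; rewrite /=; lra) (fun z z1 z2 => Hg z ltac:(lra) z2).
rewrite (bigID (fun d => Rleb (INR d) (T * y))) /=.
have p1 : \rsum_(d <- upto x | ~~ Rleb (INR d) y && Rleb (INR d) (T * y)) (w d * (X / INR d)) <= 2 * (X / y) * W 1 y.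
  apply: (Rle_trans _ (X / y * W 1 (T * y))); last first.
    have -> : 2 * (X / y) * W 1 y = X / y * (2 * W 1 y) by ring.
    by apply: Rmult_le_compat_l; lra.
  rewrite WE -rsum_scal; apply: rsum_le_incl; rewrite ?upto_uniq //; last first.
    by move=> d _ _; apply: Rmult_le_pos; [lra | exact: w_ge0].
  move=> d /uptoP[d0 dx] /andP[/RlebP hd /RlebP hd']; split=> //.
  - exact/uptoP.
  - exact: coprimen1.
  rewrite Rmult_comm; apply: Rmult_le_compat_r; first exact: w_ge0.
  by apply: Rmult_le_compat_l; [lra | apply: Rinv_le_contravar; lra].
have p2 : \rsum_(d <- upto x | ~~ Rleb (INR d) y && ~~ Rleb (INR d) (T * y)) (w d * (X / INR d)) <= 2 * (X / y) * W 1 y.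
  apply: (Rle_trans _ (4 * (X / (T * y)) * W 1 (T * y))).
    apply: Rle_trans IH'; apply: rsum_sub_pred; first by move=> d _ /andP[].
    move=> d /uptoP[d0 _] _; apply: Rmult_le_pos; first exact: w_ge0.
    by apply/Rlt_le/Rdiv_lt_0_compat => //; exact: INR_gt0.
  have -> : 4 * (X / (T * y)) * W 1 (T * y) = 4 / T * (X / y) * W 1 (T * y) by field; lra.
  have t1 : 4 / T <= 1 by apply: (Rmult_le_reg_r T); [lra | rewrite /Rdiv Rmult_assoc Rinv_l; lra].
  apply: (Rle_trans _ (1 * (X / y) * W 1 (T * y))).
    by apply: Rmult_le_compat_r; [exact: W_ge0 | apply: Rmult_le_compat_r; lra].
  have -> : 2 * (X / y) * W 1 y = 1 * (X / y) * (2 * W 1 y) by ring.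
  by apply: Rmult_le_compat_l; lra.
lra.
Qed.

Lemma Q_bounds d L : 0 < L -> 0 <= Q d L <= L.
Proof.
move=> L0; split; first by apply: rsum_ge0 => *; lra.
apply: (Rle_trans _ (\rsum_(l <- upto L) 1)).
  by apply: rsum_sub_pred => // l _ _; lra.
have [n [n1 n2]] := @nat_floor L ltac:(lra).
have -> : \rsum_(l <- upto L) 1 = INR n; last by [].
rewrite (perm_big (iota 1 n)) /=; last first.
  apply: uniq_perm; rewrite ?upto_uniq ?iota_uniq // => l.
  rewrite mem_iota add1n ltnS; apply/uptoP/andP => -[h1 h2]; split=> //.
    by rewrite -ltnS; apply/ltP/INR_lt; rewrite S_INR; lra.
  by apply: (Rle_trans _ (INR n)) => //; apply: le_INR; apply/leP.
by rewrite rsum_const count_predT size_iota; lra.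
Qed.

Lemma kcut_gk theta x d : 0 < theta < 1 -> 0 < x -> (0 < d)%N ->
  kcut theta x d = exp (theta * ln x) *
    gk (theta / (1 - theta)) (INR d / exp ((1 - theta) * ln x)) / INR (rad d).
Proof.
move=> th x0 d0; rewrite /kcut /gk -exp_plus; congr (exp _ / _).
have d1 := INR_gt0 d0; rewrite ln_div //; last exact: exp_pos.
rewrite ln_exp; set a := theta / (1 - theta); set l := ln (INR d); set y := ln x.
have E1 : a * l = theta * y + a * (l - (1 - theta) * y) by rewrite /a; field; lra.
have E2 : y - l = theta * y + - (l - (1 - theta) * y) by ring.
rewrite {1}E1 E2 /Rmin; case: Rle_dec => h1; case: Rle_dec => h2 //; lra.
Qed.

(** The sieve error is [rad d * kcut^(3/4)], at most [(rad d)^(1/4) x^(3 theta / 4)]. To be below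
    [x^(7 theta / 8) (rad d)^-2], where [w d >= (rad d)^-2], it needs
    [(rad d)^(9/4) <= x^(theta / 8)]; this is the origin of 18. *)
Lemma term_small_rad theta x d N : 0 < theta < 1 -> 1 <= x -> (0 < d)%N -> INR d <= INR N -> x <= INR N ->
  18 * ln (INR (rad d)) <= theta * ln x ->
  Rabs (Q d (kcut theta x d) - sqf_density N * exp (theta * ln x) *
    (w d * gk (theta / (1 - theta)) (INR d / exp ((1 - theta) * ln x)))) <=
  sieve_err * exp (7 / 8 * (theta * ln x)) * w d.
Proof.
move=> th x1 d0 dN xN hr; have r0 := INR_gt0 (rad_gt0 d); have d1 := INR_ge1 d0.
have r1 := INR_ge1 (rad_gt0 d).
have L0 : 0 < kcut theta x d by apply: Rdiv_lt_0_compat => //; exact: exp_pos.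
have ld0 := ln_INR_ge0 d0.
have Lx : kcut theta x d <= x.
  apply: (Rle_trans _ (exp (ln x - ln (INR d)) / 1)).
    apply: Rmult_le_compat; try by apply/Rlt_le; [exact: exp_pos | exact: Rinv_0_lt_compat].
    - exact/Rlt_le/exp_pos.
    - exact/Rlt_le/Rinv_0_lt_compat.
    - by apply: exp_le; exact: Rmin_r.
    - by apply: Rinv_le_contravar; lra.
  by rewrite Rdiv_1_r -{2}(exp_ln x); [apply: exp_le; lra | lra].
have dN' : (d <= N)%N by apply/leP/INR_le.
have := @Q_approx d N (kcut theta x d) d0 dN' L0 ltac:(lra).
have := kcut_gk th (ltac:(lra) : 0 < x) d0; set g := gk _ _ => E.
have g0 : 0 < g by exact: gk_gt0.
have al0 : 0 < theta / (1 - theta) by apply: Rdiv_lt_0_compat; lra.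
have g1 : g <= 1 by exact: gk_le1.
have -> : sqf_density N * (INR (rad d) * w d) * kcut theta x d =
   sqf_density N * exp (theta * ln x) * (w d * g) by rewrite E; field; lra.
move=> h; apply: (Rle_trans _ _ _ h).
rewrite [X in X <= _]Rmult_assoc [X in _ <= X]Rmult_assoc.
apply: Rmult_le_compat_l; first exact/Rlt_le/exp_pos.
set lr := ln (INR (rad d)) in hr; have lr0 : 0 <= lr by apply: ln_INR_ge0; exact: rad_gt0.
have lL : ln (kcut theta x d) <= theta * ln x - lr.
  rewrite E ln_div //; last by apply: Rmult_lt_0_compat => //; exact: exp_pos.
  rewrite ln_mult //; last exact: exp_pos.
  have lg : ln g <= 0 by rewrite -ln_1; apply: ln_le.
  by rewrite (ln_exp (theta * ln x)) -/lr; lra.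
apply: (Rle_trans _ (exp (7 / 8 * (theta * ln x)) * / (INR (rad d) * INR (rad d)))); last first.
  by apply: Rmult_le_compat_l; [exact/Rlt_le/exp_pos | exact: w_ge_inv_rad_sq].
have -> : INR (rad d) = exp lr by rewrite exp_ln.
rewrite -!exp_plus -exp_Ropp -exp_plus; apply: exp_le; lra.
Qed.

Lemma term_trivial theta x d : 0 < theta < 1 -> 0 < x -> (0 < d)%N ->
  let g := gk (theta / (1 - theta)) (INR d / exp ((1 - theta) * ln x)) in
  0 <= Q d (kcut theta x d) <= exp (theta * ln x) * g * ((1 + 2 * ln (INR d)) * w d).
Proof.
move=> th x0 d0 g; have r0 := INR_gt0 (rad_gt0 d).
have L0 : 0 < kcut theta x d by apply: Rdiv_lt_0_compat => //; exact: exp_pos.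
have [q1 q2] := Q_bounds d L0; split=> //; apply: (Rle_trans _ _ _ q2).
rewrite kcut_gk // -/g; apply: Rmult_le_compat_l; last exact: inv_rad_le.
by apply: Rmult_le_pos; [exact/Rlt_le/exp_pos | exact/Rlt_le/gk_gt0].
Qed.

Lemma rsum_abs (I : eqType) (r : seq I) (P : pred I) (F : I -> R) :
  Rabs (\rsum_(i <- r | P i) F i) <= \rsum_(i <- r | P i) Rabs (F i).
Proof.
elim: r => [|i r IH]; first by rewrite !big_nil Rabs_R0; lra.
rewrite !big_cons; case: (P i) => //.
by apply: (Rle_trans _ _ _ (Rabs_triang _ _)); lra.
Qed.

(** The three errors: the sieve for [d] with radical at most [x^(theta / 18)], the trivial bound for
    larger radicals, which are rare, and the range [d > X T], where the kernel [X / d] is small. *)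
Lemma S_count_approx theta x T N : 0 < theta < 1 -> 1 <= x -> 4 <= T -> x <= INR N ->
  let X := exp ((1 - theta) * ln x) in
  X * T <= x ->
  (forall z, X * T <= z -> z < x -> W 1 (T * z) <= 2 * W 1 z) ->
  Rabs (INR (S_count theta x) -
    sqf_density N * exp (theta * ln x) * H (theta / (1 - theta)) T 1 X) <=
  exp (theta * ln x) * (
    sieve_err * exp (- (theta * ln x / 8)) * W 1 (X * T) +
    (1 + 2 * ln (X * T)) * (1 + ln (X * T)) * W 1 (X * T / exp (theta * ln x / 18)) +
    (1 + 2 * ln x) * (4 / T) * W 1 (X * T)).
Proof.
move=> th x1 T4 xN X XTx Hg; have x0 : 0 < x by lra.
have X0 : 0 < X by exact: exp_pos.
have lx0 : 0 <= ln x by rewrite -ln_1; apply: ln_le; lra.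
have X1 : 1 <= X by rewrite -exp_0; apply: exp_le; apply: Rmult_le_pos; lra.
have XT1 : 1 <= X * T by nra.
have XT0 : 0 < X * T by lra.
have lXT0 : 0 <= ln (X * T) by rewrite -ln_1; apply: ln_le; lra.
set al := theta / (1 - theta); have al0 : 0 < al by apply: Rdiv_lt_0_compat; lra.
set Xt := exp (theta * ln x); have Xt0 : 0 < Xt by exact: exp_pos.
set c := sqf_density N; have c1 : c <= 1 by exact: sqf_density_le1.
have c0 : / 2 <= c by exact: sqf_density_ge.
pose q d := Q d (kcut theta x d); pose m d := c * Xt * (w d * gk al (INR d / X)).
have -> : c * Xt * H al T 1 X = \rsum_(d <- upto (X * T)) m d.
  rewrite /m rsum_scal; congr (_ * _); rewrite /H /ksum; apply: eq_bigl => d; exact: coprimen1.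
rewrite (S_count_sum th x0) (bigID (fun d => Rleb (INR d) (X * T))) /=.
have -> : \rsum_(d <- upto x | Rleb (INR d) (X * T)) Q d (kcut theta x d) = \rsum_(d <- upto (X * T)) q d.
  rewrite -[LHS]big_filter; apply: perm_big; apply: uniq_perm.
  - by rewrite (filter_uniq _ (upto_uniq _)).
  - exact: upto_uniq.
  move=> d; rewrite [LHS]mem_filter !mem_upto; case: (RlebP (INR d) (X * T)) => h; rewrite ?andbF //.
  by case: (RlebP (INR d) x) => h' //; exfalso; lra.
set far := \rsum_(d <- upto x | _) _.
have far0 : 0 <= far.
  by apply: rsum_ge0 => d /uptoP[d0 _] _; have [] := term_trivial th x0 d0.
have farle : far <= Xt * ((1 + 2 * ln x) * (4 / T) * W 1 (X * T)).
  apply: (Rle_trans _ (\rsum_(d <- upto x | ~~ Rleb (INR d) (X * T)) (Xt * (1 + 2 * ln x) * (w d * (X / INR d))))).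
    apply: rsum_le => d /uptoP[d0 dx] _; have [_ h] := term_trivial th x0 d0.
    apply: (Rle_trans _ _ _ h); rewrite -/X -/Xt -/al; have d1 := INR_gt0 d0.
    have ld : ln (INR d) <= ln x by apply: ln_le.
    have ld0 := ln_INR_ge0 d0; have wd := w_ge0 d.
    have hg : gk al (INR d / X) <= X / INR d.
      apply: (Rle_trans _ _ _ (gk_le_inv al (Rdiv_lt_0_compat _ _ d1 X0))).
      by apply: Req_le; field; lra.
    have -> : Xt * (1 + 2 * ln x) * (w d * (X / INR d)) = Xt * (X / INR d) * ((1 + 2 * ln x) * w d) by ring.
    have g0 := gk_gt0 al (INR d / X).
    apply: Rmult_le_compat.
    - by apply: Rmult_le_pos; lra.
    - by apply: Rmult_le_pos; lra.
    - by apply: Rmult_le_compat_l; lra.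
    - by apply: Rmult_le_compat_r; lra.
  rewrite rsum_scal Rmult_assoc; apply: Rmult_le_compat_l; first by lra.
  rewrite Rmult_assoc; apply: Rmult_le_compat_l; first by lra.
  have [n hn] : exists n, x <= X * T * T ^ n.
    have [n hn] := exists_pow2_ge x; exists n.
    have Tn : 2 ^ n <= T ^ n by apply: pow_incr; lra.
    have : 0 < 2 ^ n by apply: pow_lt; lra.
    by nra.
  have := far_sum T4 X0 XT0 hn Hg.
  by have -> : 4 * (X / (X * T)) = 4 / T by field; lra.
set near := \rsum_(d <- upto (X * T)) q d; set mm := \rsum_(d <- upto (X * T)) m d.
set r := exp (theta * ln x / 18).
have nearle : Rabs (near - mm) <= Xt * (sieve_err * exp (- (theta * ln x / 8)) * W 1 (X * T) +
    (1 + 2 * ln (X * T)) * (1 + ln (X * T)) * W 1 (X * T / r)).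
  have -> : near - mm = \rsum_(d <- upto (X * T)) (q d - m d).
    rewrite (eq_bigr (fun d => q d + -1 * m d)); last by move=> d _; ring.
    by rewrite big_split rsum_scal /= -/near -/mm; ring.
  apply: (Rle_trans _ _ _ (rsum_abs _ _ _)).
  rewrite (bigID (fun d => Rleb (INR (rad d)) r)) /= Rmult_plus_distr_l; apply: Rplus_le_compat.
    apply: (Rle_trans _ (\rsum_(d <- upto (X * T)) (sieve_err * exp (7 / 8 * (theta * ln x)) * w d))).
      apply: rsum_le_incl; rewrite ?upto_uniq //.
        move=> d dX /RlebP hr; split=> //; last first.
          have [d0 dX'] := elimT (uptoP _ _) dX.
          apply: term_small_rad => //; first by lra.
          have : ln (INR (rad d)) <= theta * ln x / 18.
            by rewrite -[X in _ <= X]ln_exp; apply: ln_le => //; exact: INR_gt0 (rad_gt0 d).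
          by lra.
      move=> d _ _; apply: Rmult_le_pos; last exact: w_ge0.
      by apply: Rmult_le_pos; exact/Rlt_le/exp_pos.
    rewrite rsum_scal WE; apply: Req_le.
    have -> : \rsum_(d <- upto (X * T)) w d = \rsum_(d <- upto (X * T) | coprime d 1) w d.
      by apply: eq_bigl => d; rewrite coprimen1.
    have -> : exp (7 / 8 * (theta * ln x)) = Xt * exp (- (theta * ln x / 8)).
      by rewrite /Xt -exp_plus; congr exp; field.
    by ring.
  apply: (Rle_trans _ (\rsum_(d <- upto (X * T) | ~~ Rleb (INR (rad d)) r) (Xt * (1 + 2 * ln (X * T)) * w d))).
    apply: rsum_le => d /uptoP[d0 dX] _; have [h1 h2] := term_trivial th x0 d0.
    rewrite -/X -/Xt -/al -/(q d) in h1 h2.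
    have d1 := INR_gt0 d0; have ld : ln (INR d) <= ln (X * T) by apply: ln_le.
    have ld0 := ln_INR_ge0 d0; have wd := w_ge0 d.
    have g0 := gk_gt0 al (INR d / X); have g1 := gk_le1 (INR d / X) al0.
    have b1 : q d <= Xt * (1 + 2 * ln (X * T)) * w d.
      apply: (Rle_trans _ _ _ h2).
      have -> : Xt * (1 + 2 * ln (X * T)) * w d = Xt * 1 * ((1 + 2 * ln (X * T)) * w d) by ring.
      apply: Rmult_le_compat.
      - by apply: Rmult_le_pos; lra.
      - by apply: Rmult_le_pos; lra.
      - by apply: Rmult_le_compat_l; lra.
      - by apply: Rmult_le_compat_r; lra.
    have b2 : 0 <= m d <= Xt * (1 + 2 * ln (X * T)) * w d.
      rewrite /m; split.
        by apply: Rmult_le_pos; apply: Rmult_le_pos; lra.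
      have -> : c * Xt * (w d * gk al (INR d / X)) = Xt * w d * (c * gk al (INR d / X)) by ring.
      have -> : Xt * (1 + 2 * ln (X * T)) * w d = Xt * w d * (1 + 2 * ln (X * T)) by ring.
      apply: Rmult_le_compat_l; first by apply: Rmult_le_pos; lra.
      have : c * gk al (INR d / X) <= 1 * 1 by apply: Rmult_le_compat; lra.
      by lra.
    by apply: Rabs_le; lra.
  rewrite rsum_scal.
  have hr := @sum_w_large_rad (X * T) r XT1 (exp_pos _).
  have -> : Xt * ((1 + 2 * ln (X * T)) * (1 + ln (X * T)) * W 1 (X * T / r)) =
    Xt * (1 + 2 * ln (X * T)) * (W 1 (X * T / r) * (1 + ln (X * T))) by ring.
  by apply: Rmult_le_compat_l => //; apply: Rmult_le_pos; lra.
have -> : near + far - mm = (near - mm) + far by ring.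
apply: (Rle_trans _ _ _ (Rabs_triang _ _)); rewrite (Rabs_pos_eq far) //.
by rewrite [X in _ <= X]Rmult_plus_distr_l; lra.
Qed.

Lemma ev_exp_neg c k : 0 < c -> ev (fun v => exp (- (c * v)) <= / v ^ k).
Proof.
move=> c0; apply: (ev_mp (ev_ln_pow (INR k / c) 1)); exists 1 => v v1; rewrite pow_1 => h.
rewrite exp_Ropp; apply: Rinv_le_contravar; first by apply: pow_lt; lra.
rewrite -(exp_ln (v ^ k)); last by apply: pow_lt; lra.
apply: exp_le; rewrite ln_pow_nat; last by lra.
have := Rmult_le_compat_l c _ _ (Rlt_le _ _ c0) h.
by have -> : c * (INR k / c * ln v) = INR k * ln v by field; lra.
Qed.

(** Every error is at most [v^-3] times [W], and passing from [W] to [H] costs [C Mv <= C v], so the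
    total is below [1 / v <= eps]. The window for [ln x] lets one [v], hence one kernel sum [H],
    serve both [x] and [zx]. *)
Lemma S_count_main theta Lam B C : 0 < theta < 1 -> 4 + 2 / (1 - theta) <= Lam -> 5 <= B -> 1 <= C ->
  ev (fun v => regular (theta / (1 - theta)) Lam B C v -> forall x N, 1 <= x -> x <= INR N ->
    9 / 10 * v <= (1 - theta) * ln x -> (1 - theta) * ln x <= 11 / 10 * v ->
    Rabs (INR (S_count theta x) - sqf_density N * exp (theta * ln x) *
      H (theta / (1 - theta)) (exp (B * ln v)) 1 (exp ((1 - theta) * ln x))) <=
    eps v * (exp (theta * ln x) *
      H (theta / (1 - theta)) (exp (B * ln v)) 1 (exp ((1 - theta) * ln x)))).
Proof.
move=> th Lam4 B5 C1; set al := theta / (1 - theta).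
pose la := / (1 - theta); have la1 : 1 <= la by rewrite -Rinv_1; apply: Rinv_le_contravar; lra.
have lE : 2 / (1 - theta) = 2 * la by [].
have t10 : 0 < theta / 10 by lra.
have se0 : 0 < sieve_err by exact: exp_pos.
apply: (ev_mp (ev_exp_neg 3 t10)); apply: (ev_mp (ev_M_ge (120 * C / theta) 2)).
apply: (ev_mp (ev_ln_pow (2 * (B / theta)) 1)).
apply: (ev_mp ev_Mv).
(* Ensures [2 C (sieve_err + 30 + 16 la) <= v] with room to spare; 30 stems from the large radicals
   and 16 from the far range. *)
exists (4 + 6 * C * sieve_err + 180 * C + 96 * C * la) => v vbig [l1 v1 M1 [MM Mlev _ _ _]].
rewrite pow_1 => vB Mbig e3 rg x N x1 xN lx1 lx2.
have [_ _ _ _ _ _ eM evM BL _ hg _ hdec hlo _] := rg.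
have [eps0 eps1 iv _] := reg_eps_bounds rg.
have cs0 : 0 <= C * sieve_err by apply: Rmult_le_pos; lra.
have cl0 : 0 <= C * la by apply: Rmult_le_pos; lra.
have v4 : 4 <= v by lra.
have LB : B * ln v <= theta / 2 * v.
  have := Rmult_le_compat_l (theta / 2) _ _ ltac:(lra) vB.
  by have -> : theta / 2 * (2 * (B / theta) * ln v) = B * ln v by field; lra.
have x0 : 0 < x by lra.
have lx0 : 0 <= ln x by rewrite -ln_1; apply: ln_le; lra.
set X := exp ((1 - theta) * ln x); set T := exp (B * ln v) in hg hlo *.
have X0 : 0 < X by exact: exp_pos.
have lX : ln X = (1 - theta) * ln x by rewrite ln_exp.
have lT : ln T = B * ln v by rewrite ln_exp.
have Tv : v ^ 5 <= T.
  rewrite -(exp_ln (v ^ 5)); last by apply: pow_lt; lra.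
  rewrite ln_pow_nat; last by lra.
  apply: exp_le; apply: Rmult_le_compat_r; first by lra.
  by rewrite /=; lra.
have v5 : 4 <= v ^ 5.
  apply: (Rle_trans _ (v ^ 1)); first by rewrite pow_1.
  by apply: Rle_pow; [lra | lia].
have T4 : 4 <= T by lra.
have T0 : 0 < T by lra.
have lxla : ln x = la * ((1 - theta) * ln x) by rewrite /la; field; lra.
have lxv : 9 / 10 * v <= ln x.
  have : (1 - theta) * ln x <= 1 * ln x by apply: Rmult_le_compat_r; lra.
  by lra.
have lxV : ln x <= 11 / 10 * (la * v).
  rewrite lxla; have := Rmult_le_compat_l la _ _ ltac:(lra) lx2; lra.
have lXT : ln (X * T) = (1 - theta) * ln x + B * ln v by rewrite ln_mult // lX lT.
have XT0 : 0 < X * T by apply: Rmult_lt_0_compat.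
have tl : theta * (9 / 10 * v) <= theta * ln x by apply: Rmult_le_compat_l; lra.
have XTx : X * T <= x.
  rewrite -(exp_ln (X * T)) //; apply: (Rle_trans _ (exp (ln x))); last by rewrite exp_ln //; lra.
  rewrite lXT; apply: exp_le.
  by have := Rmult_lt_0_compat theta v ltac:(lra) ltac:(lra); lra.
have Ce : C * eps v <= 1.
  have [_ _ _ hC] := reg_eps_bounds rg; apply: Rle_trans hC; apply: Rmult_le_compat_r; first by lra.
  have C6 : C <= C ^ 6 by rewrite -{1}(pow_1 C); apply: Rle_pow; [lra | lia].
  have L8 : 1 <= ln v ^ 8 by apply: pow_R1_Rle.
  have C60 : 0 <= C ^ 6 by apply: pow_le; lra.
  by have := Rmult_le_compat_l _ _ _ C60 L8; lra.
have lav : v <= la * v.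
  by have := Rmult_le_compat_r v _ _ ltac:(lra) la1; lra.
have LamV : 4 * v + 2 * (la * v) <= Lam * v.
  by have := Rmult_le_compat_r v _ _ ltac:(lra) Lam4; rewrite lE; lra.
have Hg z : X <= z -> z < x -> W 1 (T * z) <= 2 * W 1 z.
  move=> z1 z2; have z0 : 0 < z by lra.
  have lz1 : ln X <= ln z by apply: ln_le.
  have lz2 : ln z <= ln x by apply: ln_le; lra.
  have := hg 1%N z erefl erefl z0 ltac:(lra) ltac:(lra) => h; apply: (Rle_trans _ _ _ h).
  by apply: Rmult_le_compat_r; [exact: W_ge0 | lra].
have XXT : X <= X * T by have := Rmult_le_compat_l X _ _ (Rlt_le _ _ X0) (ltac:(lra) : 1 <= T); lra.
have := @S_count_approx theta x T N th x1 T4 xN XTx (fun z z1 => Hg z ltac:(rewrite -/X in z1; lra)).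
rewrite -/X -/al => h; apply: (Rle_trans _ _ _ h).
have -> : eps v * (exp (theta * ln x) * H al T 1 X) = exp (theta * ln x) * (eps v * H al T 1 X) by ring.
apply: Rmult_le_compat_l; first exact/Rlt_le/exp_pos.
have hW2 : W 1 (X * T) <= 2 * W 1 X.
  rewrite Rmult_comm; apply: Hg; first by lra.
  by apply: (Rlt_le_trans _ (X * T)) => //; have := Rmult_lt_compat_l X _ _ X0 (ltac:(lra) : 1 < T); lra.
have hl := hlo 1%N X erefl erefl X0 ltac:(lra) ltac:(lra).
set h0 := H al T 1 X in hl *; have h00 : 0 <= h0 by exact: H_ge0.
have hWv : W 1 (X * T) <= 2 * C * v * h0.
  have : C * Mv v * h0 <= C * v * h0 by apply: Rmult_le_compat_r => //; apply: Rmult_le_compat_l; lra.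
  by lra.
set w1 := W 1 (X * T) in hWv *; have w10 : 0 <= w1 by exact: W_ge0.
have t1 : sieve_err * exp (- (theta * ln x / 8)) <= sieve_err * / v ^ 3.
  apply: Rmult_le_compat_l; first by lra.
  apply: Rle_trans e3; apply: exp_le; have := Rmult_lt_0_compat theta v ltac:(lra) ltac:(lra); lra.
set r := exp (theta * ln x / 18).
have r1 : 1 <= r by rewrite /r -exp_0; apply: exp_le; have := Rmult_le_pos theta _ ltac:(lra) lx0; lra.
(* [ln r] is of order [v], far beyond the [6 C Mv ln v] over which the decay of [W] reaches
   [v^-6]. *)
have t2 : W 1 (X * T / r) <= 2 * / v ^ 6 * w1.
  apply: (Rle_trans _ _ _ (hdec 1%N (X * T) r erefl erefl XT0 ltac:(rewrite lXT; lra) r1)).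
  apply: Rmult_le_compat_r => //; apply: Rmult_le_compat_l; first by lra.
  rewrite exp_Ropp; apply: Rinv_le_contravar; first by apply: pow_lt; lra.
  rewrite -(exp_ln (v ^ 6)); last by apply: pow_lt; lra.
  apply: exp_le; rewrite ln_pow_nat; last by lra.
  rewrite ln_exp; apply/Rle_div_l'; first by apply: Rmult_lt_0_compat; lra.
  have M6 : 120 * C / theta * ln v * ln v * Mv v <= v * ln v.
    rewrite -MM; apply: Rmult_le_compat_r; first by lra.
    by move: Mbig; rewrite /= Rmult_1_r; lra.
  have M7 : 120 * C / theta * ln v * Mv v <= v.
    apply: (Rmult_le_reg_r (ln v)); first by lra.
    by lra.
  have M8 : 6 * C * ln v * Mv v <= theta / 20 * v.
    have := Rmult_le_compat_l (theta / 20) _ _ ltac:(lra) M7.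
    by have -> : theta / 20 * (120 * C / theta * ln v * Mv v) = 6 * C * ln v * Mv v by field; lra.
  have -> : C * Mv v * (INR 6 * ln v) = 6 * C * ln v * Mv v by rewrite /=; ring.
  by have := Rmult_lt_0_compat theta v ltac:(lra) ltac:(lra); lra.
have pv3 : 0 < / v ^ 3 by apply: Rinv_0_lt_compat; apply: pow_lt; lra.
have lXT2 : 0 <= ln (X * T) <= 2 * v.
  rewrite lXT; split; last by lra.
  by apply: Rplus_le_le_0_compat; apply: Rmult_le_pos; lra.
have a2 : (1 + 2 * ln (X * T)) * (1 + ln (X * T)) * W 1 (X * T / r) <= 5 * v * (3 * v) * (2 * / v ^ 6 * w1).
  apply: Rmult_le_compat.
  - by apply: Rmult_le_pos; lra.
  - exact: W_ge0.
  - by apply: Rmult_le_compat; lra.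
  - exact: t2.
have a3 : (1 + 2 * ln x) * (4 / T) * w1 <= 4 * (la * v) * (4 * / v ^ 5) * w1.
  apply: Rmult_le_compat_r => //; apply: Rmult_le_compat.
  - by lra.
  - by apply/Rlt_le/Rdiv_lt_0_compat; lra.
  - by lra.
  - by apply: Rmult_le_compat_l; [lra | apply: Rinv_le_contravar; lra].
have a1 : sieve_err * exp (- (theta * ln x / 8)) * w1 <= sieve_err * / v ^ 3 * w1 by apply: Rmult_le_compat_r.
apply: (Rle_trans _ (sieve_err * / v ^ 3 * w1 + 5 * v * (3 * v) * (2 * / v ^ 6 * w1) + 4 * (la * v) * (4 * / v ^ 5) * w1)).
  by lra.
have -> : sieve_err * / v ^ 3 * w1 + 5 * v * (3 * v) * (2 * / v ^ 6 * w1) + 4 * (la * v) * (4 * / v ^ 5) * w1 =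
   (sieve_err * / v ^ 3 + 30 * / v ^ 4 + 16 * la * / v ^ 4) * w1 by field; lra.
have v43 : / v ^ 4 <= / v ^ 3.
  by apply: Rinv_le_contravar; [apply: pow_lt; lra | apply: Rle_pow; [lra | lia]].
have pv4 : 0 < / v ^ 4 by apply: Rinv_0_lt_compat; apply: pow_lt; lra.
apply: (Rle_trans _ ((sieve_err + 30 + 16 * la) * / v ^ 3 * (2 * C * v * h0))).
  apply: Rmult_le_compat => //.
    have := Rmult_lt_0_compat _ _ se0 pv3; have := Rmult_lt_0_compat la _ ltac:(lra) pv4; lra.
  have := Rmult_le_compat_l la _ _ ltac:(lra) v43; lra.
have -> : (sieve_err + 30 + 16 * la) * / v ^ 3 * (2 * C * v * h0) =
   (2 * C * (sieve_err + 30 + 16 * la) / v) * (/ v) * h0 by field; lra.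
apply: Rmult_le_compat_r => //; rewrite -[X in _ <= X]Rmult_1_l; apply: Rmult_le_compat => //.
- by apply: Rmult_le_pos; [ lra | apply/Rlt_le/Rinv_0_lt_compat; lra].
- by apply/Rlt_le/Rinv_0_lt_compat; lra.
apply: (Rmult_le_reg_r v); first by lra.
by rewrite /Rdiv Rmult_assoc Rinv_l; lra.
Qed.

(** * Comparison of the counting function at [x] and [zx] *)

Lemma eps_le theta x : 0 < theta < 1 -> 1 <= ln x -> 1 <= (1 - theta) * ln x ->
  eps ((1 - theta) * ln x) <= sqrt (/ (1 - theta)) * sqrt (ln (ln x) / ln x).
Proof.
move=> th lx v1; have i0 : 0 < / (1 - theta) by apply: Rinv_0_lt_compat; lra.
have llx : 0 <= ln (ln x) by rewrite -ln_1; apply: ln_le; lra.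
rewrite -sqrt_mult; [|lra|by apply: Rmult_le_pos; [lra | apply/Rlt_le/Rinv_0_lt_compat; lra]].
apply: sqrt_le_1_alt.
have -> : / (1 - theta) * (ln (ln x) / ln x) = ln (ln x) / ((1 - theta) * ln x) by field; lra.
apply: Rmult_le_compat_r; first by apply/Rlt_le/Rinv_0_lt_compat; lra.
apply: ln_le; first by lra.
by have : (1 - theta) * ln x <= 1 * ln x by [apply: Rmult_le_compat_r; lra]; lra.
Qed.

Theorem theorem2 (theta A : R) :
  0 < theta < 1 -> 0 < A ->
  exists x0 C : R, 0 < C /\
    forall x z : R, x0 <= x -> 0 < z ->
      Rabs (ln z) <= A * ln (ln x) ->
      Rabs (INR (S_count theta (z * x)) - Rpower z theta * INR (S_count theta x))
        <= C * Rpower z theta * INR (S_count theta x) * sqrt (ln (ln x) / ln x).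
Proof.
move=> th A0; pose al := theta / (1 - theta); pose la := / (1 - theta).
have i0 : 0 < la by apply: Rinv_0_lt_compat; lra.
have al0 : 0 < al by apply: Rdiv_lt_0_compat; lra.
have i2 : 4 <= 4 + 2 / (1 - theta) by rewrite /Rdiv -/la; lra.
have [B [C [K [B5 K0 ev1]]]] := @H_slow al _ (2 * A) 5 al0 i2 ltac:(lra).
have C1 : 1 <= C by case: ev1 => v0 /(_ v0 (Rle_refl _)) [[]].
(* [20 A ln v <= v] keeps the shift [2 A ln v] within [v / 10], so that both points lie in the
   window of the scale [v]; [4 eps <= 1] keeps the approximation error below half of the density. *)
have [v0 hv] : ev (fun v => [/\ 4 * eps v <= 1, ln la <= ln v, 20 * A * ln v <= v &
    [/\ regular al (4 + 2 / (1 - theta)) B C v,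
    (forall X t, 0 < X -> 9 / 10 * v <= ln X -> ln X <= 11 / 10 * v -> 0 < t ->
      Rabs (ln t) <= 2 * A * ln v ->
      Rabs (H al (exp (B * ln v)) 1 (t * X) - H al (exp (B * ln v)) 1 X) <=
      K * eps v * H al (exp (B * ln v)) 1 X) &
    forall x N, 1 <= x -> x <= INR N ->
      9 / 10 * v <= (1 - theta) * ln x -> (1 - theta) * ln x <= 11 / 10 * v ->
      Rabs (INR (S_count theta x) - sqf_density N * exp (theta * ln x) *
        H al (exp (B * ln v)) 1 (exp ((1 - theta) * ln x))) <=
      eps v * (exp (theta * ln x) * H al (exp (B * ln v)) 1 (exp ((1 - theta) * ln x)))]]).
  apply: (ev_mp (ev_eps 4)); apply: (ev_mp (ev_ln (ln la))); apply: (ev_mp (ev_ln_pow (20 * A) 1)).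
  apply: (ev_mp ev1); apply: (ev_mp (S_count_main th (Rle_refl _) B5 C1)).
  by apply: ev_all => v hS [rg hH]; rewrite pow_1 => h1 h2 h3; split=> //; split=> // x N; exact: hS.
(* This [x0] gives [v >= v0] and [v >= 1]. In the constant, [2 K + 2] is the total relative error, 4
   converts the main term into [S_count], and [sqrt la] converts [eps] at [v] to the scale
   [ln x]. *)
exists (exp (Rmax v0 1 * la)), (8 * (K + 1) * sqrt la); split.
  by apply: Rmult_lt_0_compat; [lra | exact: sqrt_lt_R0].
move=> x z xx z0 lz; pose v := (1 - theta) * ln x.
have x0 : 0 < x by have := exp_pos (Rmax v0 1 * la); lra.
have lx : Rmax v0 1 * la <= ln x by rewrite -[X in X <= _]ln_exp; apply: ln_le => //; exact: exp_pos.
have vm : Rmax v0 1 <= v.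
  have := Rmult_le_compat_l (1 - theta) _ _ ltac:(lra) lx.
  by have -> : (1 - theta) * (Rmax v0 1 * la) = Rmax v0 1 by rewrite /la; field; lra.
have v1 : 1 <= v by have := Rmax_r v0 1; lra.
have lxE : ln x = v * la by rewrite /v /la; field; lra.
have lx1 : v <= ln x.
  have lx0 : 0 <= ln x by rewrite lxE; apply: Rmult_le_pos; lra.
  by have := Rmult_le_pos theta _ ltac:(lra) lx0; rewrite /v; lra.
have [e4 lla lA [rg hH hS]] := hv v (Rle_trans _ _ _ (Rmax_l v0 1) vm).
have [e0 _ _ _] := reg_eps_bounds rg.
(* [ln (ln x)] exceeds [ln v] by the constant [ln la]; doubling absorbs it, which is why slow
   variation is invoked with [2 A]. *)
have llx : ln (ln x) <= 2 * ln v by rewrite lxE ln_mult; lra.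
have lzv : Rabs (ln z) <= 2 * A * ln v.
  by apply: (Rle_trans _ _ _ lz); have := Rmult_le_compat_l A _ _ (Rlt_le _ _ A0) llx; lra.
(* Multiplying [x] by [z] dilates [X = x^(1 - theta)] by [z^(1 - theta)]. *)
pose t := exp ((1 - theta) * ln z); have lt : ln t = (1 - theta) * ln z by rewrite ln_exp.
have ltv : Rabs (ln t) <= 2 * A * ln v.
  rewrite lt Rabs_mult (Rabs_pos_eq (1 - theta)); last by lra.
  apply: Rle_trans lzv; rewrite -[X in _ <= X]Rmult_1_l.
  by apply: Rmult_le_compat_r; [exact: Rabs_pos | lra].
have lzx : ln (z * x) = ln z + ln x by rewrite ln_mult.
have lzx' : (1 - theta) * ln (z * x) = ln t + v by rewrite lzx lt /v; ring.
have [lt1 lt2] := Rabs_bounds ltv; have [lz1 lz2] := Rabs_bounds lzv.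
have x1 : 1 <= x by rewrite -(exp_ln x) // -exp_0; apply: exp_le; lra.
have zx0 : 0 < z * x by apply: Rmult_lt_0_compat.
have zx1 : 1 <= z * x by rewrite -(exp_ln (z * x)) // -exp_0; apply: exp_le; lra.
(* A common [N] gives both approximations the same density factor. *)
have [N hN] := nat_above (Rmax x (z * x)).
have xN : x <= INR N by have := Rmax_l x (z * x); lra.
have zxN : z * x <= INR N by have := Rmax_r x (z * x); lra.
have s0 := hS x N x1 xN ltac:(rewrite -/v; lra) ltac:(rewrite -/v; lra).
have s1 := hS (z * x) N zx1 zxN ltac:(lra) ltac:(lra).
have := hH (exp v) t (exp_pos _) ltac:(rewrite ln_exp; lra) ltac:(rewrite ln_exp; lra) (exp_pos _) ltv.
have tX : t * exp v = exp ((1 - theta) * ln (z * x)) by rewrite -exp_plus lzx' lt.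
rewrite tX; move: s0 s1; rewrite -/v.
have -> : exp (theta * ln (z * x)) = Rpower z theta * exp (theta * ln x).
  by rewrite /Rpower -exp_plus lzx; congr exp; ring.
set H0 := H _ _ _ (exp v); set H1 := H _ _ _ (exp (_ * ln (z * x))).
set Y := exp (theta * ln x); set Z := Rpower z theta; set c := sqf_density N.
set S0 := INR _; set S1 := INR _ => s0 s1 hh.
have Y0 : 0 < Y by exact: exp_pos.
have Z0 : 0 < Z by exact: exp_pos.
have H00 : 0 <= H0 by exact: H_ge0.
have [c1 c2] := conj (sqf_density_ge N) (sqf_density_le1 N); rewrite -/c in c1 c2.
have p0 : 0 <= Y * H0 by apply: Rmult_le_pos; lra.
have [s01 s02] := Rabs_bounds s0; have [s11 s12] := Rabs_bounds s1; have [h1 h2] := Rabs_bounds hh.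
set e := eps v in e4 e0 s0 s01 s02 s1 s11 s12 hh h1 h2.
(* The density is at least 1/2 and the relative error at most 1/4. *)
have S0lo : Y * H0 <= 4 * S0.
  have a1 : / 2 * (Y * H0) <= c * (Y * H0) by apply: Rmult_le_compat_r.
  have a2 : e * (Y * H0) <= / 4 * (Y * H0) by apply: Rmult_le_compat_r; lra.
  by lra.
have ebd : e <= sqrt la * sqrt (ln (ln x) / ln x) by apply: eps_le => //; lra.
have H1le : H1 <= (1 + K) * H0.
  have : K * e * H0 <= K * H0 by apply: Rmult_le_compat_r => //; rewrite -[X in _ <= X]Rmult_1_r; apply: Rmult_le_compat_l; lra.
  by lra.
apply: (Rle_trans _ (Z * Y * H0 * e * (2 * K + 2))).
  have -> : S1 - Z * S0 = (S1 - c * (Z * Y) * H1) + c * (Z * Y) * (H1 - H0) - Z * (S0 - c * Y * H0) by ring.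
  have zy : 0 < Z * Y by apply: Rmult_lt_0_compat.
  apply: (Rle_trans _ (e * (Z * Y * H1) + Z * Y * (K * e * H0) + Z * (e * (Y * H0)))).
    apply: (Rle_trans _ _ _ (Rabs_triang _ _)); rewrite Rabs_Ropp.
    apply: Rplus_le_compat; last first.
      by rewrite Rabs_mult (Rabs_pos_eq Z); [apply: Rmult_le_compat_l; lra | lra].
    apply: (Rle_trans _ _ _ (Rabs_triang _ _)); apply: Rplus_le_compat => //.
    rewrite Rabs_mult (Rabs_pos_eq (c * _)); last by apply: Rmult_le_pos; lra.
    apply: Rmult_le_compat => //; first by apply: Rmult_le_pos; lra.
      exact: Rabs_pos.
    by rewrite -[X in _ <= X]Rmult_1_l; apply: Rmult_le_compat_r; lra.
  have : e * (Z * Y * H1) <= e * (Z * Y * ((1 + K) * H0)).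
    by apply: Rmult_le_compat_l; [lra | apply: Rmult_le_compat_l; lra].
  by lra.
have -> : Z * Y * H0 * e * (2 * K + 2) = Z * (2 * K + 2) * (Y * H0 * e) by ring.
have -> : 8 * (K + 1) * sqrt la * Z * S0 * sqrt (ln (ln x) / ln x) =
  Z * (2 * K + 2) * (4 * S0 * (sqrt la * sqrt (ln (ln x) / ln x))) by ring.
apply: Rmult_le_compat_l; first by apply: Rmult_le_pos; lra.
by apply: Rmult_le_compat; lra.
Qed.
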